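(* Let $g\in H^\infty(\mathbb{D})$ be non-constant and such that $g(\mathbb{D})\cap\mathbb{D}=\varnothing$ and the set $\{z\in\mathbb{T}:|g(z)|=1\}$ has positive Lebesgue measure. Then the coanalytic Toeplitz operator $T_g^*$ is weakly hypercyclic on $H^2(\mathbb{D})$.
   Context: $\mathbb{D}$ is the open unit disk, $\mathbb{T}$ the unit circle with normalized Lebesgue measure $\lambda$; functions in $H^\infty(\mathbb{D})$ are identified with their (a.e. defined) non-tangential boundary values on $\mathbb{T}$. $H^2(\mathbb{D})$ is regarded as the closed subspace of $L^2(\mathbb{T})$. For $g\in L^\infty(\mathbb{T})$, the Toeplitz operator is $T_g=PM_g$ on $H^2(\mathbb{D})$, where $M_g$ is multiplication by $g$ and $P$ is the orthogonal projection of $L^2(\mathbb{T})$ onto $H^2(\mathbb{D})$; $T_g^*$ is its Hilbert space adjoint. A bounded operator $T$ on a Banach space $X$ is weakly hypercyclic if there is $x\in X$ such that $\{T^nx:n\geq 0\}$ is dense in $X$ in the weak topology. *)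

(* Defs.v *)
(* Complex numbers: C R := R[i] (mathcomp-real-closed),
   with R : realType; C R is a numClosedFieldType, hence (via
   numFieldNormedType.Exports) a normed module over itself, so that
   [derivable f z 1] is complex differentiability. *)
From HB Require Import structures.
From mathcomp Require Import all_boot all_order all_algebra.
From mathcomp Require Import complex.
From mathcomp Require Import all_classical all_reals all_analysis.
Set Implicit Arguments. Unset Strict Implicit. Unset Printing Implicit Defensive.
Import Order.TTheory GRing.Theory Num.Theory.
Import numFieldNormedType.Exports.
Local Open Scope classical_set_scope.
Local Open Scope ring_scope.

Definition C (R : realType) : numClosedFieldType := R[i].

Definition RtoC (R : realType) (r : R) : C R := Complex r 0.

(* the point e^{2 pi i t} of the unit circle T (t in [0,1) parametrises T,
   Lebesgue measure on [0,1) is the normalised measure lambda) *)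
Definition circ (R : realType) (t : R) : C R :=
  Complex (cos (2 * pi * t)) (sin (2 * pi * t)).

Definition disc (R : realType) : set (C R) := [set z | `|z| < 1].

Definition Hinfty (R : realType) (g : C R -> C R) : Prop :=
  (forall z, disc z -> derivable g z 1) /\
  (exists M : R, forall z, disc z -> `|g z| <= RtoC M).

(* radial boundary value: g(r e^{2 pi i t}) -> L as r -> 1^- ;
   for g in H^oo this exists for a.e. t (Fatou) and equals the
   non-tangential boundary value *)
Definition boundary_value (R : realType) (g : C R -> C R) (t : R) (L : C R) : Prop :=
  (fun r : R => g (RtoC r * circ t)) @ at_left 1 --> L.

Definition unimodular_set (R : realType) (g : C R -> C R) : set R :=
  [set t | 0 <= t < 1 /\ exists L : C R, boundary_value g t L /\ `|L| = 1].

(* H^2 is realised through Taylor coefficients: f in H^2 is represented by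
   its coefficient sequence (f_k), with sum |f_k|^2 < oo; by Parseval this
   is the closed subspace of L^2(T) of functions with vanishing negative
   Fourier coefficients, and <f,h>_{L^2(T)} = sum_k f_k conj(h_k). *)

Definition H2 (R : realType) (f : nat -> C R) : Prop :=
  cvg (series (fun k => `|f k| ^+ 2) @ \oo).

Definition ip (R : realType) (f h : nat -> C R) : C R :=
  lim (series (fun k => f k * Num.conj (h k)) @ \oo).

Definition pseries_at (R : realType) (f : nat -> C R) (z : C R) : C R :=
  lim (series (fun k => f k * z ^+ k) @ \oo).

(* Toeplitz operator T_g with g in H^oo: T_g h = P(g h) = g h.
   [Tg_rel g h k] says k = T_g h, i.e. the power series of k equals
   g times the power series of h on D. *)
Definition Tg_rel (R : realType) (g : C R -> C R) (h k : nat -> C R) : Prop :=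
  forall z, disc z ->
    series (fun j => k j * z ^+ j) @ \oo --> g z * pseries_at h z.

Definition is_Tg_adjoint (R : realType) (g : C R -> C R)
    (A : (nat -> C R) -> (nat -> C R)) : Prop :=
  (forall f, H2 f -> H2 (A f)) /\
  (forall f h k, H2 f -> H2 h -> H2 k -> Tg_rel g h k -> ip (A f) h = ip f k).

(* weak hypercyclicity on H^2: some orbit {A^n x} meets every basic weakly
   open set { u : |<u - y, e_i>| < eps, i < m } (y, e_i in H^2, eps > 0) *)
Definition weakly_hypercyclic (R : realType)
    (A : (nat -> C R) -> (nat -> C R)) : Prop :=
  exists x, H2 x /\
    forall (y : nat -> C R) (m : nat) (e : nat -> nat -> C R) (eps : R),
      H2 y -> (forall i, (i < m)%N -> H2 (e i)) -> 0 < eps ->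
      exists n : nat, forall i, (i < m)%N ->
        `|ip (fun k => iter n A x k - y k) (e i)| < RtoC eps.

(* Main.v *)
(* Let [gs] be the radial boundary function of [g] on a compact set [E] of positive
   measure where it is unimodular, and let [P] be the analytic projection. For [v]
   supported on [E], the adjoint [T] of [T_g] maps [P v] to [P (conj gs v)]. As [1/g]
   is bounded by 1 and is smaller than 1 in modulus inside the disc, [P (gs^n v)]
   tends to 0 in norm; moreover the vectors [P v] are dense in [H^2]. Set [x =
   \sum_j P (gs^(n_j) u_j)] for targets [u_j] and a sparse sequence [n_j]. Then
   [T^(n_i) x = P w_i + P u_i + o(1)], where [w_i = conj gs^(n_i) \sum_(j < i)
   gs^(n_j) u_j] has squared norm O(i), because multiplication by [gs] is isometric
   on [E], and the [w_i] are almost orthogonal. By Bessel, [\sum_i |<P w_i, e>|^2 /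
   i] is finite for each [e]; if a target [u] recurs along indices whose reciprocals
   have divergent sum, some [<P w_i, e>] along these indices is small, for finitely
   many [e] at once. So the orbit of [x] comes weakly close to [P u]. *)
Require Import Defs.
From HB Require Import structures.
From mathcomp Require Import all_boot all_order all_algebra.
From mathcomp Require Import complex.
From mathcomp Require Import all_classical all_reals all_analysis.
From mathcomp Require Import measurable_realfun.
From mathcomp Require Import ring lra.
Import Order.TTheory GRing.Theory Num.Theory.
Import numFieldNormedType.Exports.
Local Open Scope classical_set_scope.
Local Open Scope ring_scope.
Set Implicit Arguments. Unset Strict Implicit. Unset Printing Implicit Defensive.

(** * The complex modulus *)

(** Complex differentiability is the only analytic input, so the Taylor expansion on the disc is
    derived from the constancy of circle means, which Green's formula yields in logarithmic polar
    coordinates. Boundary values are used only on [E]: every pairing of an analytic function with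
    its boundary function is made against a function that vanishes off [E]. At the boundary nothing
    decays, since [1/g] is unimodular on [E]. The decay is obtained by duality: a pairing over [E]
    is moved to Taylor coefficients, and these are estimated on a small circle where
    [|1/g| <= q < 1]. The density rests on polynomials [p] with [p(0) = 1] that are small in mean
    square off [E]: [conj p] projects to the constant 1, so cutting it off to [E] changes the
    projection little. For the recurrence two demands compete: the energy of the first [j] targets
    must be O(j) although their norms are unbounded, and each target must recur along indices with
    divergent reciprocal sum. The 2-adic valuation, used twice, meets both. *)

Definition nm (R : realType) (z : C R) : R := Normc.normc z.

Section ComplexModulus.
Variable R : realType.
Implicit Types (z w : C R) (r : R).

Lemma CP z w : complex.Re z = complex.Re w -> complex.Im z = complex.Im w ->
  z = w.
Proof. by case: z w => [a b] [c d] /= -> ->. Qed.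

Lemma cReD z w : complex.Re (z + w) = complex.Re z + complex.Re w.
Proof. by case: z w => [a b] [c d]. Qed.

Lemma cImD z w : complex.Im (z + w) = complex.Im z + complex.Im w.
Proof. by case: z w => [a b] [c d]. Qed.

Lemma cReN z : complex.Re (- z) = - complex.Re z.
Proof. by case: z => [a b]. Qed.

Lemma cImN z : complex.Im (- z) = - complex.Im z.
Proof. by case: z => [a b]. Qed.

Lemma cReM z w : complex.Re (z * w) =
  complex.Re z * complex.Re w - complex.Im z * complex.Im w.
Proof. by case: z w => [a b] [c d]. Qed.

Lemma cImM z w : complex.Im (z * w) =
  complex.Re z * complex.Im w + complex.Im z * complex.Re w.
Proof. by case: z w => [a b] [c d]. Qed.

Lemma cconjE z : Num.conj z = Complex (complex.Re z) (- complex.Im z).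
Proof. by case: z. Qed.

Lemma normE z : `|z| = RtoC (nm z).
Proof. by []. Qed.

Lemma RtoCD r s : RtoC (r + s) = RtoC r + RtoC s :> C R.
Proof. by apply: CP; rewrite /= ?addr0. Qed.

Lemma RtoCM r s : RtoC (r * s) = RtoC r * RtoC s :> C R.
Proof. by apply: CP; rewrite ?cReM ?cImM /=; ring. Qed.

Lemma RtoCX r n : RtoC (r ^+ n) = RtoC r ^+ n :> C R.
Proof. by elim: n => [//|n IH]; rewrite !exprS RtoCM IH. Qed.

Lemma RtoC_sum (I : Type) (s : seq I) (P : pred I) (f : I -> R) :
  RtoC (\sum_(i <- s | P i) f i) = \sum_(i <- s | P i) RtoC (f i) :> C R.
Proof.
elim: s => [|a s IH]; first by rewrite !big_nil.
by rewrite !big_cons; case: (P a); rewrite ?RtoCD IH.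
Qed.

Lemma nm_sqr z : nm z ^+ 2 = complex.Re z ^+ 2 + complex.Im z ^+ 2.
Proof. by case: z => a b; rewrite /nm /= sqr_sqrtr// addr_ge0 ?sqr_ge0. Qed.

Lemma nm_ge0 z : 0 <= nm z.
Proof. by case: z => a b; rewrite /nm /= sqrtr_ge0. Qed.

Lemma nm0 : nm (0 : C R) = 0. Proof. exact: Normc.normc0. Qed.
Lemma nm1 : nm (1 : C R) = 1. Proof. exact: Normc.normc1. Qed.

Lemma nm_eq0 z : nm z = 0 -> z = 0. Proof. exact: Normc.eq0_normc. Qed.

Lemma nmM z w : nm (z * w) = nm z * nm w. Proof. exact: Normc.normcM. Qed.

Lemma nmV z : nm z^-1 = (nm z)^-1. Proof. exact: Normc.normcV. Qed.

Lemma nmD z w : nm (z + w) <= nm z + nm w. Proof. exact: le_normcD. Qed.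

Lemma nmN z : nm (- z) = nm z. Proof. exact: normcN. Qed.

Lemma nmB z w : nm (z - w) = nm (w - z). Proof. by rewrite -nmN opprB. Qed.

Lemma nm_sub z w : nm (z - w) <= nm z + nm w.
Proof. by rewrite -(nmN w) nmD. Qed.

Lemma nmX z n : nm (z ^+ n) = nm z ^+ n.
Proof. by elim: n => [|n IH]; rewrite ?nm1// !exprS nmM IH. Qed.

Lemma nm_conj z : nm (Num.conj z) = nm z.
Proof. by rewrite cconjE; case: z => a b; rewrite /nm /= sqrrN. Qed.

Lemma nm_real r : nm (RtoC r) = `|r|.
Proof. by rewrite /nm /= expr0n addr0 sqrtr_sqr. Qed.

Lemma nm_scale (c : C R) r k : 0 <= r -> nm (c * RtoC r ^+ k) = nm c * r ^+ k.
Proof. by move=> r0; rewrite nmM nmX nm_real ger0_norm. Qed.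

Lemma nm_Re z : `|complex.Re z| <= nm z.
Proof.
by rewrite -sqrtr_sqr -[leRHS]ger0_norm ?nm_ge0// -sqrtr_sqr ler_wsqrtr// nm_sqr lerDl sqr_ge0.
Qed.

Lemma nm_Im z : `|complex.Im z| <= nm z.
Proof.
by rewrite -sqrtr_sqr -[leRHS]ger0_norm ?nm_ge0// -sqrtr_sqr ler_wsqrtr// nm_sqr lerDr sqr_ge0.
Qed.

Lemma nm_le z : nm z <= `|complex.Re z| + `|complex.Im z|.
Proof.
rewrite -(@ler_pXn2r _ 2)// ?nnegrE ?nm_ge0// ?addr_ge0// nm_sqr sqrrD !real_normK ?num_real//.
by rewrite addrAC lerDl mulrn_wge0// mulr_ge0.
Qed.

Lemma nm_sum (I : Type) (s : seq I) (P : pred I) (f : I -> C R) :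
  nm (\sum_(i <- s | P i) f i) <= \sum_(i <- s | P i) nm (f i).
Proof.
elim: s => [|a s IH]; first by rewrite !big_nil nm0.
rewrite !big_cons; case: (P a) => //.
by rewrite (le_trans (nmD _ _))// lerD2l.
Qed.

Lemma sqr_norm_conj z : z * Num.conj z = RtoC (nm z ^+ 2).
Proof.
by rewrite nm_sqr cconjE; apply: CP; rewrite ?cReM ?cImM /=; ring.
Qed.

Lemma cRe_sum (I : Type) (s : seq I) (P : pred I) (f : I -> C R) :
  complex.Re (\sum_(i <- s | P i) f i) = \sum_(i <- s | P i) complex.Re (f i).
Proof.
elim: s => [|a s IH]; first by rewrite !big_nil.
by rewrite !big_cons; case: (P a); rewrite ?cReD IH.
Qed.

Lemma cIm_sum (I : Type) (s : seq I) (P : pred I) (f : I -> C R) :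
  complex.Im (\sum_(i <- s | P i) f i) = \sum_(i <- s | P i) complex.Im (f i).
Proof.
elim: s => [|a s IH]; first by rewrite !big_nil.
by rewrite !big_cons; case: (P a); rewrite ?cImD IH.
Qed.

Lemma discE z : disc z <-> nm z < 1.
Proof. by rewrite /disc /= normE ltcR. Qed.

Lemma normC_lt z r : (`|z| < RtoC r) = (nm z < r).
Proof. by rewrite normE ltcR. Qed.

(** In the partial order of [C R] a positive element is a positive real, so real tolerances
    suffice. *)
Lemma cvgC_eps (T : Type) (F : set_system T) {FF : Filter F} (u : T -> C R) (L : C R) :
  u @ F --> L <-> forall e : R, 0 < e -> \forall x \near F, nm (u x - L) < e.
Proof.
split=> [uL e e0|H].
  move/cvgrPdist_lt : uL => /(_ (RtoC e)); rewrite ltcR => /(_ e0).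
  by apply: filterS => x; rewrite normC_lt nmB.
apply/cvgrPdist_lt => -[a b]; rewrite ltcE /= => /andP[/eqP -> a0].
have := H _ a0; apply: filterS => x.
by rewrite -normC_lt distrC.
Qed.

Lemma cvgC_nm (T : Type) (F : set_system T) {FF : Filter F} (u : T -> C R) (L : C R) :
  u @ F --> L <-> nm (u x - L) @[x --> F] --> (0 : R).
Proof.
rewrite cvgC_eps; split=> [H|/cvgrPdist_lt H e e0].
  apply/cvgrPdist_lt => e e0; have := H _ e0; apply: filterS => x.
  by rewrite sub0r normrN ger0_norm ?nm_ge0.
have := H _ e0; apply: filterS => x.
by rewrite sub0r normrN ger0_norm ?nm_ge0.
Qed.

Lemma cvgC_ReIm (T : Type) (F : set_system T) {FF : Filter F} (u : T -> C R) (L : C R) :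
  u @ F --> L <-> (complex.Re (u x) @[x --> F] --> complex.Re L) /\
                  (complex.Im (u x) @[x --> F] --> complex.Im L).
Proof.
rewrite cvgC_eps; split=> [H|[/cvgrPdist_lt H1 /cvgrPdist_lt H2] e e0].
  split; apply/cvgrPdist_lt => e e0; have := H _ e0; apply: filterS => x h;
    rewrite (le_lt_trans _ h)// nmB.
    by rewrite (le_trans _ (nm_Re _))// cReD cReN.
  by rewrite (le_trans _ (nm_Im _))// cImD cImN.
have e20 : 0 < e / 2 by rewrite divr_gt0.
near=> x.
have h1 : `|complex.Re L - complex.Re (u x)| < e / 2 by near: x; exact: H1.
have h2 : `|complex.Im L - complex.Im (u x)| < e / 2 by near: x; exact: H2.
rewrite nmB (le_lt_trans (nm_le _))// cReD cImD cReN cImN.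
by rewrite [ltRHS]splitr ltrD.
Unshelve. all: by end_near. Qed.

End ComplexModulus.

(** * Goursat's bisection and Green's formula *)

Section Goursat.
Variable R : realType.
Implicit Types (W X Y PX PY : R -> R -> R).

(** The mixed second difference is additive when a rectangle is subdivided, which is what the
    bisection exploits. *)
Definition rect_diff W (a b c d : R) := W b d - W b c - W a d + W a c.

(** One of the four quarters carries at least a fourth of the increment; the last one is taken by
    default when the other three fail. *)
Definition rect_quarter W (q : (R * R) * (R * R)) :=
  let: ((a, b), (c, d)) := q in
  let m := (a + b) / 2 in let k := (c + d) / 2 in
  let big a b c d :=
    `|rect_diff W q.1.1 q.1.2 q.2.1 q.2.2| <= 4 * `|rect_diff W a b c d| in
  if big a m c k then ((a, m), (c, k)) else
  if big m b c k then ((m, b), (c, k)) else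
  if big a m k d then ((a, m), (k, d)) else ((m, b), (k, d)).

Lemma rect_quarterP W (a b c d : R) : a <= b -> c <= d ->
  let q := rect_quarter W ((a, b), (c, d)) in
  [/\ a <= q.1.1 /\ q.1.2 <= b, q.1.2 - q.1.1 = (b - a) / 2,
      c <= q.2.1 /\ q.2.2 <= d, q.2.2 - q.2.1 = (d - c) / 2 &
      `|rect_diff W a b c d| <= 4 * `|rect_diff W q.1.1 q.1.2 q.2.1 q.2.2|].
Proof.
move=> ab cd; rewrite /rect_quarter /=.
set m := (a + b) / 2; set k := (c + d) / 2.
have [am mb] : a <= m /\ m <= b by rewrite /m; lra.
have [ck kd] : c <= k /\ k <= d by rewrite /k; lra.
have [ma bm] : m - a = (b - a) / 2 /\ b - m = (b - a) / 2 by rewrite /m; lra.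
have [kc dk] : k - c = (d - c) / 2 /\ d - k = (d - c) / 2 by rewrite /k; lra.
case: ifPn => [|h1] //=; case: ifPn => [|h2] //=; case: ifPn => [|h3] //=.
move: h1 h2 h3; rewrite -!ltNge => h1 h2 h3.
split => //; rewrite leNgt; apply/negP => h4.
have E : rect_diff W a b c d = rect_diff W a m c k + rect_diff W m b c k +
    rect_diff W a m k d + rect_diff W m b k d by rewrite /rect_diff; ring.
have : `|rect_diff W a b c d| <= `|rect_diff W a m c k| + `|rect_diff W m b c k| +
    `|rect_diff W a m k d| + `|rect_diff W m b k d|.
  by rewrite {1}E (le_trans (ler_normD _ _))// lerD2r (le_trans (ler_normD _ _))// lerD2r ler_normD.
by lra.
Qed.

(* Goursat's bisection: an additive rectangle function that is o(diam^2) at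
   every point vanishes. *)
Lemma rect_diff0 W (a b c d : R) : a <= b -> c <= d ->
  (forall s t : R, a <= s <= b -> c <= t <= d -> forall e : R, 0 < e ->
    exists2 del : R, 0 < del & forall a' b' c' d' : R,
      a <= a' <= s -> s <= b' <= b -> c <= c' <= t -> t <= d' <= d ->
      b' - a' < del -> d' - c' < del ->
      `|rect_diff W a' b' c' d'| <= e * ((b' - a') + (d' - c')) ^+ 2) ->
  rect_diff W a b c d = 0.
Proof.
move=> ab cd loc; apply/eqP; rewrite -normr_eq0 eq_le normr_ge0 andbT leNgt.
apply/negP => eta0; set eta := `|_| in eta0.
pose q n := iter n (rect_quarter W) ((a, b), (c, d)).
have qS n : q n.+1 = rect_quarter W (q n) by [].
have qP n : [/\ (q n).1.2 - (q n).1.1 = (b - a) / 2 ^+ n,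
    (q n).2.2 - (q n).2.1 = (d - c) / 2 ^+ n &
    eta <= 4 ^+ n * `|rect_diff W (q n).1.1 (q n).1.2 (q n).2.1 (q n).2.2|].
  elim: n => [|n [h1 h2 h3]]; first by rewrite !expr0 !divr1 mul1r.
  rewrite qS; move: h1 h2 h3; case: (q n) => [[a1 b1] [c1 d1]] /= h1 h2 h3.
  have ab1 : a1 <= b1.
    by rewrite -subr_ge0 h1 divr_ge0 ?exprn_ge0// subr_ge0.
  have cd1 : c1 <= d1.
    by rewrite -subr_ge0 h2 divr_ge0 ?exprn_ge0// subr_ge0.
  have [_ -> _ -> h] := rect_quarterP W ab1 cd1.
  rewrite h1 h2 !exprS !invfM; split; [ring|ring|].
  by rewrite (le_trans h3)// -mulrA mulrCA ler_pM2l// exprn_gt0.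
have wid n : (q n).1.1 <= (q n).1.2 /\ (q n).2.1 <= (q n).2.2.
  have [h1 h2 _] := qP n.
  by rewrite -!(subr_ge0 _.1) h1 h2 !divr_ge0 ?exprn_ge0 ?subr_ge0.
have step n : [/\ (q n).1.1 <= (q n.+1).1.1, (q n.+1).1.2 <= (q n).1.2,
    (q n).2.1 <= (q n.+1).2.1 & (q n.+1).2.2 <= (q n).2.2].
  have := wid n; rewrite qS; case: (q n) => [[a1 b1] [c1 d1]] /= [ab1 cd1].
  by have [[? ?] _ [? ?] _ _] := rect_quarterP W ab1 cd1.
have mono n k : [/\ (q n).1.1 <= (q (n + k)%N).1.1, (q (n + k)%N).1.2 <= (q n).1.2,
    (q n).2.1 <= (q (n + k)%N).2.1 & (q (n + k)%N).2.2 <= (q n).2.2].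
  elim: k => [|k [h1 h2 h3 h4]]; first by rewrite addn0.
  rewrite addnS; have [k1 k2 k3 k4] := step (n + k)%N.
  by split; [exact: le_trans k1|exact: le_trans h2|exact: le_trans k3|exact: le_trans h4].
have cross n k : (q n).1.1 <= (q k).1.2 /\ (q n).2.1 <= (q k).2.2.
  have [h1 _ h3 _] := mono n k; have [_ h2 _ h4] := mono k n.
  rewrite addnC in h2 h4; have [w1 w2] := wid (n + k)%N.
  by split; [exact: le_trans h1 (le_trans w1 h2)|exact: le_trans h3 (le_trans w2 h4)].
(* The nested rectangles share the point [(s, t)], where the local estimate is applied. *)
pose s := sup (range (fun n => (q n).1.1)).
pose t := sup (range (fun n => (q n).2.1)).
have sP n : (q n).1.1 <= s <= (q n).1.2.
  apply/andP; split.
    apply: ub_le_sup; last by exists n.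
    by exists (q 0%N).1.2 => _ [k _ <-]; case: (cross k 0%N).
  by apply: ge_sup => [|_ [k _ <-]]; [exists (q 0%N).1.1, 0%N|case: (cross k n)].
have tP n : (q n).2.1 <= t <= (q n).2.2.
  apply/andP; split.
    apply: ub_le_sup; last by exists n.
    by exists (q 0%N).2.2 => _ [k _ <-]; case: (cross k 0%N).
  by apply: ge_sup => [|_ [k _ <-]]; [exists (q 0%N).2.1, 0%N|case: (cross k n)].
pose L := (b - a) + (d - c).
have L0 : 0 <= L by rewrite /L; lra.
(* With this tolerance the local estimate gives [eta <= eta * L^2 / (2 * (L^2 + 1))], which is
   absurd; the [+ 1] covers [L = 0]. *)
have e0 : 0 < eta / (2 * (L ^+ 2 + 1)).
  by rewrite divr_gt0// mulr_gt0// ltr_wpDl// sqr_ge0.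
have [del del0 H] := loc s t (sP 0%N) (tP 0%N) _ e0.
have [n hn] : exists n, L / 2 ^+ n < del.
  have [n hn] : exists n : nat, L / del < n%:R.
    by exists (Num.bound (L / del)); rewrite archi_boundP// divr_ge0// ltW.
  exists n; rewrite ltr_pdivrMr ?exprn_gt0// mulrC -ltr_pdivrMr//.
  by rewrite (lt_le_trans hn)// -natrX ler_nat ltnW// ltn_expl.
have [h1 h2 h3] := qP n.
have [m1 m2 m3 m4] := mono 0%N n; rewrite add0n /= in m1 m2 m3 m4.
have /andP[s1 s2] := sP n; have /andP[t1 t2] := tP n.
have p2 : 0 < (2 ^+ n : R) by rewrite exprn_gt0.
have := H (q n).1.1 (q n).1.2 (q n).2.1 (q n).2.2.
rewrite m1 m2 m3 m4 s1 s2 t1 t2 => /(_ isT isT isT isT).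
rewrite h1 h2 -mulrDl -/L expr_div_n.
have l1 : (b - a) / 2 ^+ n < del.
  by rewrite (le_lt_trans _ hn)// ler_pM2r ?invr_gt0// /L lerDl subr_ge0.
have l2 : (d - c) / 2 ^+ n < del.
  by rewrite (le_lt_trans _ hn)// ler_pM2r ?invr_gt0// /L lerDr subr_ge0.
move=> /(_ l1 l2) hh.
have : eta <= eta / (2 * (L ^+ 2 + 1)) * L ^+ 2.
  have E4 : 4 ^+ n = (2 ^+ n) ^+ 2 :> R by rewrite -exprM mulnC exprM; congr (_ ^+ n); ring.
  apply: (le_trans h3); rewrite E4.
  apply: (le_trans (ler_wpM2l (sqr_ge0 _) hh)).
  rewrite mulrCA (ler_wpM2l (ltW e0))//.
  have p4 : (2 ^+ n) ^+ 2 != 0 :> R by rewrite !expf_neq0// pnatr_eq0.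
  by rewrite mulrC divfK.
rewrite leNgt => /negP; apply.
rewrite mulrAC ltr_pdivrMr ?mulr_gt0 ?ltr_wpDl ?sqr_ge0// ltr_pM2l//.
by have := sqr_ge0 L; lra.
Qed.

Lemma itv_dist (x x0 lo hi dd : R) : lo <= x <= hi -> lo <= x0 <= hi -> hi - lo < dd ->
  `|x - x0| <= hi - lo /\ `|x - x0| < dd.
Proof.
by move=> /andP[? ?] /andP[? ?] ?; rewrite ler_norml ltr_norml; split; apply/andP; lra.
Qed.

(* Green's formula without continuity of the partial derivatives; PX and PY
   are primitives of X in t and of Y in s. *)
Lemma green0 PX PY X Y (a b c d : R) : a <= b -> c <= d ->
  (forall s t : R, a <= s <= b -> c <= t <= d -> is_derive t 1 (PX s) (X s t)) ->
  (forall s t : R, a <= s <= b -> c <= t <= d -> is_derive s 1 (PY^~ t) (Y s t)) ->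
  (forall s0 t0 : R, a <= s0 <= b -> c <= t0 <= d -> exists al be ga : R,
    forall e : R, 0 < e -> exists2 del : R, 0 < del & forall s t : R,
      `|s - s0| < del -> `|t - t0| < del ->
      `|X s t - X s0 t0 - al * (s - s0) - be * (t - t0)|
         <= e * (`|s - s0| + `|t - t0|) /\
      `|Y s t - Y s0 t0 - ga * (s - s0) - al * (t - t0)|
         <= e * (`|s - s0| + `|t - t0|)) ->
  rect_diff (fun s t => PX s t - PY s t) a b c d = 0.
Proof.
move=> ab cd dX dY loc; apply: rect_diff0 => // s0 t0 hs0 ht0 e e0.
have [al [be [ga H]]] := loc _ _ hs0 ht0.
have e40 : 0 < e / 4 by rewrite divr_gt0.
have [del del0 {}H] := H _ e40; exists del => // a' b' c' d'.
move=> /andP[aa' a's] /andP[sb' b'b] /andP[cc' c't] /andP[td' d'd] hb hd.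
(* Degenerate rectangles are set apart because the mean value theorem needs strict inequalities. *)
have [/eqP E|nab] := boolP (a' == b').
  by rewrite E /rect_diff (_ : _ + _ = 0) ?normr0 ?(mulr_ge0 (ltW e0)) ?sqr_ge0//; ring.
have [/eqP E|ncd] := boolP (c' == d').
  by rewrite E /rect_diff (_ : _ + _ = 0) ?normr0 ?(mulr_ge0 (ltW e0)) ?sqr_ge0//; ring.
have ab' : a' < b' by rewrite lt_neqAle nab (le_trans a's).
have cd' : c' < d' by rewrite lt_neqAle ncd (le_trans c't).
have inab x : a' <= x <= b' -> a <= x <= b.
  by move=> /andP[h1 h2]; rewrite (le_trans aa' h1) (le_trans h2 b'b).
have incd x : c' <= x <= d' -> c <= x <= d.
  by move=> /andP[h1 h2]; rewrite (le_trans cc' h1) (le_trans h2 d'd).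
have aI : a' <= a' <= b' by rewrite lexx ltW.
have bI : a' <= b' <= b' by rewrite lexx ltW.
have cI : c' <= c' <= d' by rewrite lexx ltW.
have dI : c' <= d' <= d' by rewrite lexx ltW.
have sI : a' <= s0 <= b' by rewrite a's.
have tI : c' <= t0 <= d' by rewrite c't.
pose f := PX b' - PX a'; pose g := PY^~ d' - PY^~ c'.
have [|f_c|tau] := @MVT R f (X b' - X a') c' d' cd'.
- move=> t; rewrite in_itv /= => /andP[/ltW ct /ltW td].
  by apply: is_deriveB; apply: dX; rewrite ?inab ?incd ?ct.
- apply: derivable_within_continuous => t; rewrite in_itv /= => /incd cdt.
  have D1 : is_derive t 1 (PX b') (X b' t) by apply: dX cdt; exact: inab.
  have D2 : is_derive t 1 (PX a') (X a' t) by apply: dX cdt; exact: inab.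
  exact: (@ex_derive _ _ _ _ _ _ _ (is_deriveB D1 D2)).
rewrite in_itv /= => /andP[/ltW ctau /ltW taud] Ef.
have tauI : c' <= tau <= d' by rewrite ctau.
have [|g_c|sig] := @MVT R g (Y^~ d' - Y^~ c') a' b' ab'.
- move=> s; rewrite in_itv /= => /andP[/ltW as_ /ltW sb].
  by apply: is_deriveB; apply: dY; rewrite ?inab ?incd ?as_.
- apply: derivable_within_continuous => s; rewrite in_itv /= => /inab abs_.
  have D1 : is_derive s 1 (PY^~ d') (Y s d') by apply: dY abs_ _; exact: incd.
  have D2 : is_derive s 1 (PY^~ c') (Y s c') by apply: dY abs_ _; exact: incd.
  exact: (@ex_derive _ _ _ _ _ _ _ (is_deriveB D1 D2)).
rewrite in_itv /= => /andP[/ltW asig /ltW sigb] Eg.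
have sigI : a' <= sig <= b' by rewrite asig.
(* The mean value theorem turns the increments into differences of [X] and of [Y]. Their first-order
   parts [al * u * v] cancel because the s-derivative of [X] equals the t-derivative of [Y]. *)
have -> : rect_diff (fun s t => PX s t - PY s t) a' b' c' d' =
    (X b' tau - X a' tau) * (d' - c') - (Y sig d' - Y sig c') * (b' - a').
  have -> : (X b' tau - X a' tau) * (d' - c') = f d' - f c' by rewrite Ef.
  have -> : (Y sig d' - Y sig c') * (b' - a') = g b' - g a' by rewrite Eg.
  rewrite /rect_diff /f /g !fctE; ring.
have [sb1 sb2] := itv_dist bI sI hb.
have [sa1 sa2] := itv_dist aI sI hb.
have [ss1 ss2] := itv_dist sigI sI hb.
have [tt1 tt2] := itv_dist tauI tI hd.
have [td1 td2] := itv_dist dI tI hd.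
have [tc1 tc2] := itv_dist cI tI hd.
have [X1 _] := H _ _ sb2 tt2; have [X2 _] := H _ _ sa2 tt2.
have [_ Y1] := H _ _ ss2 td2; have [_ Y2] := H _ _ ss2 tc2.
set u := b' - a' in sb1 sa1 ss1 *; set v := d' - c' in tt1 td1 tc1 *.
have u0 : 0 < u by rewrite /u subr_gt0.
have v0 : 0 < v by rewrite /v subr_gt0.
have bnd (P p q : R) : `|P| <= e / 4 * (p + q) -> p <= u -> q <= v -> `|P| <= e / 4 * (u + v).
  by move=> h hp hq; rewrite (le_trans h)// ler_pM2l// lerD.
have {}X1 := bnd _ _ _ X1 sb1 tt1; have {}X2 := bnd _ _ _ X2 sa1 tt1.
have {}Y1 := bnd _ _ _ Y1 ss1 td1; have {}Y2 := bnd _ _ _ Y2 ss1 tc1.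
have dX' : `|X b' tau - X a' tau - al * u| <= e / 2 * (u + v).
  rewrite (_ : X b' tau - X a' tau - al * u =
   (X b' tau - X s0 t0 - al * (b' - s0) - be * (tau - t0)) -
   (X a' tau - X s0 t0 - al * (a' - s0) - be * (tau - t0))); last by rewrite /u; ring.
  apply: (le_trans (ler_normB _ _)); move: (lerD X1 X2); clear; lra.
have dY' : `|Y sig d' - Y sig c' - al * v| <= e / 2 * (u + v).
  rewrite (_ : Y sig d' - Y sig c' - al * v =
   (Y sig d' - Y s0 t0 - ga * (sig - s0) - al * (d' - t0)) -
   (Y sig c' - Y s0 t0 - ga * (sig - s0) - al * (c' - t0))); last by rewrite /v; ring.
  apply: (le_trans (ler_normB _ _)); move: (lerD Y1 Y2); clear; lra.
rewrite (_ : _ - _ = (X b' tau - X a' tau - al * u) * v - (Y sig d' - Y sig c' - al * v) * u); last by ring.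
rewrite (le_trans (ler_normB _ _))// !normrM (gtr0_norm u0) (gtr0_norm v0).
have h1 := ler_wpM2r (ltW v0) dX'; have h2 := ler_wpM2r (ltW u0) dY'.
apply: (le_trans (lerD h1 h2)).
rewrite [leLHS](_ : _ = e * (u + v) ^+ 2 / 2); last by field.
by rewrite ler_pdivrMr// ler_peMr ?ler1n// mulr_ge0 ?sqr_ge0 ?(ltW e0).
Qed.

End Goursat.

(** * Bounded measurable functions on the unit interval *)

Section BoundedIntegral.
Variable R : realType.
Notation mu := (@lebesgue_measure R).
Implicit Types (f g : R -> R) (M : R).

(** Bounded everywhere rather than essentially, so that products stay in the class and integrability
    on bounded intervals is automatic. *)
Definition bmf f := measurable_fun setT f /\ exists M, forall t, `|f t| <= M.

Definition J f : R := \int[mu]_(x in `[0, 1]) f x.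

Lemma bmf_cst (c : R) : bmf (fun=> c).
Proof. by split; [exact: measurable_cst|exists `|c|]. Qed.

Lemma bmfD f g : bmf f -> bmf g -> bmf (fun t => f t + g t).
Proof.
move=> [mf [M fM]] [mg [N gN]]; split; first exact: measurable_funD.
by exists (M + N) => t; rewrite (le_trans (ler_normD _ _))// lerD.
Qed.

Lemma bmfM f g : bmf f -> bmf g -> bmf (fun t => f t * g t).
Proof.
move=> [mf [M fM]] [mg [N gN]]; split; first exact: measurable_funM.
by exists (M * N) => t; rewrite normrM ler_pM.
Qed.

Lemma bmfN f : bmf f -> bmf (fun t => - f t).
Proof.
move=> [mf [M fM]]; split; first exact: measurableT_comp.
by exists M => t; rewrite normrN.
Qed.

Lemma bmfB f g : bmf f -> bmf g -> bmf (fun t => f t - g t).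
Proof. by move=> bf bg; apply: bmfD => //; exact: bmfN. Qed.

Lemma bmf_continuous f M : continuous f -> (forall t, `|f t| <= M) -> bmf f.
Proof. by move=> cf fM; split; [exact: continuous_measurable_fun|exists M]. Qed.

Lemma bmf_indic (A : set R) : measurable A -> bmf (\1_A).
Proof.
move=> mA; split; first exact: measurable_indic.
by exists 1 => t; rewrite indicE; case: (t \in A); rewrite ?normr0 ?normr1.
Qed.

Lemma bmf_cvg (h : nat -> R -> R) f M : (forall n, bmf (h n)) ->
  (forall n t, `|h n t| <= M) -> (forall t, h^~ t @ \oo --> f t) -> bmf f.
Proof.
move=> bh hM hf; split.
  by apply: (@measurable_fun_cvg _ _ _ _ h) => [n|x _]; [exact: (bh n).1|exact: hf].
exists M => t; have hn := cvg_norm (hf t).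
rewrite -(cvg_lim _ (hn _))//; apply: limr_le; first by apply/cvg_ex; exists `|f t|; exact: hn.
by apply: nearW => n /=.
Qed.

Lemma mu01 : mu `[(0 : R), 1]%classic = 1%E.
Proof. by rewrite lebesgue_measure_itv /= lte_fin ltr01 sube0. Qed.

Lemma bmf_integrable f (a b : R) : bmf f ->
  mu.-integrable `[a, b] (EFin \o f).
Proof.
move=> [mf [M fM]]; apply: measurable_bounded_integrable => //.
- by rewrite [X in (X < _)%E]lebesgue_measure_itv /=; case: ifPn => // _; rewrite -EFinB ltry.
- exact: measurable_funTS.
- exists M; split; first exact: num_real.
  by move=> x Mx t _; exact: le_trans (fM t) (ltW Mx).
Qed.

Lemma JD f g : bmf f -> bmf g -> J (fun t => f t + g t) = J f + J g.
Proof. by move=> bf bg; rewrite /J RintegralD//; exact: bmf_integrable. Qed.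

Lemma JZ (r : R) f : bmf f -> J (fun t => r * f t) = r * J f.
Proof. by move=> bf; rewrite /J RintegralZl//; exact: bmf_integrable. Qed.

Lemma JN f : bmf f -> J (fun t => - f t) = - J f.
Proof.
move=> bf; rewrite -[RHS]mulN1r -JZ//; congr J.
by apply/funext => t; rewrite mulN1r.
Qed.

Lemma JB f g : bmf f -> bmf g -> J (fun t => f t - g t) = J f - J g.
Proof. by move=> bf bg; rewrite JD ?JN//; exact: bmfN. Qed.

Lemma J_cst (c : R) : J (fun=> c) = c.
Proof.
by rewrite /J Rintegral_cst// [X in fine X](_ : _ = 1%E) ?mulr1//; exact: mu01.
Qed.

Lemma J_le f g : bmf f -> bmf g -> (forall t, 0 <= t <= 1 -> f t <= g t) ->
  J f <= J g.
Proof.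
move=> bf bg fg; apply: le_Rintegral => //; first exact: bmf_integrable.
exact: bmf_integrable.
Qed.

Lemma J_ge0 f : (forall t, 0 <= f t) -> 0 <= J f.
Proof. by move=> f0; apply: Rintegral_ge0. Qed.

Lemma eq_J f g : (forall t, 0 <= t <= 1 -> f t = g t) -> J f = J g.
Proof.
move=> fg; apply: eq_Rintegral => t; rewrite inE /= in_itv /=; exact: fg.
Qed.

Lemma J_dct (h : nat -> R -> R) f M : (forall n, bmf (h n)) -> bmf f ->
  (forall n t, `|h n t| <= M) ->
  (forall t, 0 <= t < 1 -> h^~ t @ \oo --> f t) ->
  (fun n => J (h n)) @ \oo --> J f.
Proof.
move=> bh bf hM hf.
have [|||||_ _] := @dominated_convergence _ _ _ mu `[0, 1]%classic
  ltac:(exact: measurable_itv) (fun n => EFin \o h n) (EFin \o f) (cst M%:E).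
- by move=> n; apply/measurable_EFinP/measurable_funTS; exact: (bh n).1.
- by apply/measurable_EFinP/measurable_funTS; exact: bf.1.
(* Convergence is assumed on [[0, 1)] while [J] integrates over [[0, 1]]: the endpoint is the
   exceptional null set. *)
- exists [set 1]; split => //; first exact: lebesgue_measure_set1.
  move=> t /=; apply: contra_notP => /eqP t1; rewrite in_itv /= => /andP[t0 t1'].
  apply: cvg_EFin; first by apply: nearW.
  by apply: hf; rewrite t0 lt_neqAle t1.
- exact: (@bmf_integrable (cst M) 0 1 (bmf_cst M)).
- by apply: aeW => t n _ /=; rewrite lee_fin hM.
move=> H; rewrite /J /Rintegral; apply: fine_cvg.
by rewrite fineK//; apply: integrable_fin_num => //; exact: bmf_integrable.
Qed.

End BoundedIntegral.

(** * Integrals of complex-valued functions *)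

Section ComplexIntegral.
Variable R : realType.
Implicit Types (f g : R -> C R) (M : R).

Definition good f := bmf (fun t => complex.Re (f t)) /\ bmf (fun t => complex.Im (f t)).

Definition I f : C R :=
  Complex (J (fun t => complex.Re (f t))) (J (fun t => complex.Im (f t))).

Lemma good_nm f : good f -> exists M, forall t, nm (f t) <= M.
Proof.
move=> [[_ [M fM]] [_ [N fN]]]; exists (M + N) => t.
by rewrite (le_trans (nm_le _))// lerD.
Qed.

Lemma good_cst (c : C R) : good (fun=> c).
Proof. by split; exact: bmf_cst. Qed.

Lemma goodD f g : good f -> good g -> good (fun t => f t + g t).
Proof.
move=> [f1 f2] [g1 g2]; split.
  by under eq_fun do rewrite cReD; exact: bmfD.
by under eq_fun do rewrite cImD; exact: bmfD.
Qed.

Lemma goodM f g : good f -> good g -> good (fun t => f t * g t).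
Proof.
move=> [f1 f2] [g1 g2]; split.
  by under eq_fun do rewrite cReM; apply: bmfB; exact: bmfM.
by under eq_fun do rewrite cImM; apply: bmfD; exact: bmfM.
Qed.

Lemma good_conj f : good f -> good (fun t => Num.conj (f t)).
Proof.
move=> [f1 f2]; split; under eq_fun do rewrite cconjE /=; first by [].
exact: bmfN.
Qed.

Lemma goodB f g : good f -> good g -> good (fun t => f t - g t).
Proof.
move=> gf [g1 g2]; apply: goodD => //; split.
  by under eq_fun do rewrite cReN; exact: bmfN.
by under eq_fun do rewrite cImN; exact: bmfN.
Qed.

Lemma goodX f n : good f -> good (fun t => f t ^+ n).
Proof.
move=> gf; elim: n => [|n IH]; first exact: good_cst.
by under eq_fun do rewrite exprS; exact: goodM.
Qed.

Lemma good_sum (T : Type) (s : seq T) (P : pred T) (f : T -> R -> C R) :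
  (forall i, good (f i)) -> good (fun t => \sum_(i <- s | P i) f i t).
Proof.
move=> gf; elim: s => [|a s IH].
  by under eq_fun do rewrite big_nil; exact: good_cst.
by under eq_fun do rewrite big_cons; case: (P a) => //; exact: goodD.
Qed.

Lemma good_real (f : R -> R) : bmf f -> good (fun t => RtoC (f t)).
Proof. by split => //=; exact: bmf_cst. Qed.

Lemma good_continuous f M : continuous (fun t => complex.Re (f t)) ->
  continuous (fun t => complex.Im (f t)) -> (forall t, nm (f t) <= M) -> good f.
Proof.
move=> c1 c2 fM; split; apply: (@bmf_continuous _ _ M) => // t.
  exact: le_trans (nm_Re _) (fM t).
exact: le_trans (nm_Im _) (fM t).
Qed.

Lemma good_cvg (h : nat -> R -> C R) f M : (forall n, good (h n)) ->
  (forall n t, nm (h n t) <= M) -> (forall t, h^~ t @ \oo --> f t) -> good f.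
Proof.
move=> gh hM hf; split.
  apply: (@bmf_cvg _ (fun n t => complex.Re (h n t)) _ M) => [n|n t|t].
  - exact: (gh n).1.
  - exact: le_trans (nm_Re _) (hM n t).
  - by have /cvgC_ReIm[] := hf t.
apply: (@bmf_cvg _ (fun n t => complex.Im (h n t)) _ M) => [n|n t|t].
- exact: (gh n).2.
- exact: le_trans (nm_Im _) (hM n t).
- by have /cvgC_ReIm[] := hf t.
Qed.

Lemma bmf_nm2 f : good f -> bmf (fun t => nm (f t) ^+ 2).
Proof.
move=> [f1 f2]; under eq_fun do rewrite nm_sqr !expr2.
by apply: bmfD; exact: bmfM.
Qed.

Lemma eq_I f g : (forall t, 0 <= t <= 1 -> f t = g t) -> I f = I g.
Proof. by move=> fg; congr Complex; apply: eq_J => t ht; rewrite fg. Qed.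

Lemma ID f g : good f -> good g -> I (fun t => f t + g t) = I f + I g.
Proof.
move=> [f1 f2] [g1 g2]; apply: CP; rewrite ?cReD ?cImD /=.
  by rewrite -JD//; congr J; apply/funext => t; rewrite cReD.
by rewrite -JD//; congr J; apply/funext => t; rewrite cImD.
Qed.

Lemma IZ (c : C R) f : good f -> I (fun t => c * f t) = c * I f.
Proof.
move=> [f1 f2]; apply: CP; rewrite ?cReM ?cImM /= -!JZ// -?JB -?JD//;
  try exact: (bmfM (bmf_cst _)); congr J; apply/funext => t; rewrite ?cReM ?cImM//.
Qed.

Lemma IB f g : good f -> good g -> I (fun t => f t - g t) = I f - I g.
Proof.
move=> gf gg; rewrite -[- I g]mulN1r -IZ// -ID//; last exact: goodM (good_cst _) gg.
by apply: eq_I => t _; rewrite mulN1r.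
Qed.

Lemma I_conj f : good f -> I (fun t => Num.conj (f t)) = Num.conj (I f).
Proof.
move=> [f1 f2]; rewrite cconjE /= -JN//; congr Complex; congr J;
  by apply/funext => t; rewrite cconjE.
Qed.

Lemma I_sum (T : Type) (s : seq T) (P : pred T) (f : T -> R -> C R) :
  (forall i, good (f i)) ->
  I (fun t => \sum_(i <- s | P i) f i t) = \sum_(i <- s | P i) I (f i).
Proof.
move=> gf; elim: s => [|a s IH].
  rewrite big_nil; under [in LHS]eq_fun do rewrite big_nil.
  by apply: CP; rewrite /= J_cst.
rewrite big_cons; under [in LHS]eq_fun do rewrite big_cons.
by case: (P a) => //; rewrite ID ?IH//; exact: good_sum.
Qed.

Lemma I_cst (c : C R) : I (fun=> c) = c.
Proof. by apply: CP; rewrite /= J_cst. Qed.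

Lemma I_real (f : R -> R) : I (fun t => RtoC (f t)) = RtoC (J f).
Proof. by apply: CP => //=; rewrite J_cst. Qed.

Lemma I_nm_le f (g : R -> R) : good f -> bmf g ->
  (forall t, 0 <= t <= 1 -> nm (f t) <= g t) -> nm (I f) <= J g.
Proof.
move=> gf bg fg; have [->|I0] := eqVneq (I f) 0.
  rewrite nm0 -(J_cst 0); apply: J_le => //; first exact: bmf_cst.
  by move=> t ht; exact: le_trans (nm_ge0 _) (fg t ht).
have n0 : 0 < nm (I f).
  by rewrite lt_neqAle nm_ge0 andbT eq_sym; apply: contra_neq I0 => /nm_eq0.
(* Multiplying [f] by the conjugate of [I f] makes its integral real, equal to [|I f|^2], so that
   only real parts are compared. *)
rewrite -(ler_pM2l n0) -expr2.
have gcf : good (fun t => Num.conj (I f) * f t) by apply: goodM => //; exact: good_cst.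
have -> : nm (I f) ^+ 2 = J (fun t => complex.Re (Num.conj (I f) * f t)).
  rewrite -[RHS]/(complex.Re (I (fun t => Num.conj (I f) * f t))) IZ//.
  by rewrite mulrC sqr_norm_conj.
rewrite -JZ//; apply: J_le => [||t ht]; first exact: gcf.1.
  by apply: bmfM => //; exact: bmf_cst.
rewrite (le_trans (ler_norm _))// (le_trans (nm_Re _))// nmM nm_conj.
by rewrite ler_pM2l// fg.
Qed.

Lemma I_dct (h : nat -> R -> C R) f M : (forall n, good (h n)) -> good f ->
  (forall n t, nm (h n t) <= M) ->
  (forall t, 0 <= t < 1 -> h^~ t @ \oo --> f t) ->
  (fun n => I (h n)) @ \oo --> I f.
Proof.
move=> gh gf hM hf; apply/cvgC_ReIm; split.
  apply: (@J_dct _ (fun n t => complex.Re (h n t)) _ M) => [n||n t|t ht].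
  - exact: (gh n).1.
  - exact: gf.1.
  - exact: le_trans (nm_Re _) (hM n t).
  - by have /cvgC_ReIm[] := hf t ht.
apply: (@J_dct _ (fun n t => complex.Im (h n t)) _ M) => [n||n t|t ht].
- exact: (gh n).2.
- exact: gf.2.
- exact: le_trans (nm_Im _) (hM n t).
- by have /cvgC_ReIm[] := hf t ht.
Qed.

End ComplexIntegral.

(** * Fourier coefficients *)

Section Circle.
Variable R : realType.
Notation mu := (@lebesgue_measure R).
Implicit Types (f g : R -> C R) (s t : R) (z w : C R).

Lemma circD s t : circ (s + t) = circ s * circ t.
Proof.
by rewrite /circ mulrDr; apply: CP; rewrite ?cReM ?cImM /= ?cosD ?sinD//; ring.
Qed.

Lemma circ0 : circ 0 = 1 :> C R.
Proof. by rewrite /circ mulr0 cos0 sin0. Qed.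

Lemma circ1 : circ 1 = 1 :> C R.
Proof. by rewrite /circ mulr1 mulr_natl cos2pi sin2pi. Qed.

Lemma conj_circ t : Num.conj (circ t) = circ (- t).
Proof. by rewrite cconjE /circ /= mulrN cosN sinN. Qed.

Lemma nm_circ t : nm (circ t) = 1.
Proof.
apply/eqP; rewrite -(@eqrXn2 _ 2)// ?nm_ge0// nm_sqr /= cos2Dsin2 expr1n//.
Qed.

Lemma circ_conj_mul t : circ t * Num.conj (circ t) = 1.
Proof. by rewrite sqr_norm_conj nm_circ expr1n. Qed.

Lemma circX t n : circ t ^+ n = circ (n%:R * t).
Proof.
elim: n => [|n IH]; first by rewrite mul0r circ0.
by rewrite exprS IH -circD; congr circ; rewrite -natr1; ring.
Qed.

Lemma continuous_circ_Re : continuous (fun t => complex.Re (circ t)).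
Proof.
move=> t; apply: (@continuous_comp _ _ _ (fun t => 2 * pi * t) (@cos R)).
  exact: mulrl_continuous.
exact: continuous_cos.
Qed.

Lemma continuous_circ_Im : continuous (fun t => complex.Im (circ t)).
Proof.
move=> t; apply: (@continuous_comp _ _ _ (fun t => 2 * pi * t) (@sin R)).
  exact: mulrl_continuous.
exact: continuous_sin.
Qed.

Lemma good_circ : good (@circ R).
Proof.
apply: (@good_continuous _ _ 1); first exact: continuous_circ_Re.
  exact: continuous_circ_Im.
by move=> t; rewrite nm_circ.
Qed.

Lemma good_circX n : good (fun t => circ t ^+ n : C R).
Proof. exact: goodX good_circ. Qed.

Lemma good_conj_circX n : good (fun t => Num.conj (circ t ^+ n) : C R).
Proof. exact: good_conj (good_circX n). Qed.

Lemma J_FTC (f F : R -> R) : continuous f ->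
  (forall t, is_derive t 1 F (f t)) -> J f = F 1 - F 0.
Proof.
move=> cf dF; rewrite /J /Rintegral.
have cF : continuous F.
  by move=> t; apply: differentiable_continuous; apply/derivable1_diffP; case: (dF t).
rewrite (@continuous_FTC2 _ f F)//.
- exact: continuous_subspaceT.
- split; first by move=> t _; case: (dF t).
  + exact: cvg_at_right_filter (cF 0).
  + exact: cvg_at_left_filter (cF 1).
- by move=> t _; rewrite derive1E; have [_ ->] := dF t.
Qed.

Lemma I_circX n : I (fun t => circ t ^+ n : C R) = (n == 0%N)%:R.
Proof.
case: n => [|n]; first by rewrite (_ : (fun t => _) = (fun=> 1)) ?I_cst.
set a : R := 2 * pi * n.+1%:R.
have a0 : a != 0 by rewrite !mulf_neq0// ?pnatr_eq0// gt_eqF// pi_gt0.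
have [ca sa] : cos a = 1 /\ sin a = 0.
  have : circ (n.+1%:R : R) = 1 by rewrite -[_%:R]mulr1 -circX circ1 expr1n.
  by case.
have E t : circ t ^+ n.+1 = Complex (cos (a * t)) (sin (a * t)) :> C R.
  by rewrite circX /circ /a !mulrA.
have dlin t : is_derive t 1 (fun x : R => a * x) a.
  have := @is_deriveZ _ _ _ (@id R) a t 1 1 (is_derive_id _ _).
  by rewrite /GRing.scale /= mulr1.
have cl : continuous (fun x : R => a * x) by exact: mulrl_continuous.
have ccos : continuous (fun t => cos (a * t)).
  by move=> t; apply: continuous_comp; [exact: cl|exact: continuous_cos].
have csin : continuous (fun t => sin (a * t)).
  by move=> t; apply: continuous_comp; [exact: cl|exact: continuous_sin].
have dsin t : is_derive t 1 (fun x => a^-1 * sin (a * x)) (cos (a * t)).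
  have d1 := @is_derive1_comp _ sin (fun x => a * x) t _ _ (is_derive_sin _) (dlin t).
  by apply: (is_derive_eq (@is_deriveZ _ _ _ _ a^-1 _ _ _ d1)); rewrite /GRing.scale /=; field.
have dcos t : is_derive t 1 (fun x => - a^-1 * cos (a * x)) (sin (a * t)).
  have d1 := @is_derive1_comp _ cos (fun x => a * x) t _ _ (is_derive_cos _) (dlin t).
  by apply: (is_derive_eq (@is_deriveZ _ _ _ _ (- a^-1) _ _ _ d1)); rewrite /GRing.scale /=; field.
apply: CP => /=; under [in LHS]eq_J => t _ do rewrite E /=.
  by rewrite (J_FTC ccos dsin) mulr1 mulr0 sa sin0 subrr.
by rewrite (J_FTC csin dcos) mulr1 mulr0 ca cos0 subrr.
Qed.

Definition ip2 f g : C R := I (fun t => f t * Num.conj (g t)).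
Definition N2 f : R := J (fun t => nm (f t) ^+ 2).
(** Only indices [k >= 0] occur, so [fc f] is the coefficient sequence of the analytic projection of
    [f]. *)
Definition fc f (k : nat) : C R := I (fun t => f t * Num.conj (circ t ^+ k)).

Lemma ip2_self f : ip2 f f = RtoC (N2 f).
Proof. by rewrite -I_real; apply: eq_I => t _; rewrite sqr_norm_conj. Qed.

Lemma N2_ge0 f : 0 <= N2 f.
Proof. by apply: J_ge0 => t; rewrite sqr_ge0. Qed.

Lemma ip2C f g : good f -> good g -> ip2 f g = Num.conj (ip2 g f).
Proof.
move=> gf gg; rewrite -I_conj; last by apply: goodM => //; exact: good_conj.
by apply: eq_I => t _; rewrite rmorphM /= conjCK mulrC.
Qed.

Lemma nm_sqrB z w : nm (z - w) ^+ 2 =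
  nm z ^+ 2 + nm w ^+ 2 - 2 * complex.Re (z * Num.conj w).
Proof. by rewrite !nm_sqr cReD cImD cReN cImN cReM cconjE /=; ring. Qed.

Lemma nm_sqrD z w : nm (z + w) ^+ 2 =
  nm z ^+ 2 + nm w ^+ 2 + 2 * complex.Re (z * Num.conj w).
Proof. by rewrite !nm_sqr cReD cImD cReM cconjE /=; ring. Qed.

Lemma N2B f g : good f -> good g ->
  N2 (fun t => f t - g t) = N2 f + N2 g - 2 * complex.Re (ip2 f g).
Proof.
move=> gf gg; have gfg : good (fun t => f t * Num.conj (g t)).
  by apply: goodM => //; exact: good_conj.
have b := bmfM (bmf_cst 2) gfg.1.
rewrite /N2 /ip2 /= -JZ; last exact: gfg.1.
rewrite -JD -?JB; [|exact: bmfD (bmf_nm2 gf) (bmf_nm2 gg)|by []|exact: bmf_nm2..].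
by apply: eq_J => t _; exact: nm_sqrB.
Qed.

Lemma N2D f g : good f -> good g ->
  N2 (fun t => f t + g t) = N2 f + N2 g + 2 * complex.Re (ip2 f g).
Proof.
move=> gf gg; have gfg : good (fun t => f t * Num.conj (g t)).
  by apply: goodM => //; exact: good_conj.
have b := bmfM (bmf_cst 2) gfg.1.
rewrite /N2 /ip2 /= -JZ; last exact: gfg.1.
rewrite -!JD; [|exact: bmfD (bmf_nm2 gf) (bmf_nm2 gg)|by []|exact: bmf_nm2..].
by apply: eq_J => t _; exact: nm_sqrD.
Qed.

Lemma circ_cancel (j k : nat) t : (k <= j)%N ->
  circ t ^+ j * Num.conj (circ t ^+ k) = circ t ^+ (j - k)%N.
Proof.
move=> kj; rewrite -{1}(subnK kj) exprD rmorphXn /= -mulrA -exprMn.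
by rewrite circ_conj_mul expr1n mulr1.
Qed.

Lemma ip2_circ j k : ip2 (fun t => circ t ^+ j) (fun t => circ t ^+ k) = (j == k)%:R.
Proof.
have [jk|kj] := leqP k j.
  rewrite /ip2; under eq_I => t _ do rewrite circ_cancel//.
  by rewrite I_circX subn_eq0 eqn_leq jk andbT.
rewrite ip2C; [|exact: good_circX..]; rewrite /ip2.
under eq_I => t _ do rewrite (circ_cancel _ (ltnW kj)).
by rewrite I_circX subn_eq0 leqNgt kj /= (ltn_eqF kj) conjC0.
Qed.

Definition trig (c : nat -> C R) N t : C R := \sum_(k < N) c k * circ t ^+ k.

Lemma good_trig c N : good (trig c N).
Proof. by apply: good_sum => k; apply: goodM (good_cst _) (good_circX _). Qed.

Lemma ip2_trigr f c N : good f ->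
  ip2 f (trig c N) = \sum_(k < N) Num.conj (c k) * fc f k.
Proof.
move=> gf; rewrite /ip2 /trig.
under eq_I => t _ do rewrite rmorph_sum mulr_sumr.
rewrite I_sum => [|k]; last first.
  apply: goodM => //; apply: good_conj; apply: goodM; [exact: good_cst|exact: good_circX].
apply: eq_bigr => k _; rewrite -IZ; last by apply: goodM => //; exact: good_conj_circX.
by apply: eq_I => t _; rewrite rmorphM /= mulrCA.
Qed.

Lemma fc_trig c N k : fc (trig c N) k = if (k < N)%N then c k else 0.
Proof.
rewrite /fc /trig; under eq_I => t _ do rewrite mulr_suml.
rewrite I_sum => [|j]; last first.
  apply: goodM (good_conj_circX k); apply: goodM; [exact: good_cst|exact: good_circX].
have E (j : 'I_N) : I (fun t => c j * circ t ^+ j * Num.conj (circ t ^+ k)) =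
    if j == k :> nat then c k else 0.
  under eq_I => t _ do rewrite -mulrA.
  rewrite IZ; last by apply: goodM (good_circX _) (good_conj_circX k).
  by rewrite [I _]ip2_circ; case: eqP => [->|_]; rewrite ?mulr1 ?mulr0.
under eq_bigr do rewrite E.
case: ltnP => [kN|Nk]; last first.
  by rewrite big1// => j _; rewrite (ltn_eqF (leq_trans (ltn_ord j) Nk)).
rewrite (bigD1 (Ordinal kN))//= eqxx big1 ?addr0// => j.
by rewrite -val_eqE /= => /negbTE ->.
Qed.

Lemma N2_trig c N : N2 (trig c N) = \sum_(k < N) nm (c k) ^+ 2.
Proof.
suff /(congr1 (@complex.Re R)) : RtoC (N2 (trig c N)) = RtoC (\sum_(k < N) nm (c k) ^+ 2) by [].
rewrite -ip2_self ip2_trigr; last exact: good_trig.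
rewrite RtoC_sum; apply: eq_bigr => k _.
by rewrite fc_trig ltn_ord mulrC sqr_norm_conj.
Qed.

Lemma bessel f N : good f -> \sum_(k < N) nm (fc f k) ^+ 2 <= N2 f.
Proof.
move=> gf; have := N2_ge0 (fun t => f t - trig (fc f) N t).
rewrite N2B//; last exact: good_trig.
rewrite N2_trig ip2_trigr//.
under [X in complex.Re X]eq_bigr do rewrite mulrC sqr_norm_conj.
by rewrite -RtoC_sum /=; lra.
Qed.

Lemma fcD f g k : good f -> good g -> fc (fun t => f t + g t) k = fc f k + fc g k.
Proof.
move=> gf gg; rewrite /fc -ID; try by apply: goodM => //; exact: good_conj_circX.
by apply: eq_I => t _; rewrite mulrDl.
Qed.

Lemma fcZ c f k : good f -> fc (fun t => c * f t) k = c * fc f k.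
Proof.
move=> gf; rewrite /fc -IZ; last by apply: goodM => //; exact: good_conj_circX.
by apply: eq_I => t _; rewrite mulrA.
Qed.

Lemma eq_fc f g k : (forall t, 0 <= t <= 1 -> f t = g t) -> fc f k = fc g k.
Proof. by move=> fg; apply: eq_I => t ht; rewrite fg. Qed.

Lemma fc_sum (T : Type) (s : seq T) (P : pred T) (f : T -> R -> C R) k :
  (forall i, good (f i)) ->
  fc (fun t => \sum_(i <- s | P i) f i t) k = \sum_(i <- s | P i) fc (f i) k.
Proof.
move=> gf; rewrite /fc; under eq_I => t _ do rewrite mulr_suml.
by rewrite I_sum// => i; apply: goodM => //; exact: good_conj_circX.
Qed.

End Circle.

(** * Fejer kernel and Fejer means *)

Section Fejer.
Variable R : realType.
Implicit Types (f : R -> C R) (s t : R) (z w : C R).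

(** The one-sided Dirichlet kernel: [|dirichlet n t s|^2 / n] is the Fejer kernel, written so that
    positivity is visible and Parseval gives its mass. *)
Definition dirichlet n t s : C R := \sum_(k < n) (circ t * Num.conj (circ s)) ^+ k.

Lemma good_dirichlet n t : good (dirichlet n t).
Proof.
apply: good_sum => k; apply: goodX; apply: goodM; first exact: good_cst.
exact: good_conj (@good_circ R).
Qed.

Lemma J_dirichlet n t : J (fun s => nm (dirichlet n t s) ^+ 2) = n%:R.
Proof.
rewrite -[RHS](_ : N2 (trig (fun k => Num.conj (circ t) ^+ k) n) = _); last first.
  rewrite N2_trig (eq_bigr (fun=> 1)); first by rewrite sumr_const card_ord.
  by move=> k _; rewrite nmX nm_conj nm_circ !expr1n.
apply: eq_J => s _; congr (_ ^+ 2); rewrite -nm_conj; congr nm.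
rewrite /dirichlet /trig rmorph_sum; apply: eq_bigr => k _.
by rewrite rmorphXn /= rmorphM /= conjCK exprMn.
Qed.

(** The geometric sum satisfies [D * (1 - z) = 1 - z^n] with [|z| = 1]; hence the Fejer kernel is
    O(1/n) away from the diagonal. *)
Lemma dirichlet_bound n t s :
  nm (dirichlet n t s) ^+ 2 * nm (circ s - circ t) ^+ 2 <= 4.
Proof.
set z := circ t * Num.conj (circ s).
have nz : nm z = 1 by rewrite nmM nm_conj !nm_circ mulr1.
have -> : nm (circ s - circ t) = nm (1 - z).
  rewrite /z -(circ_conj_mul s) -mulrBl nmM nm_conj nm_circ mulr1//.
have E : dirichlet n t s * (1 - z) = 1 - z ^+ n.
  by rewrite -[RHS](opprB (z ^+ n) 1) subrX1 /dirichlet -/z; ring.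
rewrite -exprMn -nmM E (_ : 4 = 2 ^+ 2); last by ring.
rewrite ler_pXn2r ?nnegrE ?nm_ge0// (le_trans (nm_sub _ _))// nm1 nmX nz expr1n.
lra.
Qed.

Definition fejer_mean f n t : C R :=
  I (fun s => RtoC (nm (dirichlet n.+1 t s) ^+ 2 / n.+1%:R) * f s).

(** Closeness is measured by [|circ s - circ t|], so that the endpoints 0 and 1 count as the same
    point of the circle. *)
Lemma fejer_mean_cvg f t : good f ->
  (forall e : R, 0 < e -> exists2 d : R, 0 < d & forall s, 0 <= s <= 1 ->
    nm (circ s - circ t) < d -> nm (f s - f t) <= e) ->
  fejer_mean f ^~ t @ \oo --> f t.
Proof.
move=> gf loc; apply/cvgC_eps => e e0.
have e20 : 0 < e / 2 by rewrite divr_gt0.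
have [d d0 dP] := loc _ e20.
have [M fM] := good_nm gf.
have M0 : 0 <= M := le_trans (nm_ge0 _) (fM 0).
pose K n s := nm (dirichlet n.+1 t s) ^+ 2 / n.+1%:R.
have bK n : bmf (K n).
  by apply: bmfM (bmf_nm2 (good_dirichlet _ _)) (bmf_cst _).
have JK n : J (K n) = 1.
  rewrite /K (eq_J (g := fun s => n.+1%:R^-1 * nm (dirichlet n.+1 t s) ^+ 2)); last first.
    by move=> s _; rewrite mulrC.
  by rewrite JZ ?J_dirichlet ?mulVf//; exact: bmf_nm2 (good_dirichlet _ _).
have K0 n s : 0 <= K n s by rewrite divr_ge0 ?sqr_ge0.
have key n : nm (fejer_mean f n t - f t) <= e / 2 + 8 * M / d ^+ 2 / n.+1%:R.
  have gKf : good (fun s => RtoC (K n s) * f s) by apply: goodM => //; exact: good_real.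
  have gKc : good (fun s => RtoC (K n s) * f t).
    by apply: goodM (good_real (bK n)) (good_cst _).
  have -> : fejer_mean f n t - f t = I (fun s => RtoC (K n s) * (f s - f t)).
    have Eft : f t = I (fun s => RtoC (K n s) * f t).
      under eq_I => s _ do rewrite mulrC.
      by rewrite IZ ?I_real ?JK ?mulr1//; exact: good_real.
    rewrite [in LHS]Eft.
    rewrite [in RHS](eq_I (g := fun s => RtoC (K n s) * f s + (-1) * (RtoC (K n s) * f t))); last first.
      by move=> s _; rewrite mulN1r mulrBr.
    rewrite ID//; last exact: goodM (good_cst _) gKc.
    by rewrite IZ// mulN1r.
  pose g s := e / 2 * K n s + 8 * M / d ^+ 2 / n.+1%:R.
  have bg : bmf g by apply: bmfD (bmfM (bmf_cst _) (bK n)) (bmf_cst _).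
  have -> : e / 2 + 8 * M / d ^+ 2 / n.+1%:R = J g.
    rewrite /g (JD (bmfM (bmf_cst _) (bK n)) (bmf_cst _)) (JZ _ (bK n)).
    by rewrite JK J_cst mulr1.
  apply: I_nm_le => // [|s hs].
    by apply: goodM (good_real (bK n)) (goodB gf (good_cst _)).
  rewrite nmM nm_real (ger0_norm (K0 n s)) /g.
  have [h|h] := ltP (nm (circ s - circ t)) d.
    rewrite mulrC (le_trans (ler_wpM2r (K0 n s) (dP s hs h)))// lerDl.
    by apply: divr_ge0 => //; apply: divr_ge0; [exact: mulr_ge0|exact: sqr_ge0].
  have Kd : K n s <= 4 / d ^+ 2 / n.+1%:R.
    rewrite ler_pM2r ?invr_gt0 ?ltr0n// ler_pdivlMr ?exprn_gt0//.
    apply: le_trans (dirichlet_bound n.+1 t s); rewrite ler_wpM2l ?sqr_ge0//.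
    by rewrite ler_pXn2r ?nnegrE ?nm_ge0 ?(ltW d0).
  have f2 : nm (f s - f t) <= 2 * M.
    by rewrite (le_trans (nm_sub _ _))// mulr_natl lerD.
  rewrite (le_trans (ler_pM (K0 n s) (nm_ge0 _) Kd f2))//.
  rewrite (_ : 4 / _ / _ * _ = 8 * M / d ^+ 2 / n.+1%:R); last by ring.
  by rewrite lerDr mulr_ge0// ltW.
have c0 : (fun n : nat => 8 * M / d ^+ 2 / n.+1%:R) @ \oo --> (0 : R).
  rewrite -[X in _ --> X](mulr0 (8 * M / d ^+ 2)).
  by apply: cvgMr; exact: cvg_harmonic.
near=> n; rewrite (le_lt_trans (key n))// [ltRHS]splitr ltrD2l.
near: n; have /cvgrPdist_lt /(_ _ e20) := c0; apply: filterS => n.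
by rewrite sub0r normrN; apply: le_lt_trans; exact: ler_norm.
Unshelve. all: by end_near. Qed.

Lemma I_dirichlet f n t : good f ->
  I (fun s => RtoC (nm (dirichlet n t s) ^+ 2) * f s) =
  \sum_(j < n) \sum_(k < n) circ t ^+ j * Num.conj (circ t ^+ k) *
     I (fun s => f s * Num.conj (circ s ^+ j) * circ s ^+ k).
Proof.
move=> gf; have gg j k : good (fun s => f s * Num.conj (circ s ^+ j) * circ s ^+ k).
  by apply: goodM (goodM gf (good_conj_circX _ _)) (good_circX _ _).
rewrite (eq_I (g := fun s => \sum_(j < n) \sum_(k < n) circ t ^+ j * Num.conj (circ t ^+ k) *
    (f s * Num.conj (circ s ^+ j) * circ s ^+ k))); last first.
  move=> s _; rewrite -sqr_norm_conj /dirichlet rmorph_sum mulr_suml mulr_suml.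
  apply: eq_bigr => j _; rewrite mulr_sumr mulr_suml; apply: eq_bigr => k _.
  by rewrite !exprMn !rmorphM !rmorphXn /= conjCK; ring.
rewrite I_sum => [|j]; last first.
  by apply: good_sum => k; apply: goodM (good_cst _) (gg _ _).
apply: eq_bigr => j _; rewrite I_sum => [|k]; last exact: goodM (good_cst _) (gg _ _).
by apply: eq_bigr => k _; rewrite IZ.
Qed.

End Fejer.

(** * Mean values of holomorphic functions *)

Lemma derivable_littleo (K : numFieldType) (f : K -> K) (x : K) :
  derivable f x 1 -> forall e : K, 0 < e -> exists2 d : K, 0 < d & forall y,
    `|y - x| < d -> `|f y - f x - 'D_1 f x * (y - x)| <= e * `|y - x|.
Proof.
move=> df e e0; have /cvgrPdist_le /(_ e e0) := df.
rewrite near_withinE => /nbhs_ballP[d /= d0 H]; exists d => // y yd.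
have [->|yx] := eqVneq y x; first by rewrite !subrr mulr0 subr0 normr0 mulr0.
have h0 : y - x != 0 by rewrite subr_eq0.
have := H (y - x); rewrite /ball /= sub0r normrN => /(_ yd h0).
rewrite /GRing.scale /= mulr1 subrK -/('D_1 f x) => h.
have -> : f y - f x - 'D_1 f x * (y - x) =
    - (('D_1 f x - (y - x)^-1 * (f y - f x)) * (y - x)) by field.
by rewrite normrN normrM ler_wpM2r.
Qed.

Section ComplexDifferentiability.
Variable R : realType.
Implicit Types (f F : C R -> C R) (z w : C R) (r s t : R).

Definition cdiff f z L := forall e : R, 0 < e -> exists2 d : R, 0 < d &
  forall w, nm (w - z) < d -> nm (f w - f z - L * (w - z)) <= e * nm (w - z).

Lemma derivable_cdiff f z : derivable f z 1 -> cdiff f z ('D_1 f z).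
Proof.
move=> df e e0; have e0' : 0 < RtoC e :> C R by rewrite ltcR.
have [[d d'] dd0 H] := derivable_littleo df e0'.
move: dd0; rewrite ltcE /= => /andP[/eqP d'0 d0]; exists d => // w wd.
have := H w; rewrite d'0 -[Complex d 0]/(RtoC d) normC_lt => /(_ wd).
by rewrite !normE -RtoCM lecR.
Qed.

Lemma cdiff_lipschitz f z L : cdiff f z L -> exists2 d : R, 0 < d &
  forall w, nm (w - z) < d -> nm (f w - f z) <= (1 + nm L) * nm (w - z).
Proof.
move=> /(_ _ ltr01)[d d0 H]; exists d => // w wd.
have := nmD (f w - f z - L * (w - z)) (L * (w - z)).
rewrite subrK nmM mulrDl => h; apply: (le_trans h).
by rewrite lerD2r H.
Qed.

(* The logarithmic radius makes [f (polar s t)] satisfy the Cauchy-Riemann equations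
   in (s, t) for holomorphic f, which is the form Green's formula needs. *)
Definition polar s t : C R := RtoC (expR (2 * pi * s)) * circ t.

Definition dz (x y : R) : C R := RtoC (2 * pi) * Complex x y.

Lemma polarD s t x y : polar (s + x) (t + y) = polar s t * polar x y.
Proof. by rewrite /polar circD mulrDr expRD RtoCM; ring. Qed.

Lemma nm_polar s t : nm (polar s t) = expR (2 * pi * s).
Proof. by rewrite nmM nm_circ mulr1 nm_real ger0_norm ?expR_ge0. Qed.

Lemma nm_dz x y : nm (dz x y) <= 2 * pi * (`|x| + `|y|).
Proof.
have p0 : 0 <= 2 * pi :> R by rewrite mulr_ge0// pi_ge0.
by rewrite nmM nm_real ger0_norm// ler_wpM2l// nm_le.
Qed.

Lemma polar0_diff (e : R) : 0 < e -> exists2 d : R, 0 < d & forall x y : R,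
  `|x| < d -> `|y| < d -> nm (polar x y - 1 - dz x y) <= e * (`|x| + `|y|).
Proof.
move=> e0; set p : R := 2 * pi.
have p0 : 0 < p by rewrite mulr_gt0// pi_gt0.
have e10 : 0 < e / (4 * p) by rewrite divr_gt0// mulr_gt0.
have [d1 d10 H1] := derivable_littleo (@derivable_expR R 0) e10.
have [d2 d20 H2] := derivable_littleo (@derivable_cos R 0) e10.
have [d3 d30 H3] := derivable_littleo (@derivable_sin R 0) e10.
have De : 'D_1 (@expR R) 0 = 1 by rewrite derive_val expR0.
have Dc : 'D_1 (@cos R) 0 = 0 by rewrite derive_val sin0 oppr0.
have Ds : 'D_1 (@sin R) 0 = 1 by rewrite derive_val cos0.
(* [p * Q] bounds the difference quotients of [circ] at 0 ([c2] below); [d4] is then chosen to make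
   the cross term [p * |x| * |circ y - 1|] at most [e / 4 * |y|]. *)
have [Q s0 EQ] : exists2 Q : R, 0 < Q & Q = 1 + e / (4 * p) + e / (4 * p) + 1.
  by exists (1 + e / (4 * p) + e / (4 * p) + 1); [lra|].
have d40 : 0 < e / (4 * (p * Q * p)).
  by apply: divr_gt0 => //; apply: mulr_gt0 => //; apply: mulr_gt0 => //; exact: mulr_gt0.
have pQ : 0 < p * Q * p by apply: mulr_gt0 => //; exact: mulr_gt0.
pose d4 : R := e / (4 * (p * Q * p)).
pose d := Num.min (Num.min d1 d2) (Num.min d3 d4).
have d0 : 0 < d by rewrite /d /d4 !lt_min d10 d20 d30.
exists (Num.min (d / p) d); first by rewrite lt_min divr_gt0.
move=> x y; rewrite !lt_min => /andP[xd xd'] /andP[yd yd'].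
have px : `|p * x - 0| < d by rewrite subr0 normrM gtr0_norm// mulrC -ltr_pdivlMr.
have py : `|p * y - 0| < d by rewrite subr0 normrM gtr0_norm// mulrC -ltr_pdivlMr.
have := px; have := py; rewrite {1 2}/d !lt_min.
move=> /andP[/andP[_ y2] /andP[y3 _]] /andP[/andP[x1 _] /andP[_ _]].
have := H1 _ x1; have := H2 _ y2; have := H3 _ y3.
rewrite De Dc Ds expR0 cos0 sin0 !subr0 !mul1r mul0r subr0 => h3 h2 h1.
have x4 : `|x| < d4 by case/and3P: xd'.
have Ecirc : circ y = Complex (cos (p * y)) (sin (p * y)) :> C R by [].
(* The radial and the angular factor are linearized separately; the middle summand is the
   second-order cross term. *)
have -> : polar x y - 1 - dz x y =
    RtoC (expR (p * x) - 1 - p * x) * circ y + RtoC (p * x) * (circ y - 1) +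
    (circ y - 1 - Complex 0 (p * y)).
  rewrite /polar /dz -/p Ecirc; apply: CP;
    rewrite ?(cReM, cReD, cReN, cImM, cImD, cImN) /=; ring.
have c1 : nm (circ y - 1 - Complex 0 (p * y)) <= 2 * (e / (4 * p)) * (p * `|y|).
  rewrite (le_trans (nm_le _))// Ecirc !(cReD, cReN, cImD, cImN) /=.
  rewrite ?oppr0 ?addr0 ?subr0.
  by move: h2 h3; rewrite normrM (gtr0_norm p0); lra.
have c2 : nm (circ y - 1) <= Q * (p * `|y|).
  rewrite EQ.
  have := nmD (circ y - 1 - Complex 0 (p * y)) (Complex 0 (p * y)).
  rewrite subrK => /le_trans; apply.
  have : nm (Complex 0 (p * y) : C R) <= p * `|y|.
    by rewrite (le_trans (nm_le _))//= normr0 add0r normrM gtr0_norm.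
  have : 0 <= p * `|y| by rewrite mulr_ge0// ltW.
  by move: c1; lra.
rewrite (le_trans (nmD _ _))//.
rewrite (le_trans (lerD (nmD _ _) (lexx _)))// !nmM nm_circ mulr1 !nm_real.
have pe : 0 <= p * `|y| by rewrite mulr_ge0// ltW.
have px0 : 0 <= p * `|x| by rewrite mulr_ge0// ltW.
move: h1; rewrite (normrM p x) (gtr0_norm p0) => h1.
have c3 : p * `|x| * nm (circ y - 1) <= e / 4 * `|y|.
  rewrite (le_trans (ler_wpM2l px0 c2))//.
  rewrite (_ : p * `|x| * _ = `|x| * (p * Q * p) * `|y|); last by ring.
  rewrite ler_wpM2r// -ler_pdivlMr//; apply: (le_trans (ltW x4)).
  by rewrite /d4 invfM mulrA.
have E1 : e / (4 * p) * (p * `|x|) = e / 4 * `|x| by field; rewrite gt_eqF.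
have E2 : 2 * (e / (4 * p)) * (p * `|y|) = e / 2 * `|y| by field; rewrite gt_eqF.
rewrite E1 in h1; rewrite E2 in c1.
have := normr_ge0 x; have := normr_ge0 y.
move: h1 c1 c3; move: (nm _) (nm _) => A B. 
have ee := e0.
nra.
Qed.

End ComplexDifferentiability.

(** * Circle means of holomorphic functions do not depend on the radius *)

Section CircleMeans.
Variable R : realType.
Notation mu := (@lebesgue_measure R).
Implicit Types (f F : C R -> C R) (z w L : C R) (r s t x : R).

(** Chain rule: the differential in [(s, t)] is multiplication by one complex number, which encodes
    the Cauchy-Riemann equations. *)
Lemma cdiff_polar f s t L : cdiff f (polar s t) L -> exists La : C R,
  forall e : R, 0 < e -> exists2 d : R, 0 < d & forall s' t' : R,
    `|s' - s| < d -> `|t' - t| < d ->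
    nm (f (polar s' t') - f (polar s t) - La * Complex (s' - s) (t' - t))
      <= e * (`|s' - s| + `|t' - t|).
Proof.
move=> df; set z0 := polar s t in df *.
exists (L * z0 * RtoC (2 * pi)) => e e0.
have p0 : 0 < 2 * pi :> R by rewrite mulr_gt0// pi_gt0.
set p : R := 2 * pi in p0 *.
have nz : 0 < nm z0 by rewrite nm_polar expR_gt0.
pose e1 : R := e / 2 / (nm z0 * (1 + p)).
have e10 : 0 < e1.
  by apply: divr_gt0; [exact: divr_gt0|apply: mulr_gt0 => //; lra].
pose e2 : R := Num.min 1 (e / 2 / ((1 + nm L) * nm z0)).
have L1 : 0 < 1 + nm L by rewrite ltr_pwDl// nm_ge0.
have Lz : 0 < (1 + nm L) * nm z0 by exact: mulr_gt0.
have e20 : 0 < e2.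
  by rewrite lt_min ltr01 /=; apply: divr_gt0 => //; exact: divr_gt0.
have [d1 d10 H1] := df _ e10.
have [d2 d20 H2] := polar0_diff e20.
pose q : R := nm z0 * (1 + p).
have q0 : 0 < q by apply: mulr_gt0 => //; lra.
exists (Num.min d2 (d1 / q / 2)).
  by rewrite lt_min d20 divr_gt0// divr_gt0.
move=> s' t'; rewrite !lt_min => /andP[xs xs'] /andP[xt xt'].
set x := s' - s in xs xs' *; set y := t' - t in xt xt' *.
have Ep : polar s' t' = z0 * polar x y by rewrite -polarD /x /y !subrKC.
have P := H2 _ _ xs xt.
have n0 : 0 <= `|x| + `|y| by rewrite addr_ge0.
have Pe : nm (polar x y - 1 - dz x y) <= `|x| + `|y|.
  by rewrite (le_trans P)// ler_piMl// ge_min lexx.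
have P1 : nm (polar x y - 1) <= (1 + p) * (`|x| + `|y|).
  have := nmD (polar x y - 1 - dz x y) (dz x y); rewrite subrK => h.
  by rewrite (le_trans h)// mulrDl mul1r lerD// nm_dz.
have Dz : nm (polar s' t' - z0) <= q * (`|x| + `|y|).
  rewrite Ep (_ : z0 * polar x y - z0 = z0 * (polar x y - 1)); last by ring.
  by rewrite nmM /q -mulrA ler_wpM2l// nm_ge0.
have Dz1 : nm (polar s' t' - z0) < d1.
  rewrite (le_lt_trans Dz)// mulrC -ltr_pdivlMr// [ltRHS]splitr.
  exact: ltrD.
have := H1 _ Dz1; set w := polar s' t' => h.
have -> : f w - f z0 - L * z0 * RtoC p * Complex x y =
    (f w - f z0 - L * (w - z0)) + L * (z0 * (polar x y - 1 - dz x y)).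
  by rewrite /w Ep /dz -/p; ring.
rewrite (le_trans (nmD _ _))//.
have h1 : nm (f w - f z0 - L * (w - z0)) <= e / 2 * (`|x| + `|y|).
  rewrite (le_trans h)// (le_trans (ler_wpM2l (ltW e10) Dz))// mulrA ler_wpM2r//.
  by rewrite /e1 -/q divfK// gt_eqF.
have h2 : nm (L * (z0 * (polar x y - 1 - dz x y))) <= e / 2 * (`|x| + `|y|).
  rewrite (nmM L) (nmM z0) mulrA; apply: le_trans (ler_wpM2l (mulr_ge0 (nm_ge0 _) (nm_ge0 _)) P) _.
  rewrite mulrA ler_wpM2r//.
  have : e2 <= e / 2 / ((1 + nm L) * nm z0) by rewrite ge_min lexx orbT.
  move=> /(ler_wpM2l (ltW Lz)); rewrite [leRHS]mulrC divfK ?gt_eqF// => h3.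
  apply: le_trans h3; rewrite ler_wpM2r ?(ltW e20)// ler_wpM2r ?(ltW nz)//.
  by rewrite lerDr.
by rewrite (le_trans (lerD h1 h2))// -mulrDl -splitr.
Qed.

Lemma is_derive_primitive (h : R -> R) a x u : a < x -> x < u ->
  (forall y, a <= y <= u -> {for y, continuous h}) ->
  is_derive x 1 (fun y => \int[mu]_(s in `[a, y]) h s) (h x).
Proof.
move=> ax xu ch.
have ih : mu.-integrable `[a, u] (EFin \o h).
  apply: continuous_compact_integrable; first exact: segment_compact.
  by apply: continuous_in_subspaceT => y; rewrite inE /= in_itv; exact: ch.
have [|dF F'] := continuous_FTC1_closed xu ih ax; first by apply: ch; lra.
by apply: DeriveDef; [exact: dF|rewrite -derive1E].
Qed.

(** The origin is left out so that [F w / w^k] qualifies; its circle means are the Taylor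
    coefficients. *)
Definition holo0 f := forall z, 0 < nm z < 1 -> exists L, cdiff f z L.

Let near_eps (h : R -> R) s :
  (forall e : R, 0 < e -> exists2 d : R, 0 < d & forall s', `|s' - s| < d ->
     `|h s' - h s| < e) -> {for s, continuous h}.
Proof.
move=> H; apply/cvgrPdist_lt => e /H[d d0 dP].
apply/nbhs_ballP; exists d => // s'; rewrite /ball /= distrC => /dP.
by rewrite distrC.
Qed.

(** Green's formula for [Re f] and [Im f] on [[a, b] x [0, 1]]: the sides [t = 0] and [t = 1] cancel
    by periodicity, and the other two sides are the circle means of [Re f]. *)
Lemma Re_mean_const f a b : holo0 f -> a <= b -> b < 0 ->
  J (fun t => complex.Re (f (polar a t))) = J (fun t => complex.Re (f (polar b t))).
Proof.
move=> hf ab b0.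
pose X s t := complex.Re (f (polar s t)); pose Y s t := complex.Im (f (polar s t)).
have polar1 s t : s < 0 -> 0 < nm (polar s t) < 1.
  move=> s0; rewrite nm_polar expR_gt0 expR_lt1 pmulr_rlt0// mulr_gt0// pi_gt0//.
have loc s t : s < 0 -> exists La : C R,
  forall e : R, 0 < e -> exists2 d : R, 0 < d & forall s' t' : R,
    `|s' - s| < d -> `|t' - t| < d ->
    nm (f (polar s' t') - f (polar s t) - La * Complex (s' - s) (t' - t))
      <= e * (`|s' - s| + `|t' - t|).
  by move=> /(polar1 _ t)/hf[L /cdiff_polar].
have cont s t : s < 0 -> forall e : R, 0 < e -> exists2 d : R, 0 < d &
    forall s' t', `|s' - s| < d -> `|t' - t| < d ->
    nm (f (polar s' t') - f (polar s t)) < e.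
  move=> s0 e e0; have [La H] := loc s t s0.
  have [d d0 dP] := H _ ltr01.
  have k0 : 0 < (1 + nm La) * 2 by rewrite mulr_gt0// ltr_pwDl// nm_ge0.
  exists (Num.min d (e / ((1 + nm La) * 2))); first by rewrite lt_min d0 divr_gt0.
  move=> s' t'; rewrite !lt_min => /andP[sd se] /andP[td te].
  have := nmD (f (polar s' t') - f (polar s t) - La * Complex (s' - s) (t' - t))
    (La * Complex (s' - s) (t' - t)); rewrite subrK => /le_lt_trans; apply.
  have h := dP _ _ sd td; rewrite mul1r in h.
  have h2 : nm (La * Complex (s' - s) (t' - t)) <= nm La * (`|s' - s| + `|t' - t|).
    by rewrite nmM ler_wpM2l ?nm_ge0// nm_le.
  rewrite (le_lt_trans (lerD h h2))// -{1}[_ + `|t' - t|]mul1r -mulrDl.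
  rewrite mulrC -ltr_pdivlMr ?ltr_pwDl ?nm_ge0//.
  rewrite (_ : e / _ = e / ((1 + nm La) * 2) + e / ((1 + nm La) * 2)); first exact: ltrD.
  by field; rewrite gt_eqF// ltr_pwDl ?nm_ge0.
have cX s t : s < 0 -> {for t, continuous (X s)}.
  move=> s0; apply: near_eps => e e0; have [d d0 dP] := cont s t s0 e e0.
  exists d => // t' td; rewrite (le_lt_trans _ (dP s t' _ td))// ?subrr ?normr0//.
  by rewrite (le_trans _ (nm_Re _))// cReD cReN.
have cY s t : s < 0 -> {for s, continuous (Y^~ t)}.
  move=> s0; apply: near_eps => e e0; have [d d0 dP] := cont s t s0 e e0.
  exists d => // s' sd; rewrite (le_lt_trans _ (dP s' t sd _))// ?subrr ?normr0//.
  by rewrite (le_trans _ (nm_Im _))// cImD cImN.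
(* The base points [-1] and [a - 1] lie strictly before the rectangle, so that the primitives are
   differentiable on its edges too. The bounds [2] and [b / 2] below do the same on the other side,
   [b / 2] being still negative. *)
pose PX s t : R := \int[mu]_(x in `[-1, t]) X s x.
pose PY s t : R := \int[mu]_(x in `[a - 1, s]) Y x t.
have G : rect_diff (fun s t => PX s t - PY s t) a b 0 1 = 0.
  apply: (@green0 _ PX PY X Y) => //.
  - move=> s t hs ht; apply: (@is_derive_primitive (X s) _ _ 2); [lra|lra|].
    by move=> y _; apply: cX; lra.
  - move=> s t hs ht; apply: (@is_derive_primitive (Y^~ t) _ _ (b / 2)); [lra|lra|].
    by move=> y hy; apply: cY; lra.
  - move=> s t hs ht; have [|La H] := loc s t; first by lra.
    (* Cauchy-Riemann with [La = al + i ga]: [X_s = Y_t = al], [Y_s = ga] and [X_t = - ga]. *)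
    exists (complex.Re La), (- complex.Im La), (complex.Im La) => e e0.
    have [d d0 dP] := H e e0; exists d => // s' t' sd td; have := dP _ _ sd td.
    move=> h; split; apply: le_trans h.
      rewrite (le_trans _ (nm_Re _))// !(cReD, cReN, cReM) /= /X.
      by rewrite le_eqVlt; apply/orP; left; apply/eqP; congr `|_|; ring.
    rewrite (le_trans _ (nm_Im _))// !(cImD, cImN, cImM) /= /Y.
    by rewrite le_eqVlt; apply/orP; left; apply/eqP; congr `|_|; ring.
have PXJ s : s < 0 -> PX s 1 - PX s 0 = J (X s).
  move=> s0; have iX c d : mu.-integrable `[c, d] (EFin \o X s).
    apply: continuous_compact_integrable; first exact: segment_compact.
    by apply: continuous_in_subspaceT => y _; exact: cX.
  rewrite /PX (@Rintegral_itvB _ (X s) (BLeft (-1)) (BRight 1) 0 (iX _ _)) ?bnd_simp ?lerN10//.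
  rewrite Rintegral_itv_obnd_cbnd//.
  by apply: integrableS (iX 0 1) => //; apply: subset_itvr; rewrite bnd_simp.
have PYper s : PY s 1 = PY s 0.
  rewrite /PY; congr (fine _); apply: eq_integral => y _; congr EFin.
  by rewrite /Y /polar circ1 circ0.
move: G; rewrite /rect_diff !PYper => G.
apply: etrans (esym (PXJ a (le_lt_trans ab b0))) (etrans _ (PXJ b b0)).
move: G; move: (PX b 1) (PX b 0) (PX a 1) (PX a 0) (PY b 0) (PY a 0) => *; lra.
Qed.

Lemma polarP r : 0 < r -> exists s, forall t, polar s t = RtoC r * circ t.
Proof.
move=> r0; exists (ln r / (2 * pi)) => t; rewrite /polar.
have p0 : 2 * pi != 0 :> R by rewrite gt_eqF// mulr_gt0// pi_gt0.
by rewrite [2 * pi * _]mulrC divfK// lnK.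
Qed.

Lemma mean_const f r1 r2 : holo0 f -> 0 < r1 < 1 -> 0 < r2 < 1 ->
  I (fun t => f (RtoC r1 * circ t)) = I (fun t => f (RtoC r2 * circ t)).
Proof.
move=> hf.
wlog r12 : r1 r2 / r1 <= r2 => [H h1 h2|/andP[r10 r11] /andP[r20 r21]].
  by have [/H->//|/ltW/H->] := leP r1 r2.
have [s1 E1] := polarP r10; have [s2 E2] := polarP r20.
have p0 : 0 < 2 * pi :> R by rewrite mulr_gt0// pi_gt0.
have nE s r : (forall t, polar s t = RtoC r * circ t) -> 0 < r -> expR (2 * pi * s) = r.
  by move=> E r0; rewrite -(nm_polar s 0) E nmM nm_circ mulr1 nm_real gtr0_norm.
have s12 : s1 <= s2.
  by rewrite -(ler_pM2l p0) -ler_expR (nE _ _ E1)// (nE _ _ E2).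
have s20 : s2 < 0.
  by rewrite -(pmulr_rlt0 _ p0) -expR_lt1 (nE _ _ E2).
(* The imaginary part of [f] is the real part of [- i f]. *)
have hfi : holo0 (fun z => - Complex 0 1 * f z).
  move=> z /hf[L H]; exists (- Complex 0 1 * L) => e e0.
  have [d d0 dP] := H e e0; exists d => // w wd; apply: le_trans (dP w wd).
  rewrite (_ : _ - _ - _ = - Complex 0 1 * (f w - f z - L * (w - z))); last by ring.
  rewrite nmM nmN (_ : nm _ = 1) ?mul1r//.
  by rewrite /nm /= expr0n /= add0r expr1n sqrtr1.
have ReI z : complex.Re (- Complex 0 1 * z) = complex.Im z.
  by rewrite cReM cReN cImN /=; ring.
have E f' : (fun t => f' (RtoC r1 * circ t)) = (fun t => f' (polar s1 t)) :> (R -> C R).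
  by apply/funext => t; rewrite E1.
have E' f' : (fun t => f' (RtoC r2 * circ t)) = (fun t => f' (polar s2 t)) :> (R -> C R).
  by apply/funext => t; rewrite E2.
rewrite E E'; apply: CP => /=; first exact: Re_mean_const.
have := Re_mean_const hfi s12 s20.
by under eq_J do rewrite ReI; under [in RHS]eq_J do rewrite ReI.
Qed.

End CircleMeans.

(** * Square-summable sequences *)

Section SquareSummable.
Variable R : realType.
Implicit Types (f g h : nat -> C R) (a b : R).

Lemma cvgC_series (u : nat -> C R) (v : nat -> R) :
  (forall k, nm (u k) <= v k) -> cvg (series v @ \oo) ->
  exists L : C R, series u @ \oo --> L.
Proof.
move=> uv cv.
have sub (p : C R -> R) : (forall z, `|p z| <= nm z) ->
    cvg (series (fun k => p (u k)) @ \oo).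
  move=> pn; apply: (@normed_cvg _ R); apply: series_le_cvg cv => n //=.
    exact: le_trans (nm_ge0 _) (uv n).
  exact: le_trans (pn _) (uv n).
have /cvg_ex[A cA] := sub (@complex.Re R) (@nm_Re R).
have /cvg_ex[B cB] := sub (@complex.Im R) (@nm_Im R).
exists (Complex A B); apply/cvgC_ReIm; split => /=.
  rewrite (_ : (fun n => _) = series (fun k => complex.Re (u k)))//.
  by apply/funext => n; rewrite /series /= cRe_sum.
rewrite (_ : (fun n => _) = series (fun k => complex.Im (u k)))//.
by apply/funext => n; rewrite /series /= cIm_sum.
Qed.

Lemma cvgC_unique (u : nat -> C R) (L L' : C R) :
  u @ \oo --> L -> u @ \oo --> L' -> L = L'.
Proof.
move=> /cvgC_ReIm[u1 u2] /cvgC_ReIm[v1 v2]; apply: CP.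
  exact: (cvg_unique _ u1 v1).
exact: (cvg_unique _ u2 v2).
Qed.

Lemma series_mkord (V : zmodType) (u : nat -> V) n :
  series u n = \sum_(k < n) u k.
Proof. by rewrite /series /= big_mkord. Qed.

(** [b] bounds the l2 norm of [f]. Carrying a bound instead of the norm reduces estimates to finite
    sums and makes them stable under coordinatewise limits. *)
Definition nb f b := 0 <= b /\ forall N, \sum_(k < N) nm (f k) ^+ 2 <= b ^+ 2.

Lemma nb_ge0 f b : nb f b -> 0 <= b. Proof. by case. Qed.

Lemma nb_le f b b' : nb f b -> b <= b' -> nb f b'.
Proof.
move=> [b0 fb] bb'; split=> [|N]; first exact: le_trans bb'.
by apply: le_trans (fb N) _; rewrite ler_pXn2r ?nnegrE// (le_trans b0).
Qed.

Lemma eq_nb f g b : f =1 g -> nb f b -> nb g b.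
Proof. by move=> /funext ->. Qed.

Lemma nb_coef f b k : nb f b -> nm (f k) <= b.
Proof.
move=> [b0 fb]; rewrite -(@ler_pXn2r _ 2) ?nnegrE ?nm_ge0// (le_trans _ (fb k.+1))//.
by rewrite big_ord_recr /= lerDr sumr_ge0// => i _; exact: sqr_ge0.
Qed.

Lemma nb0 : nb (fun=> 0) 0.
Proof. by split=> // N; rewrite big1 => [|k _]; rewrite ?nm0 expr0n. Qed.

Lemma cauchy_schwarz_sum N (u v : nat -> R) a b : 0 <= a -> 0 <= b ->
  (forall k, 0 <= u k) -> (forall k, 0 <= v k) ->
  \sum_(k < N) u k ^+ 2 <= a ^+ 2 -> \sum_(k < N) v k ^+ 2 <= b ^+ 2 ->
  \sum_(k < N) u k * v k <= a * b.
Proof.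
move=> a0 b0 u0 v0 ua vb.
have zero (w : nat -> R) : \sum_(k < N) w k ^+ 2 <= 0 ^+ 2 -> forall k : 'I_N, w k = 0.
  rewrite expr0n /= => h k; apply/eqP; rewrite -sqrf_eq0 eq_le sqr_ge0 andbT.
  by rewrite (le_trans _ h)// (bigD1 k)//= lerDl sumr_ge0// => i _; exact: sqr_ge0.
move: a0; rewrite le_eqVlt => /predU1P[a0|a0].
  move: ua; rewrite -a0 mul0r => /zero z.
  by rewrite big1// => k _; rewrite z mul0r.
move: b0; rewrite le_eqVlt => /predU1P[b0|b0].
  move: vb; rewrite -b0 mulr0 => /zero z.
  by rewrite big1// => k _; rewrite z mulr0.
have ab : 0 < a * b by rewrite mulr_gt0.
(* Cauchy-Schwarz by summing [u v <= a b / 2 * (u^2 / a^2 + v^2 / b^2)], hence the separate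
   treatment of [a = 0] and [b = 0]. *)
have -> : a * b = a * b / 2 * (a ^- 2 * a ^+ 2 + b ^- 2 * b ^+ 2).
  by field; rewrite !gt_eqF.
apply: le_trans (_ : a * b / 2 * (a ^- 2 * \sum_(k < N) u k ^+ 2 +
    b ^- 2 * \sum_(k < N) v k ^+ 2) <= _); last first.
  apply: ler_wpM2l; first by rewrite divr_ge0// ltW.
  by apply: lerD; apply: ler_wpM2l => //; rewrite invr_ge0 exprn_ge0// ltW.
rewrite !mulr_sumr -big_split mulr_sumr; apply: ler_sum => k _ /=.
rewrite -subr_ge0.
have -> : a * b / 2 * (a ^- 2 * u k ^+ 2 + b ^- 2 * v k ^+ 2) - u k * v k =
    (a * b / 2) * (u k / a - v k / b) ^+ 2 by field; rewrite !gt_eqF.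
by rewrite mulr_ge0 ?sqr_ge0// divr_ge0// ltW.
Qed.

Lemma nb_dot_le f g a b N : nb f a -> nb g b ->
  \sum_(k < N) nm (f k) * nm (g k) <= a * b.
Proof.
move=> [a0 fa] [b0 gb]; apply: (@cauchy_schwarz_sum _ (fun k => nm (f k)) (fun k => nm (g k))) => //.
- by move=> k; exact: nm_ge0.
- by move=> k; exact: nm_ge0.
Qed.

Lemma nbD f g a b : nb f a -> nb g b -> nb (fun k => f k + g k) (a + b).
Proof.
move=> nf ng; have [a0 fa] := nf; have [b0 gb] := ng.
split=> [|N]; first exact: addr_ge0.
apply: le_trans (_ : \sum_(k < N) (nm (f k) ^+ 2 + nm (g k) ^+ 2 + 2 * (nm (f k) * nm (g k))) <= _).
  apply: ler_sum => k _; apply: le_trans (_ : (nm (f k) + nm (g k)) ^+ 2 <= _).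
    by rewrite ler_pXn2r ?nnegrE ?addr_ge0 ?nm_ge0// nmD.
  by rewrite le_eqVlt; apply/orP; left; apply/eqP; ring.
rewrite !big_split /= -mulr_sumr.
by have := nb_dot_le N nf ng; have := fa N; have := gb N; lra.
Qed.

Lemma nbZ (c : C R) f a : nb f a -> nb (fun k => c * f k) (nm c * a).
Proof.
move=> [a0 fa]; split=> [|N]; first by rewrite mulr_ge0 ?nm_ge0.
under eq_bigr do rewrite nmM exprMn.
by rewrite -mulr_sumr exprMn ler_wpM2l ?sqr_ge0.
Qed.

Lemma nbN f a : nb f a -> nb (fun k => - f k) a.
Proof. by move=> [a0 fa]; split=> // N; under eq_bigr do rewrite nmN. Qed.

Lemma nbB f g a b : nb f a -> nb g b -> nb (fun k => f k - g k) (a + b).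
Proof. by move=> nf /nbN; exact: nbD. Qed.

Lemma nb_sum (u : nat -> nat -> C R) (b : nat -> R) n :
  (forall j, (j < n)%N -> nb (u j) (b j)) ->
  nb (fun k => \sum_(j < n) u j k) (\sum_(j < n) b j).
Proof.
elim: n => [|n IH] H; first by rewrite big_ord0; under [X in nb X _]eq_fun do rewrite big_ord0; exact: nb0.
rewrite big_ord_recr; under [X in nb X _]eq_fun do rewrite big_ord_recr.
by apply: nbD; [apply: IH => j jn; apply: H; rewrite ltnW|exact: H].
Qed.

(** Fatou's lemma for sequences: each finite sum of squares passes to the limit. *)
Lemma nb_lim (F : nat -> nat -> C R) f b :
  (\forall n \near \oo, nb (F n) b) -> (forall k, F ^~ k @ \oo --> f k) -> nb f b.
Proof.
move=> [n0 _ Fb] Ff; have b0 : 0 <= b by case: (Fb n0 (leqnn _)).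
split=> // N.
have c : (fun n => \sum_(k < N) nm (F n k) ^+ 2) @ \oo --> \sum_(k < N) nm (f k) ^+ 2.
  apply: cvg_big => [|k _]; [exact: add_continuous|]; have /cvgC_ReIm[c1 c2] := Ff k.
  rewrite nm_sqr; under eq_fun do rewrite nm_sqr.
  by apply: cvgD; apply: cvgM.
rewrite -(cvg_lim _ c)//; apply: limr_le; first by apply/cvg_ex; eexists; exact: c.
by exists n0 => // n /Fb[_]; apply.
Qed.

Lemma nb_H2 f b : nb f b -> H2 f.
Proof.
move=> [b0 fb]; have [||L cL] := @cvgC_series (fun k => `|f k| ^+ 2) (fun k => nm (f k) ^+ 2).
- by move=> k; rewrite normE -RtoCX nm_real ger0_norm ?sqr_ge0.
- apply: nondecreasing_is_cvgn.
    apply/nondecreasing_seqP => n; rewrite /series /= big_nat_recr//= lerDl.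
    exact: sqr_ge0.
  by exists (b ^+ 2) => _ [n _ <-]; rewrite series_mkord.
by apply/cvg_ex; exists L.
Qed.

Lemma H2_nb f : H2 f -> exists b, nb f b.
Proof.
move=> /cvg_ex[L /cvgC_ReIm[cL _]].
have E : (fun n => complex.Re (series (fun k => `|f k| ^+ 2) n)) =
    series (fun k => nm (f k) ^+ 2).
  apply/funext => n; rewrite !series_mkord cRe_sum; apply: eq_bigr => k _.
  by rewrite normE -RtoCX.
rewrite E in cL.
have mono : nondecreasing_seq (series (fun k => nm (f k) ^+ 2)).
  apply/nondecreasing_seqP => n; rewrite /series /= big_nat_recr//= lerDl.
  exact: sqr_ge0.
have L0 : 0 <= complex.Re L.
  have := nondecreasing_cvgn_le mono (cvgP _ cL) 0%N.
  by rewrite (cvg_lim _ cL)// series_mkord big_ord0.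
exists (Num.sqrt (complex.Re L)); split=> [|N]; first exact: sqrtr_ge0.
rewrite sqr_sqrtr// -(series_mkord (fun k => nm (f k) ^+ 2)) -(cvg_lim _ cL)//.
exact: (nondecreasing_cvgn_le mono (cvgP _ cL)).
Qed.

Lemma nb_tail f b : nb f b -> forall e : R, 0 < e ->
  exists K, nb (fun k => if (k < K)%N then 0 else f k) e.
Proof.
move=> [b0 fb] e e0; pose s := series (fun k => nm (f k) ^+ 2).
have mono : nondecreasing_seq s.
  apply/nondecreasing_seqP => n; rewrite /s /series /= big_nat_recr//= lerDl.
  exact: sqr_ge0.
have cs : cvgn s.
  apply: nondecreasing_is_cvgn => //.
  by exists (b ^+ 2) => _ [n _ <-]; rewrite /s series_mkord.
have e20 : 0 < e ^+ 2 by rewrite exprn_gt0.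
have /cvgrPdist_lt/(_ _ e20)[K _ HK] := cs.
exists K; split=> [|N]; first exact: ltW.
have [NK|KN] := leqP N K.
  by rewrite big1 ?sqr_ge0// => k _; rewrite (leq_trans (ltn_ord k) NK) nm0 expr0n.
have E n : \sum_(k < K + n) nm (if (k < K)%N then 0 else f k) ^+ 2 = s (K + n)%N - s K.
  elim: n => [|n IH].
    by rewrite addn0 subrr big1// => k _; rewrite ltn_ord nm0 expr0n.
  rewrite addnS big_ord_recr /= IH ltnNge leq_addr /= /s /series /= [in RHS]big_nat_recr//=.
  by rewrite addrAC.
rewrite -(subnKC (ltnW KN)) E subnKC ?(ltnW KN)//.
have /= h1 := HK K (leqnn _).
have h2 := nondecreasing_cvgn_le mono cs N.
by move: h1; rewrite ltr_norml => /andP[_ h1]; move: h1 h2; rewrite /s; lra.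
Qed.

Definition dot f g (k : nat) : C R := f k * Num.conj (g k).

Lemma ip_cvg f g a b : nb f a -> nb g b -> series (dot f g) @ \oo --> ip f g.
Proof.
move=> nf ng; have [||L cL] := @cvgC_series (dot f g) (fun k => nm (f k) * nm (g k)).
- by move=> k; rewrite nmM nm_conj.
- apply: nondecreasing_is_cvgn.
    apply/nondecreasing_seqP => n; rewrite /series /= big_nat_recr//= lerDl.
    by rewrite mulr_ge0 ?nm_ge0.
  by exists (a * b) => _ [n _ <-]; rewrite series_mkord (nb_dot_le _ nf ng).
by apply/cvg_ex; exists L.
Qed.

Lemma ip_eq f g a b L : nb f a -> nb g b -> series (dot f g) @ \oo --> L -> ip f g = L.
Proof. by move=> nf ng cL; apply: cvgC_unique (ip_cvg nf ng) cL. Qed.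

Lemma nm_cvg_le (u : nat -> C R) L b : u @ \oo --> L ->
  (\forall n \near \oo, nm (u n) <= b) -> nm L <= b.
Proof.
move=> /cvgC_eps uL ub; rewrite leNgt; apply/negP => bL.
have /uL e0 : 0 < nm L - b by rewrite subr_gt0.
have [n [/= h1 h2]] := filter_ex (filterI e0 ub).
have := nmD (L - u n) (u n); rewrite subrK nmB; lra.
Qed.

Lemma ip_le f g a b : nb f a -> nb g b -> nm (ip f g) <= a * b.
Proof.
move=> nf ng; apply: (nm_cvg_le (ip_cvg nf ng)); apply: nearW => n.
rewrite series_mkord (le_trans (nm_sum _ _ _))// (le_trans _ (nb_dot_le n nf ng))//.
by apply: ler_sum => k _; rewrite nmM nm_conj.
Qed.

Lemma ipDl f g h a b c : nb f a -> nb g b -> nb h c ->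
  ip (fun k => f k + g k) h = ip f h + ip g h.
Proof.
move=> nf ng nh; apply: (ip_eq (nbD nf ng) nh).
rewrite (_ : series _ = (fun n => series (dot f h) n + series (dot g h) n)).
  by apply: cvgD; [exact: (ip_cvg nf nh)|exact: (ip_cvg ng nh)].
apply/funext => n; rewrite !series_mkord -big_split; apply: eq_bigr => k _.
by rewrite /dot mulrDl.
Qed.

Lemma ipZl (z : C R) f h a c : nb f a -> nb h c -> ip (fun k => z * f k) h = z * ip f h.
Proof.
move=> nf nh; apply: (ip_eq (nbZ z nf) nh).
rewrite (_ : series _ = (fun n => z * series (dot f h) n)).
  by apply: cvgMr; exact: (ip_cvg nf nh).
apply/funext => n; rewrite !series_mkord mulr_sumr; apply: eq_bigr => k _.
by rewrite /dot mulrA.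
Qed.

Lemma ip_sum (u : nat -> nat -> C R) (b : nat -> R) h c n :
  (forall j, (j < n)%N -> nb (u j) (b j)) -> nb h c ->
  ip (fun k => \sum_(j < n) u j k) h = \sum_(j < n) ip (u j) h.
Proof.
move=> + nh; elim: n => [|n IH] H.
  rewrite big_ord0 (_ : (fun k => _) = (fun k => 0 * 0)).
    by rewrite (ipZl _ nb0 nh) mul0r.
  by apply/funext => k; rewrite big_ord0 mulr0.
have H' j : (j < n)%N -> nb (u j) (b j) by move=> jn; apply: H; rewrite ltnW.
rewrite big_ord_recr /= -IH// -(ipDl (nb_sum H') (H n _) nh)//.
by congr ip; apply/funext => k; rewrite big_ord_recr.
Qed.

(** For bounded sequences, coordinatewise convergence is weak convergence: up to a tail of small
    norm, [f] has finitely many coordinates. *)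
Lemma ip_weak_cvg f (F : nat -> nat -> C R) h a b : nb f a ->
  (forall m, nb (F m) b) -> (forall j, F ^~ j @ \oo --> h j) ->
  (fun m => ip f (F m)) @ \oo --> ip f h.
Proof.
move=> nf nF Fh; have nh : nb h b by apply: nb_lim Fh; exact: nearW.
have b0 := nb_ge0 nh.
apply/cvgC_eps => e e0.
(* The tail is paired with [F m] and with [h], both bounded by [b]: two errors of at most
   [e / 4]. *)
have e10 : 0 < e / (4 * (b + 1)) by rewrite divr_gt0// mulr_gt0//; lra.
have [K nt] := nb_tail nf e10; set ft := fun k => _ in nt.
pose fh k : C R := if (k < K)%N then f k else 0.
have fE : f = (fun k => fh k + ft k).
  by apply/funext => k; rewrite /fh /ft; case: ifP; rewrite ?addr0 ?add0r.
have nfh : nb fh (a + e / (4 * (b + 1))).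
  apply: eq_nb (nbB nf nt) => k; rewrite /fh /ft.
  by case: ifP; rewrite ?subr0 ?subrr.
have fin g c : nb g c -> ip fh g = \sum_(k < K) fh k * Num.conj (g k).
  move=> ng; apply: cvg_lim; first exact: norm_hausdorff.
  apply/cvgC_eps => e' e'0; exists K => // n /= Kn.
  rewrite series_mkord -(subnKC Kn) big_split_ord /= [X in nm (_ + X - _)]big1.
    by rewrite addr0 subrr nm0.
  by move=> k _; rewrite /fh ltnNge leq_addr /= mul0r.
have cf : (fun m => ip fh (F m)) @ \oo --> ip fh h.
  rewrite (fin _ _ nh); under eq_fun do rewrite (fin _ _ (nF _)).
  apply: cvg_big => [|k _]; [exact: add_continuous|apply: cvgMr].
  have /cvgC_nm := Fh k => H; apply/cvgC_nm; apply: cvg_trans H.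
  by apply: near_eq_cvg; apply: nearW => m /=; rewrite -rmorphB nm_conj.
have e20 : 0 < e / 2 by rewrite divr_gt0.
have /cvgC_eps/(_ _ e20) := cf; apply: filterS => m hm.
rewrite fE (ipDl nfh nt (nF m)) (ipDl nfh nt nh) opprD addrACA.
rewrite (le_lt_trans (nmD _ _))// [ltRHS]splitr ltr_leD//.
rewrite (le_trans (nm_sub _ _))//.
have := ip_le nt (nF m); have := ip_le nt nh.
have E : e / (4 * (b + 1)) * b <= e / 4.
  rewrite [leLHS](_ : _ = e / 4 * (b / (b + 1))); last by field; rewrite gt_eqF//; lra.
  rewrite ler_piMr ?divr_ge0 ?(ltW e0)// ler_pdivrMr; lra.
by move: E; lra.
Qed.

Definition delta (j k : nat) : C R := (k == j)%:R.

Lemma nb_delta j : nb (delta j) 1.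
Proof.
split=> // N; have E (k : nat) : nm (delta j k) ^+ 2 = (k == j)%:R.
  by rewrite /delta; case: eqP => _; rewrite ?nm1 ?nm0 ?expr1n ?expr0n.
under eq_bigr do rewrite E; rewrite expr1n.
have [jN|Nj] := ltnP j N; last first.
  by rewrite big1// => k _; rewrite ltn_eqF// (leq_trans (ltn_ord k)).
rewrite (bigD1 (Ordinal jN))//= eqxx big1 ?addr0// => k.
by rewrite -val_eqE /= => /negbTE ->.
Qed.

Lemma ip_fin f h N : (forall k, (N <= k)%N -> h k = 0) ->
  ip f h = \sum_(k < N) f k * Num.conj (h k).
Proof.
move=> h0; apply: cvg_lim; first exact: norm_hausdorff.
apply/cvgC_eps => e e0; exists N => // n /= Nn.
rewrite series_mkord -(subnKC Nn) big_split_ord /= [X in nm (_ + X - _)]big1.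
  by rewrite addr0 subrr nm0.
by move=> k _; rewrite h0 ?leq_addr// conjC0 mulr0.
Qed.

Lemma ip_delta f j : ip f (delta j) = f j.
Proof.
rewrite (@ip_fin _ _ j.+1) => [|k jk]; last by rewrite /delta gtn_eqF.
rewrite big_ord_recr /= big1 => [|k _]; last first.
  by rewrite /delta ltn_eqF// conjC0 mulr0.
by rewrite /delta eqxx conjC1 mulr1 add0r.
Qed.

End SquareSummable.

(** * Taylor coefficients of bounded holomorphic functions *)

Section PowerSeries.
Variable R : realType.
Implicit Types (f F : C R -> C R) (z w : C R) (r s t : R) (a : nat -> C R).

Lemma cvg_pseries a (M r : R) z : 0 < r < 1 -> (forall k, nm (a k) * r ^+ k <= M) ->
  nm z < r -> exists L : C R, series (fun k => a k * z ^+ k) @ \oo --> L.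
Proof.
move=> /andP[r0 _] aM zr.
apply: (@cvgC_series R _ (geometric M (nm z / r))).
  move=> k; rewrite nmM nmX /geometric /=.
  have {1}-> : nm z = r * (nm z / r) by rewrite mulrC divfK// gt_eqF.
  by rewrite exprMn mulrA ler_wpM2r// exprn_ge0// divr_ge0 ?nm_ge0 ?ltW.
apply: is_cvg_geometric_series.
by rewrite ger0_norm ?divr_ge0 ?nm_ge0 ?ltW// ltr_pdivrMr// mul1r.
Qed.

Lemma polar_form z : exists t, z = RtoC (nm z) * circ t.
Proof.
have [->|z0] := eqVneq z 0.
  by exists 0; rewrite nm0 (_ : RtoC 0 = 0)// mul0r.
have n0 : 0 < nm z.
  by rewrite lt_neqAle nm_ge0 andbT eq_sym; apply: contra_neq z0 => /nm_eq0.
pose x := complex.Re z / nm z; pose y := complex.Im z / nm z.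
have xy : x ^+ 2 + y ^+ 2 = 1.
  by rewrite !expr_div_n -mulrDl -nm_sqr divff// expf_neq0// gt_eqF.
have x1 : -1 <= x <= 1.
  by rewrite -ler_norml -(@ler_pXn2r _ 2)// ?nnegrE// real_normK ?num_real// expr1n -xy lerDl sqr_ge0.
have [th [cth sth]] : exists th : R, cos th = x /\ sin th = y.
  have s2 : Num.sqrt (1 - x ^+ 2) = `|y| by rewrite -xy addrAC subrr add0r sqrtr_sqr.
  have [y0|y0] := leP 0 y.
    by exists (acos x); rewrite sin_acos// s2 ger0_norm//; split=> //; apply: acosK; rewrite in_itv.
  exists (- acos x); rewrite cosN sinN sin_acos// s2 ltr0_norm// opprK; split=> //.
  by apply: acosK; rewrite in_itv.
have p0 : 2 * pi != 0 :> R by rewrite gt_eqF// mulr_gt0// pi_gt0.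
exists (th / (2 * pi)); rewrite /circ [2 * pi * _]mulrC divfK// cth sth.
by apply: CP; rewrite ?cReM ?cImM /= mul0r ?subr0 ?addr0 mulrC divfK// gt_eqF.
Qed.

(** Radii tending to 1; the shift by 2 keeps [rho 0] positive. *)
Definition rho (m : nat) : R := 1 - m.+2%:R^-1.

Lemma rho_itv m : 0 < rho m < 1.
Proof.
rewrite /rho subr_gt0 invf_lt1 ?ltr1n//= ltrBlDr ltrDl invr_gt0 ltr0n//.
Qed.

Lemma rho_cvg : rho @ \oo --> (1 : R).
Proof.
rewrite -[X in _ --> X]subr0; apply: cvgB; first exact: cvg_cst.
have := @cvg_harmonic R; rewrite -(cvg_shiftS (@harmonic R)).
by apply.
Qed.

Lemma rho_left : rho @ \oo --> (1 : R)^'-.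
Proof.
move=> A; rewrite /= => -[e /= e0 He]; have /cvgrPdist_lt/(_ e e0) := rho_cvg.
apply: filterS => m hm; apply: He; first exact: hm.
by have /andP[] := rho_itv m.
Qed.

Lemma le_rho_limit n (S B : R) : (forall m, rho m ^+ n * S <= B) -> S <= B.
Proof.
move=> H; have c : (fun m => rho m ^+ n * S) @ \oo --> (1 ^+ n * S).
  apply: cvgMl; apply: (@continuous_cvg _ _ _ _ _ _ (fun x : R => x ^+ n) 1).
      exact: exprn_continuous.
    exact: rho_cvg.
rewrite -[S]mul1r -(expr1n _ n) -(cvg_lim _ c)//.
apply: limr_le; first by apply/cvg_ex; eexists; exact: c.
by apply: nearW.
Qed.

Lemma derivable_holo0 f : (forall z, 0 < nm z < 1 -> derivable f z 1) -> holo0 f.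
Proof. by move=> df z /df/derivable_cdiff H; exists ('D_1 f z). Qed.

Lemma derivable_pow z k : derivable (fun w : C R => w ^+ k) z 1.
Proof.
rewrite (_ : (fun w => _) = (@id (C R)) ^+ k); first exact: derivableX.
by apply/funext => w; rewrite fctE.
Qed.

Definition circle_trace F r t : C R := F (RtoC r * circ t).

Section Holomorphic.
Variables (F : C R -> C R) (M : R).
Hypothesis dF : forall z, disc z -> derivable F z 1.
Hypothesis FM : forall z, disc z -> nm (F z) <= M.

Let nm_rc r t : 0 <= r -> nm (RtoC r * circ t) = r.
Proof. by move=> r0; rewrite nmM nm_circ mulr1 nm_real ger0_norm. Qed.

Let disc_rc r t : 0 <= r -> r < 1 -> disc (RtoC r * circ t).
Proof. by move=> r0 r1; apply/discE; rewrite nm_rc. Qed.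

Lemma holo_cont z : disc z -> forall e : R, 0 < e -> exists2 d : R, 0 < d &
  forall w, nm (w - z) < d -> nm (F w - F z) < e.
Proof.
move=> /dF/derivable_cdiff/cdiff_lipschitz[d d0 H] e e0.
have k0 : 0 < 1 + nm ('D_1 F z) by rewrite ltr_pwDl// nm_ge0.
exists (Num.min d (e / (1 + nm ('D_1 F z)))); first by rewrite lt_min d0 divr_gt0.
move=> w; rewrite lt_min => /andP[w1 w2]; rewrite (le_lt_trans (H _ w1))//.
by rewrite mulrC -ltr_pdivlMr.
Qed.

Lemma good_trace r : 0 <= r < 1 -> good (circle_trace F r).
Proof.
move=> /andP[r0 r1].
have c t : forall e : R, 0 < e -> exists2 d : R, 0 < d & forall s, `|s - t| < d ->
    nm (circle_trace F r s - circle_trace F r t) < e.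
  move=> e e0; have [d d0 dP] := holo_cont (disc_rc t r0 r1) e0.
  have : (fun s => circ s : C R) @ t --> (circ t : C R).
    by apply/cvgC_ReIm; split; [exact: continuous_circ_Re|exact: continuous_circ_Im].
  move=> /cvgC_eps/(_ d d0)/nbhs_ballP[d' /= d'0 H]; exists d' => // s st.
  apply: dP; rewrite -mulrBr nmM nm_real ger0_norm//.
  rewrite (@le_lt_trans _ _ (nm (circ s - circ t)))//.
    by rewrite ler_piMl ?nm_ge0// ltW.
  by apply: H; rewrite /ball /= distrC.
apply: (@good_continuous _ _ M).
- move=> t; apply/cvgrPdist_lt => e /(c t)[d d0 dP]; apply/nbhs_ballP; exists d => //.
  move=> s; rewrite /ball /= distrC => /dP; rewrite nmB; apply: le_lt_trans.
  by rewrite (le_trans _ (nm_Re _))// cReD cReN.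
- move=> t; apply/cvgrPdist_lt => e /(c t)[d d0 dP]; apply/nbhs_ballP; exists d => //.
  move=> s; rewrite /ball /= distrC => /dP; rewrite nmB; apply: le_lt_trans.
  by rewrite (le_trans _ (nm_Im _))// cImD cImN.
- by move=> t; apply: FM; exact: disc_rc.
Qed.

(** The radius 1/2 is an arbitrary choice, as [fc_trace] shows. *)
Definition taylor (k : nat) : C R := fc (circle_trace F 2^-1) k * RtoC 2 ^+ k.

Let itv_half : 0 < (2^-1 : R) < 1. Proof. lra. Qed.

(** Divided by [r^k], the left side is the mean over the circle of radius [r] of [F w / w^k], which
    is holomorphic off the origin. *)
Lemma fc_trace r k : 0 < r < 1 -> fc (circle_trace F r) k = taylor k * RtoC r ^+ k.
Proof.
move=> r01; have h : holo0 (fun w => F w * (w ^+ k)^-1).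
  apply: derivable_holo0 => z /andP[z0 z1]; apply: derivableM.
    by apply: dF; apply/discE.
  apply: (derivableV _ (@derivable_pow z k)).
  by rewrite expf_neq0//; apply: contraTneq z0 => ->; rewrite nm0 ltxx.
have key s : 0 < s < 1 -> fc (circle_trace F s) k =
    RtoC s ^+ k * I (fun t => F (RtoC s * circ t) * ((RtoC s * circ t) ^+ k)^-1).
  move=> /andP[s0 s1]; have sk : RtoC s ^+ k != 0 :> C R.
    by rewrite expf_neq0//; apply: contra_neq (lt0r_neq0 s0) => -[].
  have E t : F (RtoC s * circ t) * ((RtoC s * circ t) ^+ k)^-1 =
      (RtoC s ^+ k)^-1 * (circle_trace F s t * Num.conj (circ t ^+ k)).
    have ck : circ t ^+ k != 0 :> C R.
      rewrite expf_neq0//; apply/eqP => c0; have := nm_circ t.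
      by rewrite c0 nm0 => /eqP; rewrite eq_sym oner_eq0.
    have -> : Num.conj (circ t ^+ k) = (circ t ^+ k)^-1.
      by apply: (mulfI ck); rewrite divff// rmorphXn /= -exprMn circ_conj_mul expr1n.
    by rewrite exprMn invfM mulrCA.
  under eq_I do rewrite E.
  rewrite IZ; first by rewrite mulVKf.
  by apply: (goodM _ (good_conj_circX R k)); apply: good_trace; rewrite ltW.
rewrite (key _ r01) (mean_const h r01 itv_half) /taylor (key _ itv_half).
have h2 : RtoC 2^-1 ^+ k * RtoC 2 ^+ k = 1 :> C R.
  by rewrite -exprMn -RtoCM mulVf ?expr1n// pnatr_eq0.
by rewrite [_ * _ * RtoC 2 ^+ k]mulrAC h2 mul1r mulrC.
Qed.

(** The circle mean of [F w * w^k] does not depend on the radius [s] and is at most [s * M] in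
    modulus, so it is 0. *)
Lemma trace_neg r k : 0 < r < 1 -> (0 < k)%N ->
  I (fun t => circle_trace F r t * circ t ^+ k) = 0.
Proof.
move=> r01 k0; have h : holo0 (fun w => F w * w ^+ k).
  apply: derivable_holo0 => z /andP[z0 z1]; apply: derivableM.
    by apply: dF; apply/discE.
  exact: derivable_pow.
pose c := I (fun t => F (RtoC r * circ t) * (RtoC r * circ t) ^+ k).
have key s : 0 < s < 1 -> RtoC s ^+ k * I (fun t => circle_trace F s t * circ t ^+ k) = c.
  move=> s01; have /andP[s0 s1] := s01; apply: etrans (mean_const h s01 r01).
  rewrite -IZ; first by apply: eq_I => t _; rewrite exprMn mulrCA.
  by apply: (goodM _ (good_circX R k)); apply: good_trace; rewrite ltW.
have cs s : 0 < s < 1 -> nm c <= s * M.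
  move=> s01; have /andP[s0 s1] := s01; rewrite -(key _ s01) nmM nmX nm_real gtr0_norm//.
  have hI : nm (I (fun t => circle_trace F s t * circ t ^+ k)) <= M.
    rewrite -[M]J_cst; apply: I_nm_le; [|exact: bmf_cst|move=> t _].
      by apply: (goodM _ (good_circX R k)); apply: good_trace; rewrite ltW.
    by rewrite nmM nmX nm_circ expr1n mulr1; apply: FM; apply: disc_rc => //; exact: ltW.
  apply: ler_pM; rewrite ?exprn_ge0 ?nm_ge0 ?(ltW s0)//.
  by rewrite -[leRHS]expr1 ler_wiXn2l// ltW.
clearbody c; have c0 : c = 0.
  apply: nm_eq0; apply/eqP; rewrite eq_le nm_ge0 andbT leNgt; apply/negP => c0.
  have M0 : 0 < M by have := lt_le_trans c0 (cs _ itv_half); rewrite pmulr_rgt0.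
  have := cs (Num.min 2^-1 (nm c / (2 * M))).
  rewrite lt_min invr_gt0 ltr0n /= divr_gt0 ?mulr_gt0//= gt_min.
  have -> : 2^-1 < 1 :> R by lra.
  move=> /(_ isT); rewrite leNgt => /negP; apply.
  apply: (@le_lt_trans _ _ (nm c / (2 * M) * M)).
    by rewrite ler_wpM2r ?(ltW M0)// ge_min lexx orbT.
  rewrite (_ : _ * M = nm c / 2); first by lra.
  by field; rewrite gt_eqF.
have := key r r01; rewrite c0 => /eqP; rewrite mulf_eq0 => /orP[/eqP r0|/eqP//].
have /andP[rp _] := r01; have : nm (RtoC r ^+ k) = 0 by rewrite r0 nm0.
by rewrite nmX nm_real gtr0_norm// => /eqP; rewrite expf_eq0 gt_eqF ?andbF.
Qed.

Lemma taylor_l2_N2 (B : R) : 0 <= B ->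
  (forall r, 0 < r < 1 -> N2 (circle_trace F r) <= B ^+ 2) -> nb taylor B.
Proof.
move=> B0 HB; split=> // N.
(* For [k < N] the damping [r^(2 k)] is at least [r^(2 N)], one factor for the whole sum, which
   tends to 1 with [r]. *)
apply: (@le_rho_limit (N * 2)) => m; have r01 := rho_itv m; have /andP[r0 r1] := r01.
have gt : good (circle_trace F (rho m)) by apply: good_trace; rewrite ltW.
apply: le_trans (HB _ r01).
apply: le_trans (bessel N gt); rewrite mulr_sumr; apply: ler_sum => k _.
rewrite (fc_trace _ r01); move: (taylor k) => c.
rewrite (nm_scale c k (ltW r0)) exprMn mulrC ler_wpM2l ?sqr_ge0//.
by rewrite -exprM ler_wiXn2l ?(ltW r0) ?(ltW r1)// leq_mul2r ltnW ?orbT// ltn_ord.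
Qed.

Lemma bound_ge0 : 0 <= M.
Proof.
by apply: le_trans (nm_ge0 _) (FM (z := 0) _); apply/discE; rewrite nm0; exact: ltr01.
Qed.

Lemma taylor_nb : nb taylor M.
Proof.
apply: (taylor_l2_N2 bound_ge0) => r /andP[r0 r1].
have gt : good (circle_trace F r) by apply: good_trace; rewrite ltW.
rewrite -[leRHS]J_cst; apply: J_le; [exact: bmf_nm2|exact: bmf_cst|move=> t _].
have h := FM (disc_rc t (ltW r0) r1).
by rewrite ler_pXn2r ?nnegrE ?nm_ge0// bound_ge0.
Qed.

Lemma nm_taylor k : nm (taylor k) <= M.
Proof. exact: nb_coef taylor_nb. Qed.

Lemma taylor0 : taylor 0 = F 0.
Proof.
apply/eqP; rewrite -subr_eq0; apply/eqP/nm_eq0/eqP.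
rewrite eq_le nm_ge0 andbT leNgt; apply/negP => n0.
have D0 : disc (0 : C R) by apply/discE; rewrite nm0.
have e20 : 0 < nm (taylor 0 - F 0) / 2 by rewrite divr_gt0.
have [d d0 dP] := holo_cont D0 e20.
pose r : R := Num.min 2^-1 (d / 2).
have r01 : 0 < r < 1.
  by rewrite lt_min gt_min invr_gt0 ltr0n divr_gt0//=; apply/orP; left; lra.
have /andP[r0 r1] := r01; have gt : good (circle_trace F r) by apply: good_trace; rewrite ltW.
have E : taylor 0 - F 0 = I (fun t => circle_trace F r t - F 0).
  rewrite IB ?I_cst//; last exact: good_cst.
  have := fc_trace 0 r01; rewrite expr0 mulr1 => <-; congr (_ - _).
  by apply: eq_I => t _; rewrite expr0 conjC1 mulr1.
have : nm (taylor 0 - F 0) <= nm (taylor 0 - F 0) / 2.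
  rewrite {1}E -[leRHS]J_cst; apply: I_nm_le; [|exact: bmf_cst|move=> t _].
    exact: goodB gt (good_cst _).
  apply/ltW/dP; rewrite subr0 nm_rc ?(ltW r0)//.
  by rewrite gt_min; apply/orP; right; lra.
by lra.
Qed.

(** The Fejer means of the trace on the circle through [z] tend to [F z], and they are the Cesaro
    means of the partial sums of the Taylor series. That series converges, so its sum is [F z]. *)
Lemma taylor_cvg z : disc z -> series (fun k => taylor k * z ^+ k) @ \oo --> F z.
Proof.
move=> /[dup] zD /discE z1.
have cz : exists L : C R, series (fun k => taylor k * z ^+ k) @ \oo --> L.
  apply: (@cvg_pseries _ M ((1 + nm z) / 2)).
  - by have := nm_ge0 z; lra.
  - move=> k; rewrite (le_trans _ (nm_taylor k))// ler_piMr ?nm_ge0//.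
    by rewrite exprn_ile1//; have := nm_ge0 z; lra.
  - by lra.
have [->|z0] := eqVneq z 0.
  apply/cvgC_eps => e e0; exists 1%N => // -[//|n] _.
  rewrite /series /= big_nat_recl// big1 => [|k _]; last by rewrite exprS mul0r mulr0.
  by rewrite expr0 mulr1 addr0 taylor0 subrr nm0.
have nz0 : 0 < nm z.
  by rewrite lt_neqAle nm_ge0 andbT eq_sym; apply: contra_neq z0 => /nm_eq0.
have r01 : 0 < nm z < 1 by rewrite nz0.
have gt : good (circle_trace F (nm z)) by apply: good_trace; rewrite nm_ge0.
have [t Et] := polar_form z.
have fm : fejer_mean (circle_trace F (nm z)) ^~ t @ \oo --> F z.
  rewrite [X in F X]Et; apply: (fejer_mean_cvg gt) => e e0.
  have [d d0 dP] := holo_cont (disc_rc t (nm_ge0 z) z1) e0.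
  exists d => // s _ st; apply/ltW/dP; rewrite -mulrBr nmM nm_real ger0_norm ?nm_ge0//.
  by apply: le_lt_trans st; rewrite ler_piMl ?nm_ge0// ltW.
case: cz => L cL; have E n : fejer_mean (circle_trace F (nm z)) n t =
    RtoC n.+1%:R^-1 * \sum_(j < n.+1) series (fun k => taylor k * z ^+ k) j.+1.
  rewrite /fejer_mean.
  rewrite (eq_I (g := fun s => RtoC n.+1%:R^-1 *
      (RtoC (nm (dirichlet n.+1 t s) ^+ 2) * circle_trace F (nm z) s))); last first.
    by move=> s _; rewrite mulrC [nm _ ^+ 2 / _]mulrC RtoCM; ring.
  rewrite IZ; last first.
    by apply: goodM gt; apply: good_real; exact: bmf_nm2 (good_dirichlet _ _).
  congr (_ * _); rewrite I_dirichlet//; apply: eq_bigr => j _.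
  rewrite /series /= big_mkord (bigID (fun k : 'I_n.+1 => (k <= j)%N)) /=.
  (* Terms with [k > j] are negative frequencies and vanish by [trace_neg]. *)
  rewrite [X in _ + X]big1 ?addr0 => [|k]; last first.
    rewrite -ltnNge => jk.
    rewrite (eq_I (g := fun s => circle_trace F (nm z) s * circ s ^+ (k - j)%N)); last first.
      by move=> s _; rewrite -mulrA [_ * circ s ^+ k]mulrC circ_cancel// ltnW.
    by rewrite trace_neg ?subn_gt0// mulr0.
  rewrite (eq_bigr (fun k : 'I_n.+1 => taylor (j - k) * z ^+ (j - k))); last first.
    move=> k kj.
    rewrite (eq_I (g := fun s => circle_trace F (nm z) s * Num.conj (circ s ^+ (j - k)%N))); last first.
      move=> s _; rewrite -mulrA; congr (_ * _).
      by rewrite -(circ_cancel s kj) rmorphM /= conjCK.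
    rewrite -/(fc _ _) (fc_trace _ r01) circ_cancel// [in RHS]Et exprMn; ring.
  rewrite -(big_ord_widen n.+1 (fun k => taylor (j - k) * z ^+ (j - k)) (ltn_ord j)).
  rewrite (reindex_inj rev_ord_inj) /=; apply: eq_bigr => i _.
  by rewrite subSS subKn// -ltnS.
have cL1 : (fun n => series (fun k => taylor k * z ^+ k) n.+1) @ \oo --> L.
  by have := cL; rewrite -(cvg_shiftS (series _)); apply.
have -> : F z = L; last exact: cL.
apply: (cvgC_unique fm).
have /cvgC_ReIm[/cesaro cR /cesaro cI] := cL1.
apply/cvgC_ReIm; split.
  apply: cvg_trans cR; apply: near_eq_cvg; apply: nearW => n.
  rewrite E /arithmetic_mean /= cReM /= mul0r subr0 cRe_sum.
  by rewrite /series /= big_mkord.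
apply: cvg_trans cI; apply: near_eq_cvg; apply: nearW => n.
rewrite E /arithmetic_mean /= cImM /= mul0r addr0 cIm_sum.
by rewrite /series /= big_mkord.
Qed.

End Holomorphic.
End PowerSeries.

(** * Boundary values and the adjoint multiplier *)

Section BoundaryPairing.
Variable R : realType.
Variable E : set R.
Implicit Types (F : C R -> C R) (v f : R -> C R).

Definition supp v := forall t, ~ E t -> v t = 0.

Lemma fc_nb v (b : R) : good v -> 0 <= b -> N2 v <= b ^+ 2 -> nb (fc v) b.
Proof. by move=> gv b0 vb; split=> // N; exact: le_trans (bessel N gv) vb. Qed.

Lemma fc_nb_sqrt v : good v -> nb (fc v) (Num.sqrt (N2 v)).
Proof. by move=> gv; apply: fc_nb; rewrite ?sqrtr_ge0// sqr_sqrtr// N2_ge0. Qed.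

Lemma conj_cvg (T : Type) (G : set_system T) {FG : Filter G} (u : T -> C R) (L : C R) :
  u @ G --> L -> (fun x => Num.conj (u x)) @ G --> Num.conj L.
Proof.
move=> /cvgC_nm H; apply/cvgC_nm; apply: cvg_trans H.
by apply: near_eq_cvg; apply: nearW => m /=; rewrite -rmorphB nm_conj.
Qed.

Lemma RtoC_cvg (T : Type) (G : set_system T) {FG : Filter G} (u : T -> R) (L : R) :
  u @ G --> L -> (fun x => RtoC (u x)) @ G --> (RtoC L : C R).
Proof. by move=> uL; apply/cvgC_ReIm; split => //=; exact: cvg_cst. Qed.

Lemma cvgC_pow (T : Type) (G : set_system T) {FG : Filter G} (u : T -> C R) (L : C R) n :
  u @ G --> L -> (fun x => u x ^+ n) @ G --> L ^+ n.
Proof.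
move=> uL; elim: n => [|n IH]; first exact: cvg_cst.
rewrite exprS (_ : (fun x => _) = (fun x => u x * u x ^+ n)); last first.
  by apply/funext => x; rewrite exprS.
exact: (cvgM uL IH).
Qed.

Section Pairing.
Variables (F : C R -> C R) (M : R).
Hypothesis dF : forall z, disc z -> derivable F z 1.
Hypothesis FM : forall z, disc z -> nm (F z) <= M.

(** On an inner circle the Taylor partial sums are bounded by [M / (1 - r)], so the pairing is
    computed term by term by dominated convergence. *)
Lemma ip2_trace v (r : R) : good v -> 0 < r < 1 ->
  ip2 v (circle_trace F r) = ip (fc v) (fun j => taylor F j * RtoC r ^+ j).
Proof.
move=> gv r01; have /andP[r0 r1] := r01.
pose c j := taylor F j * RtoC r ^+ j.
have gt : good (circle_trace F r) by apply: (good_trace dF FM); rewrite ltW.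
have nc : nb c M.
  split=> [|N]; first exact: bound_ge0 FM.
  apply: le_trans ((taylor_nb dF FM).2 N); apply: ler_sum => k _.
  rewrite /c; move: (taylor F k) => d; rewrite (nm_scale d k (ltW r0)) exprMn.
  rewrite ler_piMr ?sqr_ge0//.
  by rewrite -exprM exprn_ile1// ltW.
apply/esym/(ip_eq (fc_nb_sqrt gv) nc).
have S N t : nm (trig c N t) <= M / (1 - r).
  rewrite /trig (le_trans (nm_sum _ _ _))//.
  apply: le_trans (_ : \sum_(k < N) M * r ^+ k <= _).
    apply: ler_sum => k _; rewrite (nmM (c k)) (nmX (circ t)) nm_circ expr1n mulr1 (nm_scale (taylor F k) k (ltW r0)).
    by rewrite ler_wpM2r ?exprn_ge0 ?(ltW r0)// (nm_taylor dF FM).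
  rewrite -mulr_sumr ler_wpM2l ?(bound_ge0 FM)//.
  rewrite -[leRHS]mul1r ler_pdivlMr ?subr_gt0// mulrC.
  by rewrite -[X in X * _]opprB mulNr -subrX1 opprB gerBl exprn_ge0// ltW.
have [B vB] := good_nm gv.
have c1 : (fun N => I (fun t => v t * Num.conj (trig c N t))) @ \oo -->
    I (fun t => v t * Num.conj (circle_trace F r t)).
  apply: (@I_dct _ _ _ (B * (M / (1 - r)))).
  - by move=> N; apply: goodM gv (good_conj (good_trig _ _)).
  - exact: goodM gv (good_conj gt).
  - by move=> n t; rewrite nmM nm_conj; apply: ler_pM; rewrite ?nm_ge0.
  - move=> t _; apply: cvgMr; apply: conj_cvg.
    have tz : disc (RtoC r * circ t : C R).
      by apply/discE; rewrite nmM nm_circ mulr1 nm_real gtr0_norm.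
    have := taylor_cvg dF FM tz; apply: cvg_trans; apply: near_eq_cvg.
    apply: nearW => N; rewrite series_mkord; apply: eq_bigr => k _.
    by rewrite exprMn mulrA.
apply: cvg_trans c1; apply: near_eq_cvg; apply: nearW => N.
rewrite series_mkord -[LHS]/(ip2 v (trig c N)) ip2_trigr//.
by apply: eq_bigr => k _; rewrite /dot mulrC.
Qed.

(** The radius tends to 1 in [ip2_trace]: one side converges since the damped coefficients converge
    weakly, the other by dominated convergence. Off [E] the integrand is 0, whatever [F] does
    there. *)
Lemma ip_boundary v Fs : good Fs ->
  (forall t, E t -> (fun m => F (RtoC (rho R m) * circ t)) @ \oo --> Fs t) ->
  good v -> supp v -> ip (fc v) (taylor F) = ip2 v Fs.
Proof.
move=> gFs FFs gv sv; have nt := taylor_nb dF FM.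
have c1 : (fun m => ip (fc v) (fun j => taylor F j * RtoC (rho R m) ^+ j)) @ \oo -->
    ip (fc v) (taylor F).
  apply: (ip_weak_cvg (fc_nb_sqrt gv) (b := M)) => [m|j].
    have /andP[r0 r1] := rho_itv R m.
    split=> [|N]; first exact: bound_ge0 FM.
    apply: le_trans (nt.2 N); apply: ler_sum => k _.
    move: (taylor F k) => d; rewrite (nm_scale d k (ltW r0)) exprMn.
  rewrite ler_piMr ?sqr_ge0//.
    by rewrite -exprM exprn_ile1// ltW.
  rewrite -[X in _ --> X]mulr1; apply: cvgMr.
  under eq_fun do rewrite -RtoCX.
  apply: (@RtoC_cvg _ _ _ _ 1); rewrite -(expr1n _ j).
  apply: (@continuous_cvg _ _ _ _ _ _ (fun x : R => x ^+ j) 1).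
    exact: exprn_continuous.
  exact: rho_cvg.
have [B vB] := good_nm gv.
apply: (cvgC_unique c1).
apply: (@cvg_trans _ ((fun m => I (fun t => v t * Num.conj (circle_trace F (rho R m) t))) @ \oo)).
  apply: near_eq_cvg; apply: nearW => m.
  by rewrite -ip2_trace//; exact: rho_itv.
have gt m : good (circle_trace F (rho R m)).
  by have /andP[r0 r1] := rho_itv R m; apply: (good_trace dF FM); rewrite ltW.
apply: (@I_dct _ _ _ (B * M)).
- by move=> m; apply: goodM gv (good_conj (gt m)).
- exact: goodM gv (good_conj gFs).
- move=> m t; rewrite nmM nm_conj; apply: ler_pM; rewrite ?nm_ge0//.
  have /andP[r0 r1] := rho_itv R m; apply: FM; apply/discE.
  by rewrite nmM nm_circ mulr1 nm_real gtr0_norm.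
- move=> t _; have [Et|nE] := pselect (E t).
    by apply: cvgMr; apply: conj_cvg; exact: FFs.
  have z x : v t * x = 0 by rewrite (sv _ nE) mul0r.
  by rewrite (z (Num.conj _)); apply: cvg_near_cst; apply: nearW => m; exact: z.
Qed.

End Pairing.
End BoundaryPairing.

(** * The orbit of the adjoint on projections of functions supported on [E] *)

Section Multiplier.
Variable R : realType.
Variable E : set R.
Variables (g : C R -> C R) (M : R) (gs : R -> C R).
Implicit Types (v : R -> C R).
Hypothesis dg : forall z, disc z -> derivable g z 1.
Hypothesis gM : forall z, disc z -> nm (g z) <= M.
Hypothesis g1 : forall z, disc z -> 1 <= nm (g z).
Hypothesis gnc : exists z w, disc z /\ disc w /\ g z <> g w.
Hypothesis gs_good : good gs.
Hypothesis gs_lim : forall t, E t ->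
  (fun m => g (RtoC (rho R m) * circ t)) @ \oo --> gs t.
Hypothesis gs1 : forall t, E t -> nm (gs t) = 1.

Lemma derivable_expfun (f : C R -> C R) z n : derivable f z 1 ->
  derivable (fun w => f w ^+ n) z 1.
Proof.
move=> df; rewrite (_ : (fun w => _) = f ^+ n); first exact: derivableX.
by apply/funext => w; rewrite fctE.
Qed.

(** The image of the monomial [z^k] under the n-th power of the Toeplitz operator; pairing with it
    reads off the k-th coefficient of [iter n A f]. *)
Definition gmon n k (z : C R) : C R := g z ^+ n * z ^+ k.

Lemma gmon_derivable n k z : disc z -> derivable (gmon n k) z 1.
Proof.
move=> /dg dz; apply: derivableM; first exact: derivable_expfun.
exact: derivable_pow.
Qed.

Lemma gmon_bound n k z : disc z -> nm (gmon n k z) <= M ^+ n.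
Proof.
move=> zD; rewrite nmM !nmX; have /discE z1 := zD.
rewrite -[leRHS]mulr1; apply: ler_pM; rewrite ?exprn_ge0 ?nm_ge0//.
  by rewrite lerXn2r ?nnegrE ?nm_ge0 ?(bound_ge0 gM) ?gM.
by rewrite exprn_ile1 ?nm_ge0// ltW.
Qed.

Lemma gmon_nb n k : nb (taylor (gmon n k)) (M ^+ n).
Proof. by apply: taylor_nb; [exact: gmon_derivable|exact: gmon_bound]. Qed.

Lemma taylor_gmon0 k : taylor (gmon 0 k) = delta R k.
Proof.
apply/funext => j; rewrite /taylor /delta.
have -> : fc (circle_trace (gmon 0 k) 2^-1) j = RtoC 2^-1 ^+ k * (k == j)%:R.
  rewrite -ip2_circ -IZ; last exact: goodM (good_circX _ _) (good_conj_circX _ _).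
  apply: eq_I => t _.
  by rewrite /circle_trace /gmon expr0 mul1r exprMn mulrA.
rewrite eq_sym; case: eqP => [->|_]; last by rewrite mulr0 mul0r.
by rewrite mulr1 -exprMn -RtoCM mulVf ?expr1n// pnatr_eq0.
Qed.

Lemma Tg_gmon n k : Tg_rel g (taylor (gmon n k)) (taylor (gmon n.+1 k)).
Proof.
move=> z zD.
have -> : pseries_at (taylor (gmon n k)) z = gmon n k z.
  apply: cvg_lim; first exact: norm_hausdorff.
  exact: (taylor_cvg (@gmon_derivable n k) (@gmon_bound n k)).
have -> : g z * gmon n k z = gmon n.+1 k z by rewrite /gmon exprS mulrA.
exact: (taylor_cvg (@gmon_derivable n.+1 k) (@gmon_bound n.+1 k)).
Qed.

Variable A : (nat -> C R) -> (nat -> C R).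
Hypothesis hA : is_Tg_adjoint g A.

Lemma iter_H2 n f : H2 f -> H2 (iter n A f).
Proof. by move=> Hf; elim: n => [//|n IH]; exact: (hA.1 _ IH). Qed.

Lemma iter_adjoint n f k : H2 f -> iter n A f k = ip f (taylor (gmon n k)).
Proof.
(* Each application of [A] crosses the pairing as one factor [g], hence the general exponent [i] in
   the induction. *)
move=> Hf; suff H i : ip (iter n A f) (taylor (gmon i k)) = ip f (taylor (gmon (n + i) k)).
  by rewrite -[in RHS](addn0 n) -H taylor_gmon0 ip_delta.
elim: n i => [//|n IH] i; rewrite addSnnS -IH /=.
by apply: hA.2; [exact: iter_H2|exact: nb_H2 (gmon_nb _ _)..|exact: Tg_gmon].
Qed.

Lemma iter_fc n v : good v -> supp E v ->
  iter n A (fc v) = fc (fun t => Num.conj (gs t) ^+ n * v t).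
Proof.
move=> gv sv; apply/funext => k.
rewrite iter_adjoint; last exact: nb_H2 (fc_nb_sqrt gv).
have gF : good (fun t => gs t ^+ n * circ t ^+ k).
  exact: goodM (goodX _ gs_good) (good_circX _ _).
have lF t : E t -> (fun m => gmon n k (RtoC (rho R m) * circ t)) @ \oo -->
    gs t ^+ n * circ t ^+ k.
  move=> Et; apply: cvgM; apply: cvgC_pow; first exact: gs_lim.
  rewrite -[X in _ --> X]mul1r; apply: cvgMl.
  by apply: (@RtoC_cvg _ _ _ _ _ 1); exact: rho_cvg.
apply: etrans (ip_boundary (@gmon_derivable n k) (@gmon_bound n k) gF lF gv sv) _.
apply: eq_I => t _; rewrite rmorphM rmorphXn /=.
by rewrite mulrCA mulrA.
Qed.

End Multiplier.

(** * Decay of the powers of the boundary function *)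

Section Decay.
Variable R : realType.
Variable E : set R.
Variables (g : C R -> C R) (gs : R -> C R).
Implicit Types (v : R -> C R).
Hypothesis dg : forall z, disc z -> derivable g z 1.
Hypothesis g1 : forall z, disc z -> 1 <= nm (g z).
Hypothesis gnc : exists z w, disc z /\ disc w /\ g z <> g w.
Hypothesis gs_good : good gs.
Hypothesis gs_lim : forall t, E t ->
  (fun m => g (RtoC (rho R m) * circ t)) @ \oo --> gs t.
Hypothesis gs1 : forall t, E t -> nm (gs t) = 1.

Let g0 z : disc z -> g z != 0.
Proof.
by move=> /g1; apply: contraTneq => ->; rewrite nm0 leNgt negbK ltr01.
Qed.

Definition phi (z : C R) : C R := (g z)^-1.

Let dphi z : disc z -> derivable phi z 1.
Proof. by move=> zD; apply: derivableV; [exact: g0|exact: dg]. Qed.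

Let phi1 z : disc z -> nm (phi z) <= 1.
Proof.
move=> zD; have gz := g1 zD; rewrite nmV invf_le1//.
exact: lt_le_trans ltr01 gz.
Qed.

Let disc0 : disc (0 : C R). Proof. by apply/discE; rewrite nm0. Qed.

(** Maximum principle read on coefficients: their l2 norm is at most 1, so [|phi 0| = 1] forces all
    the others to vanish and [phi] to be constant. *)
Lemma phi0_lt1 : nm (phi 0) < 1.
Proof.
rewrite lt_neqAle phi1// andbT; apply/eqP => p1.
have tn := taylor_nb dphi phi1.
have tk k : taylor phi k.+1 = 0.
  apply: nm_eq0; apply/eqP; rewrite -sqrf_eq0 eq_le sqr_ge0 andbT.
  have := tn.2 k.+2; rewrite big_ord_recr /= expr1n.
  have : nm (taylor phi 0) ^+ 2 <= \sum_(i < k.+1) nm (taylor phi i) ^+ 2.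
    by rewrite (bigD1 ord0)//= lerDl sumr_ge0// => i _; exact: sqr_ge0.
  by rewrite (taylor0 dphi phi1) p1 expr1n; lra.
have cst z : disc z -> phi z = phi 0.
  move=> zD; apply: (cvgC_unique (taylor_cvg dphi phi1 zD)).
  apply/cvgC_eps => e e0; exists 1%N => // -[//|n] _.
  rewrite /series /= big_nat_recl// big1 => [|k _]; last by rewrite tk mul0r.
  by rewrite expr0 mulr1 addr0 (taylor0 dphi phi1) subrr nm0.
have [z [w [zD [wD]]]] := gnc; apply.
by apply: invr_inj; rewrite -/(phi z) -/(phi w) !cst.
Qed.

(** Continuity at 0. This circle is the only source of geometric decay in [n]. *)
Lemma phi_small_circle : exists r q : R, [/\ 0 < r < 1, 0 <= q < 1 &
  forall t, nm (phi (RtoC r * circ t)) <= q].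
Proof.
have e0 : 0 < (1 - nm (phi 0)) / 2 by have := phi0_lt1; lra.
have [d d0 dP] := holo_cont dphi disc0 e0.
exists (Num.min 2^-1 (d / 2)), ((1 + nm (phi 0)) / 2).
have r0 : 0 < Num.min 2^-1 (d / 2) by rewrite lt_min invr_gt0 ltr0n divr_gt0.
have r1 : Num.min 2^-1 (d / 2) < 1 by rewrite gt_min; apply/orP; left; lra.
have rd : Num.min 2^-1 (d / 2) < d by rewrite gt_min; apply/orP; right; lra.
split; first by rewrite r0.
  by have := phi0_lt1; have := nm_ge0 (phi 0); lra.
move=> t; have := dP (RtoC (Num.min 2^-1 (d / 2)) * circ t).
rewrite subr0 nmM nm_circ mulr1 nm_real gtr0_norm// => /(_ rd).
have := nmD (phi (RtoC (Num.min 2^-1 (d / 2)) * circ t) - phi 0) (phi 0).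
by rewrite subrK; lra.
Qed.

Section Product.
Variables (h : nat -> C R) (N n : nat).

(** On [E] its boundary values are [conj gs^n] times the polynomial, because [gs] is unimodular
    there; it thus carries [gs^n] from one side of a pairing to the other. *)
Definition phih (z : C R) : C R := phi z ^+ n * \sum_(k < N) h k * z ^+ k.

Lemma phih_derivable z : disc z -> derivable phih z 1.
Proof.
move=> zD; apply: derivableM; first by apply: derivable_expfun; exact: dphi.
rewrite (_ : (fun w => _) = \sum_(k < N) (fun w : C R => h k * w ^+ k)); last first.
  by apply/funext => w; rewrite fct_sumE.
apply: derivable_sum => k; apply: derivableM; first exact: derivable_cst.
exact: derivable_pow.
Qed.

Lemma phih_bound z : disc z -> nm (phih z) <= \sum_(k < N) nm (h k).
Proof.
move=> zD; have /discE z1 := zD.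
rewrite nmM nmX -[leRHS]mul1r; apply: ler_pM; rewrite ?exprn_ge0 ?nm_ge0//.
  by rewrite exprn_ile1 ?nm_ge0// phi1.
rewrite (le_trans (nm_sum _ _ _))//; apply: ler_sum => k _.
by rewrite nmM nmX ler_piMr ?nm_ge0// exprn_ile1 ?nm_ge0// ltW.
Qed.

Lemma phih_N2 (r q : R) (b : R) : 0 < r < 1 -> 0 <= q -> nb h b ->
  (forall t, nm (phi (RtoC r * circ t)) <= q) ->
  N2 (circle_trace phih r) <= (q ^+ n * b) ^+ 2.
Proof.
move=> /[dup] r01 /andP[r0 r1] q0 [b0 hb] pq.
have gt : good (circle_trace phih r).
  by apply: (good_trace phih_derivable phih_bound); rewrite ltW.
pose c k := h k * RtoC r ^+ k.
apply: le_trans (_ : (q ^+ n) ^+ 2 * N2 (trig c N) <= _).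
  rewrite /N2 -JZ; last exact: bmf_nm2 (good_trig _ _).
  apply: J_le; [exact: bmf_nm2|exact: bmfM (bmf_cst _) (bmf_nm2 (good_trig _ _))|].
  move=> t _; rewrite /circle_trace /phih nmM exprMn.
  rewrite (_ : \sum_(k < N) _ = trig c N t); last first.
    by apply: eq_bigr => k _; rewrite exprMn mulrA.
  rewrite ler_wpM2r ?sqr_ge0// lerXn2r ?nnegrE ?nm_ge0 ?exprn_ge0// nmX.
  by rewrite lerXn2r ?nnegrE ?nm_ge0.
rewrite exprMn ler_wpM2l ?sqr_ge0// N2_trig (le_trans _ (hb N))//.
apply: ler_sum => k _; rewrite (nm_scale _ _ (ltW r0)) exprMn.
by rewrite ler_piMr ?sqr_ge0// -exprM exprn_ile1// ltW.
Qed.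

Lemma phih_nb (b : R) : nb h b -> nb (taylor phih) b.
Proof.
move=> nh; apply: (taylor_l2_N2 phih_derivable phih_bound (nb_ge0 nh)) => r r01.
have := phih_N2 r01 ler01 nh; rewrite expr1n mul1r; apply => t.
have /andP[r0 r1] := r01; apply: phi1; apply/discE.
by rewrite nmM nm_circ mulr1 nm_real gtr0_norm.
Qed.

(** Cauchy's estimate on the small circle: the j-th coefficient decays geometrically in [n], with a
    bound free of [N]. *)
Lemma phih_coef (r q b : R) j : 0 < r < 1 -> 0 <= q -> nb h b ->
  (forall t, nm (phi (RtoC r * circ t)) <= q) ->
  nm (taylor phih j) <= q ^+ n * b / r ^+ j.
Proof.
move=> /[dup] r01 /andP[r0 r1] q0 nh pq.
have gt : good (circle_trace phih r).
  by apply: (good_trace phih_derivable phih_bound); rewrite ltW.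
rewrite ler_pdivlMr ?exprn_gt0//.
have -> : nm (taylor phih j) * r ^+ j = nm (fc (circle_trace phih r) j).
  rewrite (fc_trace phih_derivable phih_bound j r01); move: (taylor _ _) => c.
  by rewrite (nm_scale c j (ltW r0)).
apply: (@nb_coef _ (fc (circle_trace phih r))); apply: fc_nb => //.
  by rewrite mulr_ge0 ?exprn_ge0 ?(nb_ge0 nh).
exact: phih_N2.
Qed.

Lemma phih_lim t : E t ->
  (fun m => phih (RtoC (rho R m) * circ t)) @ \oo -->
  Num.conj (gs t) ^+ n * \sum_(k < N) h k * circ t ^+ k.
Proof.
move=> Et; have zc : (fun m => RtoC (rho R m) * circ t) @ \oo --> circ t.
  rewrite -[X in _ --> X]mul1r; apply: cvgMl.
  by apply: (@RtoC_cvg _ _ _ _ _ 1); exact: rho_cvg.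
have gsn : gs t != 0.
  by apply/eqP => z; have := gs1 Et; rewrite z nm0 => /eqP; rewrite eq_sym oner_eq0.
have gsV : Num.conj (gs t) = (gs t)^-1.
  by apply: (mulfI gsn); rewrite divff// sqr_norm_conj gs1// expr1n.
apply: cvgM.
  have phl : (fun m => phi (RtoC (rho R m) * circ t)) @ \oo --> (gs t)^-1.
    exact: (cvgV gsn (gs_lim Et)).
  by rewrite gsV; apply: cvgC_pow; exact: phl.
apply: cvg_big => [|k _]; first exact: add_continuous.
by apply: cvgMr; exact: cvgC_pow.
Qed.

End Product.

(** Let [h] consist of the first [N] coefficients of [P (gs^n v)]. Then [|h|^2] is the pairing of
    [P v] with [phi^n h]. The tail of [P v] costs at most [e / 2 * |h|], as [phi^n] is a
    contraction; the finitely many leading coefficients of [P v] meet coefficients of [phi^n h] that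
    decay geometrically. Hence [|h|^2 <= e * |h|]. *)
Lemma decay v : good v -> supp E v -> forall e : R, 0 < e ->
  exists n0, forall n, (n0 <= n)%N -> nb (fc (fun t => gs t ^+ n * v t)) e.
Proof.
move=> gv sv e e0; have nv := fc_nb_sqrt gv.
have [r [q [r01 /andP[q0 q1] pq]]] := phi_small_circle.
have [r0 r1] := andP r01.
have e20 : 0 < e / 2 by rewrite divr_gt0.
have [K nt] := nb_tail nv e20; set ft := fun k => _ in nt.
pose S := \sum_(j < K) nm (fc v j) / r ^+ j.
have S0 : 0 <= S.
  by apply: sumr_ge0 => j _; rewrite divr_ge0 ?nm_ge0 ?exprn_ge0// ltW.
(* The rank is fixed before [N], the number of coefficients tested below, and [S] depends only on
   [v], [r] and [K]. *)
have [n0 hn0] : exists n0, forall n, (n0 <= n)%N -> q ^+ n * S <= e / 2.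
  have c : (fun n => q ^+ n * S) @ \oo --> 0 * S.
    by apply: cvgMl; apply: cvg_expr; rewrite ger0_norm.
  rewrite mul0r in c; have /cvgrPdist_lt/(_ _ e20)[n0 _ H] := c.
  exists n0 => n /H /=; rewrite sub0r normrN => /ltW; apply: le_trans.
  exact: ler_norm.
exists n0 => n /hn0 hn; split=> [|N]; first exact: ltW.
pose w := fun t => gs t ^+ n * v t.
have gw : good w by exact: goodM (goodX _ gs_good) gv.
pose h := fun k => if (k < N)%N then fc w k else 0.
set b2 := \sum_(k < N) _; have b20 : 0 <= b2.
  by apply: sumr_ge0 => k _; exact: sqr_ge0.
have nh : nb h (Num.sqrt b2).
  split=> [|N']; first exact: sqrtr_ge0.
  rewrite sqr_sqrtr//.
  have hE : \sum_(k < N') nm (h k) ^+ 2 = \sum_(k < N' | (k < N)%N) nm (fc w k) ^+ 2.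
    rewrite [RHS]big_mkcond; apply: eq_bigr => k _; rewrite /h.
    by case: ifP => _; rewrite ?nm0 ?expr0n.
  rewrite hE; have [NN|NN] := leqP N' N.
    rewrite (eq_bigl xpredT) => [|k]; last by rewrite (leq_trans (ltn_ord k)).
    rewrite /b2 -(subnKC NN) big_split_ord /= lerDl.
    by apply: sumr_ge0 => k _; exact: sqr_ge0.
  by rewrite -(big_ord_widen N' (fun k => nm (fc w k) ^+ 2) (ltnW NN)).
have gF : good (fun t => Num.conj (gs t) ^+ n * trig h N t).
  exact: goodM (goodX _ (good_conj gs_good)) (good_trig _ _).
have key : RtoC b2 = ip (fc v) (taylor (phih h N n)).
  apply: esym; apply: etrans (ip_boundary (@phih_derivable h N n) (@phih_bound h N n)
    gF (@phih_lim h N n) gv sv) _.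
  have -> : ip2 v (fun t => Num.conj (gs t) ^+ n * trig h N t) = ip2 w (trig h N).
    apply: eq_I => t _; rewrite rmorphM rmorphXn /= conjCK /w.
    by rewrite mulrCA mulrA.
  rewrite ip2_trigr// RtoC_sum; apply: eq_bigr => k _.
  by rewrite /h ltn_ord mulrC sqr_norm_conj.
pose fh k : C R := if (k < K)%N then fc v k else 0.
have nT := phih_nb N n nh.
have nfh : nb fh (Num.sqrt (N2 v) + e / 2).
  apply: eq_nb (nbB nv nt) => k; rewrite /fh /ft.
  by case: ifP; rewrite ?subr0 ?subrr.
have fE : fc v = (fun k => fh k + ft k).
  by apply/funext => k; rewrite /fh /ft; case: ifP; rewrite ?addr0 ?add0r.
have b2le : b2 <= e * Num.sqrt b2.
  rewrite -[leLHS]ger0_norm// -nm_real key fE (ipDl nfh nt nT).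
  rewrite (le_trans (nmD _ _))// [e]splitr mulrDl lerD//; last exact: ip_le nt nT.
  apply: le_trans (_ : q ^+ n * S * Num.sqrt b2 <= _); last first.
    by rewrite ler_wpM2r// sqrtr_ge0.
  apply: (nm_cvg_le (ip_cvg nfh nT)); exists K => // M /= KM.
  rewrite series_mkord -(subnKC KM) big_split_ord /= [X in nm (_ + X)]big1 ?addr0; last first.
    by move=> k _; rewrite /dot /fh ltnNge leq_addr mul0r.
  rewrite (le_trans (nm_sum _ _ _))// /S mulr_sumr mulr_suml; apply: ler_sum => j _.
  rewrite /dot /fh ltn_ord (nmM (fc v j)) nm_conj.
  apply: le_trans (ler_wpM2l (nm_ge0 _) (@phih_coef h N n r q _ j r01 q0 nh pq)) _.
  by rewrite le_eqVlt; apply/orP; left; apply/eqP; ring.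
have : Num.sqrt b2 <= e.
  have [->|s0] := eqVneq (Num.sqrt b2) 0; first exact: ltW.
  have sp : 0 < Num.sqrt b2 by rewrite lt_neqAle eq_sym s0 sqrtr_ge0.
  by rewrite -(ler_pM2r sp) -expr2 sqr_sqrtr.
move=> h2; rewrite -[leLHS]sqr_sqrtr//.
by rewrite lerXn2r ?nnegrE ?sqrtr_ge0// ltW.
Qed.

(* The zeroth Fourier coefficient of the decaying sequence is the integral. *)
Lemma riemann_lebesgue v : good v -> supp E v -> forall e : R, 0 < e ->
  exists n0, forall n, (n0 <= n)%N -> nm (I (fun t => gs t ^+ n * v t)) <= e.
Proof.
move=> gv sv e e0; have [n0 H] := decay gv sv e0; exists n0 => n /H nbn.
have := nb_coef 0 nbn; rewrite /fc; congr (nm _ <= e).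
by apply: eq_I => t _; rewrite expr0 conjC1 mulr1.
Qed.

Lemma riemann_lebesgue_conj v : good v -> supp E v -> forall e : R, 0 < e ->
  exists n0, forall n, (n0 <= n)%N -> nm (I (fun t => Num.conj (gs t) ^+ n * v t)) <= e.
Proof.
move=> gv sv e e0; have sv' : supp E (fun t => Num.conj (v t)).
  by move=> t /sv ->; rewrite conjC0.
have [n0 H] := riemann_lebesgue (good_conj gv) sv' e0; exists n0 => n /H.
rewrite -nm_conj -I_conj; last exact: goodM (goodX _ gs_good) (good_conj gv).
by congr (nm _ <= e); apply: eq_I => t _; rewrite rmorphM rmorphXn /= conjCK.
Qed.

End Decay.

(** * Density of the projections of functions supported on E *)

Section SymmetricSum.
Variable R : realType.

Lemma sum_symmetric (b : nat -> nat -> R) n : (forall j k, b j k = b k j) ->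
  \sum_(j < n) \sum_(k < n) b j k = \sum_(j < n) (b j j + 2 * \sum_(k < j) b j k).
Proof.
move=> bs; elim: n => [|n IH]; first by rewrite !big_ord0.
rewrite big_ord_recr /= [RHS]big_ord_recr /= -IH.
under eq_bigr do rewrite big_ord_recr /=.
rewrite big_split /= -addrA; congr (_ + _).
rewrite big_ord_recr /= addrA (eq_bigr (fun k : 'I_n => b n k)) => [|k _]; last exact: bs.
by rewrite addrC; congr (_ + _); rewrite mulr_natl mulr2n.
Qed.

Lemma RtoC_nat n : RtoC n%:R = n%:R :> C R.
Proof. by elim: n => [//|n IH]; rewrite -!natr1 RtoCD IH. Qed.

End SymmetricSum.

Section Density.
Variable R : realType.
Variable E : set R.
Notation mu := (@lebesgue_measure R).
Hypothesis cE : compact E.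
Hypothesis E01 : forall t, E t -> 0 <= t < 1.
Hypothesis muE : (0 < mu E)%E.

Let mE : measurable E. Proof. exact: compact_measurable. Qed.

Definition chi (t : R) : C R := RtoC (\1_E t).

Let bE : bmf (\1_E : R -> R). Proof. exact: bmf_indic. Qed.

Lemma good_chi : good chi. Proof. exact: good_real bE. Qed.

Let indic01 t : 0 <= (\1_E t : R) <= 1.
Proof. by rewrite indicE; case: (t \in E); rewrite ?lexx ?ler01. Qed.

Lemma J_indic_gt0 : 0 < J (\1_E : R -> R).
Proof.
rewrite /J /Rintegral.
have -> : (\int[mu]_(x in `[0%R, 1%R]) (\1_E x)%:E)%E = mu E.
  rewrite integral_indic//; congr (mu _); apply/seteqP; split=> [t []//|t Et].
  split=> //=; have /andP[t0 t1] := E01 Et.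
  by rewrite in_itv /= t0 ltW.
rewrite fine_gt0// muE /= (@le_lt_trans _ _ (mu `[0%R, 1%R]%classic))//.
  apply: le_measure; rewrite ?inE//= => t Et /=; have /andP[t0 t1] := E01 Et.
  by rewrite in_itv /= t0 ltW.
by rewrite mu01 ltry.
Qed.

Lemma circ_inj s t : 0 <= s < 1 -> 0 <= t < 1 -> circ s = circ t :> C R -> s = t.
Proof.
wlog st : s t / s <= t => [H hs ht e|/andP[s0 s1] /andP[t0 t1] e].
  by have [/H->//|/ltW ts] := leP s t; apply/esym/H.
apply/eqP; rewrite eq_le st /= leNgt; apply/negP => lst.
have e1 : circ (t - s) = 1 :> C R.
  by rewrite circD -conj_circ -e circ_conj_mul.
have := congr1 (@complex.Re R) e1; rewrite /circ /=.
set x := pi * (t - s).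
have -> : 2 * pi * (t - s) = x *+ 2 by rewrite /x mulr2n; ring.
rewrite cos_mulr2n => h.
have : sin x ^+ 2 = 0 by rewrite sin2cos2; move: h; rewrite -mulr_natl; lra.
move=> /eqP; rewrite sqrf_eq0 => /eqP sx.
have : 0 < sin x.
  apply: sin_gt0_pi; rewrite /x mulr_gt0 ?pi_gt0 ?subr_gt0//=.
  by rewrite gtr_pMr ?pi_gt0//; lra.
by rewrite sx ltxx.
Qed.

(** [circ] is injective on [[0, 1)], so this continuous function of [s] has no zero on the compact
    set [E]. *)
Lemma circ_dist t : 0 <= t < 1 -> ~ E t -> exists2 d : R, 0 < d &
  forall s, E s -> d <= nm (circ s - circ t) ^+ 2.
Proof.
move=> t01 nEt; pose f s : R := nm (circ s - circ t) ^+ 2.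
have cf : continuous f.
  move=> s; rewrite /f; under eq_fun do rewrite nm_sqr cReD cImD.
  apply: cvgD.
    by apply: (@cvgM _ _ _ _ (fun s => _) (fun s => _)); apply: cvgD; try exact: cvg_cst; exact: continuous_circ_Re.
  by apply: (@cvgM _ _ _ _ (fun s => _) (fun s => _)); apply: cvgD; try exact: cvg_cst; exact: continuous_circ_Im.
have cfE : compact (f @` E).
  by apply: continuous_compact => //; exact: continuous_subspaceT.
have : closed (f @` E) by apply: compact_closed => //; exact: Rhausdorff.
rewrite -openC openE => /(_ 0)[|d /= d0 H].
  move=> [s Es fs]; apply: nEt.
  have : circ s - circ t = 0 by apply: nm_eq0; apply/eqP; rewrite -sqrf_eq0 -/(f s) fs.
  by move=> /eqP; rewrite subr_eq0 => /eqP /(circ_inj (E01 Es) t01) <-.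
exists d => // s Es; rewrite leNgt; apply/negP => fd.
apply: (H (f s)); last by exists s.
by rewrite /ball /= sub0r normrN ger0_norm ?sqr_ge0.
Qed.

(** The Fejer mean of the indicator of [E]. *)
Definition fejE n t : R :=
  n.+1%:R^-1 * J (fun s => nm (dirichlet n.+1 t s) ^+ 2 * \1_E s).

Let bD n t : bmf (fun s => nm (dirichlet n t s) ^+ 2 * \1_E s).
Proof. by apply: bmfM bE; exact: bmf_nm2 (good_dirichlet _ _). Qed.

Lemma fejE_itv n t : 0 <= fejE n t <= 1.
Proof.
rewrite /fejE mulr_ge0 ?invr_ge0//=; last first.
  by apply: J_ge0 => s; rewrite mulr_ge0 ?sqr_ge0//; case/andP: (indic01 s).
rewrite ler_pdivrMl ?ltr0n// mulr1 -(J_dirichlet n.+1 t).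
apply: J_le => // [|s _]; first exact: bmf_nm2 (good_dirichlet _ _).
by rewrite ler_piMr ?sqr_ge0//; case/andP: (indic01 s).
Qed.

Lemma fejE_cvg0 t : 0 <= t < 1 -> ~ E t -> fejE ^~ t @ \oo --> (0 : R).
Proof.
move=> t01 nEt; have [d d0 dP] := circ_dist t01 nEt.
have bound n : fejE n t <= 4 / d * n.+1%:R^-1.
  rewrite /fejE mulrC ler_pM2r ?invr_gt0 ?ltr0n// -[leRHS]J_cst.
  apply: J_le => // [|s _]; first exact: bmf_cst.
  have [Es|nEs] := pselect (E s); last first.
    by rewrite indicE memNset// mulr0 divr_ge0// ltW.
  rewrite indicE mem_set// mulr1 ler_pdivlMr//.
  apply: le_trans (dirichlet_bound n.+1 t s).
  by rewrite ler_wpM2l ?sqr_ge0// dP.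
apply: (@squeeze_cvgr _ _ _ _ (fun=> 0) (fun n => 4 / d * n.+1%:R^-1)).
- by apply: nearW => n; rewrite bound andbT; case/andP: (fejE_itv n t).
- exact: cvg_cst.
- rewrite -[X in _ --> X](mulr0 (4 / d)); apply: cvgMr; exact: cvg_harmonic.
Qed.

(** The analytic completion of [fejE n]: the constant term plus twice the positive frequencies. *)
Definition fejpoly n : {poly C R} :=
  (RtoC n.+1%:R^-1) *: \sum_(j < n.+1)
    ((fc chi 0)%:P + 2 *: \sum_(k < j) fc chi (j - k) *: 'X^(j - k)).

Lemma fc_chi0 : fc chi 0 = RtoC (J (\1_E : R -> R)).
Proof.
by rewrite -I_real; apply: eq_I => t _; rewrite expr0 conjC1 mulr1.
Qed.

Lemma fejpoly0 n : (fejpoly n).[0] = RtoC (J (\1_E : R -> R)).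
Proof.
rewrite hornerZ horner_sum (eq_bigr (fun=> fc chi 0)).
  rewrite sumr_const card_ord fc_chi0 -[RtoC _ *+ _]mulr_natl -RtoC_nat mulrA.
  by rewrite -RtoCM mulVf ?pnatr_eq0// mul1r.
move=> j _; rewrite hornerD hornerC hornerZ horner_sum big1 ?mulr0 ?addr0// => k _.
by rewrite hornerZ hornerXn expr0n subn_eq0 leqNgt ltn_ord mulr0.
Qed.

Lemma Re_fejpoly n t : complex.Re (fejpoly n).[circ t] = fejE n t.
Proof.
pose a j k : C R := circ t ^+ j * Num.conj (circ t ^+ k) *
     I (fun s => chi s * Num.conj (circ s ^+ j) * circ s ^+ k).
have gg j k : good (fun s => chi s * Num.conj (circ s ^+ j) * circ s ^+ k).
  by apply: goodM (goodM good_chi (good_conj_circX _ _)) (good_circX _ _).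
have aC j k : a k j = Num.conj (a j k).
  rewrite /a !rmorphM /= conjCK mulrC [RHS]mulrC; congr (_ * _); last by rewrite mulrC.
  rewrite -I_conj//; apply: eq_I => s _; rewrite !rmorphM /= conjCK.
  have -> : Num.conj (chi s) = chi s by rewrite cconjE /= oppr0.
  by rewrite -!mulrA; congr (_ * _); rewrite mulrC.
have a_lt j k : (k <= j)%N -> a j k = circ t ^+ (j - k) * fc chi (j - k).
  move=> kj; rewrite /a circ_cancel//; congr (_ * _); apply: eq_I => s _.
  rewrite -mulrA; congr (_ * _).
  by rewrite -(circ_cancel s kj) rmorphM /= conjCK.
have H : RtoC (J (fun s => nm (dirichlet n.+1 t s) ^+ 2 * \1_E s)) =
    \sum_(j < n.+1) \sum_(k < n.+1) a j k.
  rewrite -I_dirichlet; last exact: good_chi.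
  by rewrite -I_real; apply: eq_I => s _; rewrite RtoCM.
rewrite /fejE hornerZ cReM /= mul0r subr0; congr (_ * _).
rewrite -[RHS]/(complex.Re (RtoC (J (fun s => nm (dirichlet n.+1 t s) ^+ 2 * \1_E s)))) H.
rewrite cRe_sum; under [RHS]eq_bigr do rewrite cRe_sum.
(* [a j k] and [a k j] are conjugate, so the double sum folds into the diagonal plus twice the lower
   triangle, whence the 2 in [fejpoly]. *)
rewrite (@sum_symmetric _ (fun j k => complex.Re (a j k))); last first.
  by move=> j k; rewrite aC cconjE.
rewrite horner_sum cRe_sum; apply: eq_bigr => j _.
rewrite hornerD hornerC hornerZ cReD a_lt// subnn expr0 mul1r; congr (_ + _).
rewrite -RtoC_nat cReM /= mul0r subr0; congr (_ * _).
rewrite horner_sum cRe_sum; apply: eq_bigr => k _.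
by rewrite a_lt ?(ltnW (ltn_ord k))// hornerZ hornerXn mulrC.
Qed.

End Density.

(** * Approximation of the constant 1, then of all of [H2], by projections *)

Section DenseRange.
Variable R : realType.
Variable E : set R.
Notation mu := (@lebesgue_measure R).
Hypothesis cE : compact E.
Hypothesis E01 : forall t, E t -> 0 <= t < 1.
Hypothesis muE : (0 < mu E)%E.

Let mE : measurable E. Proof. exact: compact_measurable. Qed.
Let bE : bmf (\1_E : R -> R). Proof. exact: bmf_indic. Qed.
Let indic01 t : 0 <= (\1_E t : R) <= 1.
Proof. by rewrite indicE; case: (t \in E); rewrite ?lexx ?ler01. Qed.

Lemma horner_trig (p : {poly C R}) t : p.[circ t] = trig (fun k => p`_k) (size p) t.
Proof. by rewrite horner_coef. Qed.

Lemma good_horner (p : {poly C R}) : good (fun t => p.[circ t]).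
Proof. by under eq_fun do rewrite horner_trig; exact: good_trig. Qed.

(** The conjugate of a polynomial has no positive frequencies, so only its constant term survives
    projection. *)
Lemma fc_conj_horner (p : {poly C R}) k :
  fc (fun t => Num.conj p.[circ t]) k = (k == 0%N)%:R * Num.conj p.[0].
Proof.
have gp := good_horner p.
have -> : fc (fun t => Num.conj p.[circ t]) k = Num.conj (I (fun t => p.[circ t] * circ t ^+ k)).
  rewrite -I_conj; last exact: goodM gp (good_circX _ _).
  by apply: eq_I => t _; rewrite rmorphM.
rewrite (eq_I (g := fun t => \sum_(j < size p) p`_j * circ t ^+ (j + k))); last first.
  by move=> t _; rewrite horner_coef mulr_suml; apply: eq_bigr => j _; rewrite exprD mulrA.
rewrite I_sum => [|j]; last exact: goodM (good_cst _) (good_circX _ _).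
rewrite (eq_bigr (fun j : 'I_(size p) => p`_j * ((j + k)%N == 0%N)%:R)); last first.
  by move=> j _; rewrite IZ ?I_circX//; exact: good_circX.
case: k => [|k]; last first.
  by rewrite big1 ?conjC0 ?mul0r// => j _; rewrite addnS mulr0.
rewrite eqxx mul1r; congr Num.conj; rewrite horner_coef0.
have [s0|s0] := posnP (size p).
  rewrite s0 big_ord0; move/eqP: s0; rewrite size_poly_eq0 => /eqP ->.
  by rewrite coef0.
rewrite (bigD1 (Ordinal s0))//= ?addn0 ?eqxx mulr1 big1 ?addr0// => j.
by rewrite -val_eqE /= addn0 => /negbTE ->; rewrite mulr0.
Qed.

Let c0 : R := J (\1_E : R -> R).

(** Since [|1 + w|^2 <= exp (2 Re w + |w|^2)]. It lets a power stand for an exponential, so that [p]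
    below remains a polynomial. *)
Lemma nm_1D_expn (w : C R) m : nm (1 + w) ^+ m.*2 <=
  expR (m%:R * (2 * complex.Re w + nm w ^+ 2)).
Proof.
rewrite -mul2n exprM expRM_natl lerXn2r ?nnegrE ?sqr_ge0 ?expR_ge0//.
apply: le_trans (expR_ge1Dx _).
by rewrite nm_sqrD nm1 expr1n mul1r cconjE /=; lra.
Qed.

(** Off [E] the Fejer means tend to 0, so the integral tends to the measure of the complement of
    [E], at most 1. *)
Lemma expR_fejE_small (L : R) : 0 <= L -> exists n,
  J (fun t => (1 - \1_E t) * expR (2 * L * fejE E n t)) <= 2.
Proof.
move=> L0.
pose h n t : R := (1 - \1_E t) * expR (2 * L * fejE E n t).
have bf n : bmf (fejE E n).
  rewrite (_ : fejE E n = fun t => complex.Re (fejpoly E n).[circ t]).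
    exact: (good_horner _).1.
  by apply/funext => t; rewrite (Re_fejpoly cE).
have b1 : bmf (fun t => 1 - \1_E t : R) by exact: bmfB (bmf_cst _) bE.
have i1 t : 0 <= (1 - \1_E t : R) <= 1 by have := indic01 t; lra.
have fb n t : expR (2 * L * fejE E n t) <= expR (2 * L).
  have := fejE_itv cE n t => /andP[f0 f1].
  by rewrite ler_expR ler_piMr// mulr_ge0.
have bh n : bmf (h n).
  apply: bmfM => //; split.
    apply: measurableT_comp; first exact: measurable_expR.
    exact: (bmfM (bmf_cst _) (bf n)).1.
  by exists (expR (2 * L)) => t; rewrite ger0_norm ?expR_ge0.
have c : (fun n => J (h n)) @ \oo --> J (fun t => 1 - \1_E t).
  apply: (@J_dct _ h _ (expR (2 * L))) => // [n t|t t01].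
    have /andP[p0 p1] := i1 t.
    rewrite normrM !ger0_norm ?expR_ge0//.
    by rewrite -[leRHS]mul1r ler_pM ?expR_ge0.
  rewrite /h; have [Et|nEt] := pselect (E t).
    have z x : (1 - \1_E t : R) * x = 0 by rewrite indicE mem_set// subrr mul0r.
    rewrite (_ : 1 - \1_E t = 0); last by rewrite indicE mem_set// subrr.
    by under eq_fun do rewrite mul0r; exact: cvg_cst.
  rewrite -[X in _ --> X]mulr1; apply: cvgMr; rewrite -[X in _ --> X]expR0.
  apply: continuous_cvg; first exact: continuous_expR.
  rewrite -[X in _ --> X](mulr0 (2 * L)); apply: cvgMr; exact: (fejE_cvg0 cE E01).
have J1 : J (fun t => 1 - \1_E t) <= 1 :> R.
  rewrite -[leRHS]J_cst; apply: J_le; [exact: b1|exact: bmf_cst|].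
  by move=> t _; case/andP: (i1 t).
have /cvgrPdist_lt/(_ _ ltr01)[n _ H] := c.
exists n; have := H n (leqnn n); rewrite /= ltr_norml => /andP[h1 h2].
by move: h1 h2 J1; rewrite /h; lra.
Qed.

(** If [p(0) = 1], then [conj p] projects to 1, so its restriction to [E] projects to 1 up to the
    norm of its part off [E]. The polynomial [p] is a power imitating [exp (L (G - c0))], where
    [Re G] is a Fejer mean of the indicator of [E] and [G(0) = c0 > 0]: off [E], [|p|^2] is about
    [exp (- 2 L c0)] in the mean. *)
Lemma fc_delta0_approx (e : R) : 0 < e -> exists u, [/\ good u, supp E u &
  nb (fun k => fc u k - delta R 0 k) e].
Proof.
move=> e0; have c0_gt0 : 0 < c0 := J_indic_gt0 cE E01 muE.
have [L [L0 hL]] : exists L : R, 0 <= L /\ expR (- (2 * L * c0)) * 4 <= e ^+ 2.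
  (* Then [exp (2 L c0) >= 1 + 4 / e^2]. The 4 collects a factor 2 from [expR_fejE_small] and a
     factor 2 from the error [exp ((L K)^2 / m)] of the power. *)
  pose L := (4 / e ^+ 2) / (2 * c0); exists L.
  have p : 0 < 4 / e ^+ 2 by rewrite divr_gt0// exprn_gt0.
  split; first by rewrite divr_ge0 ?(ltW p)// mulr_ge0// ltW.
  have -> : 2 * L * c0 = 4 / e ^+ 2 by rewrite /L; field; rewrite !gt_eqF.
  rewrite expRN mulrC ler_pdivrMr ?expR_gt0// mulrC -ler_pdivrMr ?exprn_gt0//.
  by apply: le_trans (expR_ge1Dx _); rewrite lerDr.
have [n hn] := expR_fejE_small L0.
pose G t := (fejpoly E n).[circ t]; pose w t := G t - RtoC c0.
have gG : good G := good_horner _.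
have [K hK] := good_nm (goodB gG (good_cst (RtoC c0))).
have K0 : 0 <= K := le_trans (nm_ge0 _) (hK 0).
have [m [m0 hm]] : exists m, (0 < m)%N /\ expR ((L * K) ^+ 2 / m%:R) <= 2.
  have c : (fun m : nat => expR ((L * K) ^+ 2 * m.+1%:R^-1)) @ \oo --> (1 : R).
    rewrite -[X in _ --> X]expR0; apply: continuous_cvg; first exact: continuous_expR.
    rewrite -[X in _ --> X](mulr0 ((L * K) ^+ 2)); apply: cvgMr; exact: cvg_harmonic.
  have /cvgrPdist_lt/(_ _ ltr01)[m _ H] := c; exists m.+1; split => //.
  by have := H m (leqnn m); rewrite /= ltr_norml => /andP[]; lra.
pose p : {poly C R} := (1 + RtoC (L / m%:R) *: (fejpoly E n - (RtoC c0)%:P)) ^+ m.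
have p0 : p.[0] = 1.
  rewrite horner_exp hornerD hornerZ hornerD hornerN !hornerC fejpoly0.
  by rewrite -/c0 subrr mulr0 addr0 expr1n.
have gp := good_conj (good_horner p).
pose u t := chi E t * Num.conj p.[circ t].
have gu : good u := goodM (good_chi cE) gp.
pose z t := RtoC (1 - \1_E t) * Num.conj p.[circ t].
have b1 : bmf (fun t => 1 - \1_E t : R) by exact: bmfB (bmf_cst _) bE.
have gz : good z := goodM (good_real b1) gp.
exists u; split => //.
  by move=> t nEt; rewrite /u /chi indicE memNset// mul0r.
have uz k : - fc z k = fc u k - delta R 0 k.
  have : fc u k + fc z k = delta R 0 k.
    rewrite -fcD// -[RHS](_ : fc (fun t => Num.conj p.[circ t]) k = _); last first.
      by rewrite fc_conj_horner p0 conjC1 mulr1.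
    by apply: eq_fc => t _; rewrite /u /z -mulrDl -RtoCD subrKC mul1r.
  by move=> <-; rewrite opprD addrA subrr sub0r.
apply: (eq_nb uz); apply: nbN; apply: fc_nb => //; first exact: ltW.
pose b : R := expR (- (2 * L * c0)) * 2.
have i1 t : 0 <= (1 - \1_E t : R) <= 1 by have := indic01 t; lra.
have bf : bmf (fejE E n).
  rewrite (_ : fejE E n = fun t => complex.Re (fejpoly E n).[circ t]).
    exact: (good_horner _).1.
  by apply/funext => t; rewrite (Re_fejpoly cE).
have bh : bmf (fun t => (1 - \1_E t) * expR (2 * L * fejE E n t)).
  apply: bmfM => //; split.
    apply: measurableT_comp; first exact: measurable_expR.
    exact: (bmfM (bmf_cst _) bf).1.
  exists (expR (2 * L)) => t; rewrite ger0_norm ?expR_ge0//.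
  have /andP[f0 f1] := fejE_itv cE n t.
  by rewrite ler_expR ler_piMr// mulr_ge0.
apply: le_trans (_ : J (fun t => b * ((1 - \1_E t) * expR (2 * L * fejE E n t))) <= _).
  apply: J_le; [exact: bmf_nm2|exact: bmfM (bmf_cst _) bh|move=> t _].
  have /andP[j0 j1] := i1 t.
  rewrite /z nmM nm_real nm_conj (ger0_norm j0) exprMn [leRHS]mulrCA.
  apply: ler_pM; [exact: sqr_ge0|exact: sqr_ge0|by rewrite expr2 ler_piMr|].
  have -> : p.[circ t] = (1 + RtoC (L / m%:R) * w t) ^+ m.
    by rewrite horner_exp hornerD hornerZ hornerD hornerN !hornerC.
  rewrite nmX -exprM muln2; apply: (le_trans (nm_1D_expn _ _)).
  rewrite /b mulrAC -expRD.
  have mn0 : m%:R != 0 :> R by rewrite pnatr_eq0 -lt0n.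
  have Lm0 : 0 <= L / m%:R by rewrite divr_ge0.
  rewrite cReM /= mul0r subr0 (nmM (RtoC _)) nm_real (ger0_norm Lm0).
  have -> : complex.Re (w t) = fejE E n t - c0.
    by rewrite /w cReD cReN /= /G (Re_fejpoly cE).
  apply: le_trans (_ : expR (- (2 * L * c0) + 2 * L * fejE E n t) *
     expR ((L * K) ^+ 2 / m%:R) <= _); last by rewrite ler_wpM2l ?expR_ge0.
  rewrite -expRD ler_expR.
  have wK : nm (w t) ^+ 2 <= K ^+ 2 by rewrite lerXn2r ?nnegrE ?nm_ge0 ?hK.
  have -> : m%:R * (2 * (L / m%:R * (fejE E n t - c0)) + (L / m%:R * nm (w t)) ^+ 2) =
      - (2 * L * c0) + 2 * L * fejE E n t + L ^+ 2 / m%:R * nm (w t) ^+ 2 by field.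
  rewrite lerD2l exprMn [leRHS]mulrAC ler_wpM2l//.
  by rewrite divr_ge0// sqr_ge0.
rewrite JZ//; apply: le_trans hL; rewrite /b -mulrA ler_wpM2l ?expR_ge0//.
by rewrite (_ : 4 = 2 * 2) ?ler_wpM2l//; ring.
Qed.

(** The norm closure of the projections of functions supported on [E]. *)
Definition inV (y : nat -> C R) := forall e : R, 0 < e -> exists u,
  [/\ good u, supp E u & nb (fun k => fc u k - y k) e].

Lemma inV_fc u : good u -> supp E u -> inV (fc u).
Proof.
move=> gu su e e0; exists u; split => //.
by apply: nb_le (ltW e0); apply: eq_nb (nb0 R) => k; rewrite subrr.
Qed.

Lemma inVD y z : inV y -> inV z -> inV (fun k => y k + z k).
Proof.
move=> hy hz e e0; have e20 : 0 < e / 2 by rewrite divr_gt0.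
have [u [gu su nu]] := hy _ e20; have [v [gv sv nv]] := hz _ e20.
exists (fun t => u t + v t); split; first exact: goodD.
  by move=> t nE; rewrite su// sv// addr0.
rewrite [e]splitr; apply: eq_nb (nbD nu nv) => k.
by rewrite fcD// opprD addrACA.
Qed.

Lemma inVZ (c : C R) y : inV y -> inV (fun k => c * y k).
Proof.
move=> hy e e0; have k0 : 0 < 1 + nm c by rewrite ltr_pwDl// nm_ge0.
have e20 : 0 < e / (1 + nm c) by rewrite divr_gt0.
have [u [gu su nu]] := hy _ e20.
exists (fun t => c * u t); split; first exact: goodM (good_cst _) gu.
  by move=> t nE; rewrite su// mulr0.
apply: (@nb_le _ _ (nm c * (e / (1 + nm c)))).
  by apply: eq_nb (nbZ c nu) => k; rewrite fcZ// mulrBr.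
by rewrite mulrCA ler_piMr ?(ltW e0)// ler_pdivrMr// mul1r lerDr.
Qed.

Lemma inV_sum (y : nat -> nat -> C R) n : (forall j, (j < n)%N -> inV (y j)) ->
  inV (fun k => \sum_(j < n) y j k).
Proof.
elim: n => [|n IH] H.
  under eq_fun do rewrite big_ord0.
  move=> e e0; exists (fun=> 0); split => //; first exact: good_cst.
  apply: nb_le (ltW e0); apply: eq_nb (nb0 R) => k; rewrite subr0 /fc.
  by under eq_I do rewrite mul0r; rewrite I_cst.
under eq_fun do rewrite big_ord_recr /=.
by apply: inVD; [apply: IH => j jn; apply: H; exact: ltnW|exact: H].
Qed.

Lemma inV_closed y : (forall e : R, 0 < e -> exists z, inV z /\ nb (fun k => z k - y k) e) ->
  inV y.
Proof.
move=> H e e0; have e20 : 0 < e / 2 by rewrite divr_gt0.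
have [z [hz nz]] := H _ e20; have [u [gu su nu]] := hz _ e20.
exists u; split => //; rewrite [e]splitr; apply: eq_nb (nbD nu nz) => k.
by rewrite addrA subrK.
Qed.

Lemma nb_shift (f : nat -> C R) b j : nb f b ->
  nb (fun k => if (k < j)%N then 0 else f (k - j)%N) b.
Proof.
move=> [b0 fb]; split=> // N; apply: le_trans (fb N).
apply: le_trans (_ : \sum_(k < j + N) nm (if (k < j)%N then 0 else f (k - j)%N) ^+ 2 <= _).
  rewrite addnC big_split_ord /= lerDl.
  by apply: sumr_ge0 => k _; exact: sqr_ge0.
rewrite big_split_ord /= big1 ?add0r => [|k _]; last by rewrite ltn_ord nm0 expr0n.
by apply: ler_sum => k _; rewrite ltnNge leq_addr addKn.
Qed.

(* Multiplying by z^j shifts the Fourier coefficients up by j; the finitely many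
   new leading ones are corrected by the deltas already obtained. *)
Lemma inV_delta j : inV (delta R j).
Proof.
elim/ltn_ind: j => j IH; apply: inV_closed => e e0.
have [u [gu su nu]] := fc_delta0_approx e0.
pose u' t := circ t ^+ j * u t.
have gu' : good u' := goodM (good_circX _ _) gu.
have su' : supp E u' by move=> t nE; rewrite /u' su// mulr0.
pose z k := fc u' k + \sum_(i < j) (- fc u' i) * delta R i k.
exists z; split.
  apply: inVD; first exact: inV_fc.
  by apply: (inV_sum (y := fun i k => - fc u' i * delta R i k)) => i ij; apply: inVZ; exact: IH.
apply: eq_nb (nb_shift j nu) => k; rewrite /z; case: ltnP => [kj|jk].
  rewrite (bigD1 (Ordinal kj))//= big1 => [|i]; last first.
    by rewrite -val_eqE /= /delta eq_sym => /negbTE ->; rewrite mulr0.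
  by rewrite /delta eqxx mulr1 addr0 subrr (ltn_eqF kj) subrr.
rewrite big1 ?addr0 => [|i _]; last first.
  by rewrite /delta gtn_eqF ?mulr0// (leq_trans (ltn_ord i) jk).
congr (_ - _); last by rewrite /delta subn_eq0 eqn_leq jk andbT.
apply: eq_I => t _; rewrite /u' [circ t ^+ j * _]mulrC -mulrA; congr (_ * _).
by rewrite -(circ_cancel t jk) rmorphM /= conjCK mulrC.
Qed.

Lemma dense_range y b : nb y b -> inV y.
Proof.
move=> ny; apply: inV_closed => e e0; have [K nt] := nb_tail ny e0.
exists (fun k => \sum_(i < K) y i * delta R i k); split.
  by apply: (inV_sum (y := fun i k => y i * delta R i k)) => i _; apply: inVZ; exact: inV_delta.
apply: eq_nb (nbN nt) => k; case: ltnP => kK.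
  rewrite (bigD1 (Ordinal kK))//= big1 => [|i]; last first.
    by rewrite -val_eqE /= /delta eq_sym => /negbTE ->; rewrite mulr0.
  by rewrite /delta eqxx mulr1 addr0 subrr oppr0.
rewrite big1 ?sub0r// => i _.
by rewrite /delta gtn_eqF ?mulr0// (leq_trans (ltn_ord i) kK).
Qed.

End DenseRange.

(** * The vector and its orbit *)

(** Recursive choice under constraints that involve all earlier values; locality of [P] lets a
    finite list stand for [f]. *)
Lemma rec_choice (P : (nat -> nat) -> nat -> nat -> Prop) :
  (forall f j, exists n, P f j n) ->
  (forall f f' j n, (forall k, (k < j)%N -> f k = f' k) -> P f j n -> P f' j n) ->
  exists f, forall j, P f j (f j).
Proof.
move=> ex loc.
have /choice[next nextP] : forall s : seq nat, exists n, P (nth 0%N s) (size s) n.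
  by move=> s; exact: ex.
pose L := fix L j := if j is j'.+1 then rcons (L j') (next (L j')) else [::].
have sL j : size (L j) = j by elim: j => //= j IH; rewrite size_rcons IH.
pose f j := next (L j).
have LE j k : (k < j)%N -> nth 0%N (L j) k = f k.
  elim: j => //= j IH; rewrite ltnS leq_eqVlt nth_rcons sL => /predU1P[->|kj].
    by rewrite ltnn eqxx.
  by rewrite kj IH.
exists f => j; have := nextP (L j); rewrite sL; apply: loc => k kj; exact: LE.
Qed.

Lemma eventually_all (Q : nat -> nat -> Prop) j :
  (forall i, (i < j)%N -> exists n0, forall n, (n0 <= n)%N -> Q i n) ->
  exists n0, forall n, (n0 <= n)%N -> forall i, (i < j)%N -> Q i n.
Proof.
elim: j => [|j IH] H; first by exists 0%N.
have [n1 H1] := IH (fun i ij => H i (ltnW ij)); have [n2 H2] := H j (ltnSn _).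
exists (maxn n1 n2) => n; rewrite geq_max => /andP[h1 h2] i.
by rewrite ltnS leq_eqVlt => /predU1P[->|ij]; [exact: H2|exact: H1].
Qed.

Section Selection.
Variable R : realType.
Variable E : set R.
Variable gs : R -> C R.
Hypothesis gs_good : good gs.
Hypothesis gs1 : forall t, E t -> nm (gs t) = 1.
Hypothesis Hdecay : forall v, good v -> supp E v -> forall e : R, 0 < e ->
  exists n0, forall n, (n0 <= n)%N -> nb (fc (fun t => gs t ^+ n * v t)) e.
Hypothesis Hrl : forall v, good v -> supp E v -> forall e : R, 0 < e ->
  exists n0, forall n, (n0 <= n)%N -> nm (I (fun t => gs t ^+ n * v t)) <= e.
Hypothesis Hrlc : forall v, good v -> supp E v -> forall e : R, 0 < e ->
  exists n0, forall n, (n0 <= n)%N -> nm (I (fun t => Num.conj (gs t) ^+ n * v t)) <= e.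
Variable u : nat -> R -> C R.
Hypothesis gu : forall j, good (u j).
Hypothesis su : forall j, supp E (u j).

Let hlf : R := 2^-1.

Definition psum (f : nat -> nat) j t : C R := \sum_(k < j) gs t ^+ f k * u k t.
(** For [n = f j] this is the function [w_j] of the overview; [n] stays free while the next exponent
    is being chosen. *)
Definition wave f j n t : C R := Num.conj (gs t) ^+ n * psum f j t.

Lemma good_psum f j : good (psum f j).
Proof. by apply: good_sum => k; exact: goodM (goodX _ gs_good) (gu _). Qed.

Lemma supp_psum f j : supp E (psum f j).
Proof. by move=> t nE; rewrite /psum big1// => k _; rewrite su// mulr0. Qed.

Lemma good_wave f j n : good (wave f j n).
Proof. exact: goodM (goodX _ (good_conj gs_good)) (good_psum _ _). Qed.

Lemma psum_local f f' j : (forall k, (k < j)%N -> f k = f' k) -> psum f j = psum f' j.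
Proof.
by move=> ff; apply/funext => t; apply: eq_bigr => k _; rewrite ff.
Qed.

(** In order: the new wave is almost orthogonal to the earlier ones; adding the new summand raises
    the energy of [psum] by at most [N2 (u j) + 1]; the new summand is negligible in the orbit at
    the earlier times [f i]; the series defining the vector converges. *)
Definition admissible f j n :=
  [/\ forall i, (i < j)%N -> nm (ip2 (wave f j n) (wave f i (f i))) <= hlf ^+ j.+1 ^+ 2,
      2 * nm (ip2 (fun t => gs t ^+ n * u j t) (psum f j)) <= 1,
      forall i, (i < j)%N ->
        nb (fc (fun t => gs t ^+ n * (Num.conj (gs t) ^+ f i * u j t))) (hlf ^+ j) &
      nb (fc (fun t => gs t ^+ n * u j t)) (hlf ^+ j)].

Let hlf0 : 0 < hlf. Proof. by rewrite invr_gt0. Qed.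

(** With the earlier exponents fixed, each condition says that a quantity tending to 0 in [n] is
    small. *)
Lemma admissible_ex f j : exists n, admissible f j n.
Proof.
have [n1 H1] : exists n0, forall n, (n0 <= n)%N -> forall i, (i < j)%N ->
    nm (ip2 (wave f j n) (wave f i (f i))) <= hlf ^+ j.+1 ^+ 2.
  apply: (eventually_all (Q := fun i n => nm (ip2 (wave f j n) (wave f i (f i))) <= hlf ^+ j.+1 ^+ 2)) => i _.
  have gv : good (fun t => psum f j t * Num.conj (wave f i (f i) t)).
    exact: goodM (good_psum _ _) (good_conj (good_wave _ _ _)).
  have sv : supp E (fun t => psum f j t * Num.conj (wave f i (f i) t)).
    by move=> t nE; rewrite supp_psum// mul0r.
  have [|n0 H] := Hrlc gv sv (e := hlf ^+ j.+1 ^+ 2); first by rewrite !exprn_gt0.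
  exists n0 => n /H; congr (nm _ <= _); apply: eq_I => t _.
  by rewrite /wave mulrA.
have [n2 H2] : exists n0, forall n, (n0 <= n)%N ->
    nm (ip2 (fun t => gs t ^+ n * u j t) (psum f j)) <= hlf.
  have gv : good (fun t => u j t * Num.conj (psum f j t)).
    exact: goodM (gu _) (good_conj (good_psum _ _)).
  have sv : supp E (fun t => u j t * Num.conj (psum f j t)).
    by move=> t nE; rewrite su// mul0r.
  have [n0 H] := Hrl gv sv hlf0; exists n0 => n /H; congr (nm _ <= _).
  by apply: eq_I => t _; rewrite mulrA.
have [n3 H3] : exists n0, forall n, (n0 <= n)%N -> forall i, (i < j)%N ->
    nb (fc (fun t => gs t ^+ n * (Num.conj (gs t) ^+ f i * u j t))) (hlf ^+ j).
  apply: (eventually_all (Q := fun i n =>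
    nb (fc (fun t => gs t ^+ n * (Num.conj (gs t) ^+ f i * u j t))) (hlf ^+ j))) => i _.
  apply: (Hdecay (v := fun t => Num.conj (gs t) ^+ f i * u j t)).
  - exact: goodM (goodX _ (good_conj gs_good)) (gu _).
  - by move=> t nE; rewrite su// mulr0.
  - exact: exprn_gt0.
have [n4 H4] := Hdecay (gu j) (@su j) (exprn_gt0 j hlf0).
exists (maxn (maxn n1 n2) (maxn n3 n4)).
have [m1 m2] : (n1 <= maxn (maxn n1 n2) (maxn n3 n4))%N /\
  (n2 <= maxn (maxn n1 n2) (maxn n3 n4))%N by rewrite !leq_max !leqnn ?orbT.
have [m3 m4] : (n3 <= maxn (maxn n1 n2) (maxn n3 n4))%N /\
  (n4 <= maxn (maxn n1 n2) (maxn n3 n4))%N by rewrite !leq_max !leqnn ?orbT.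
split; [exact: H1|by have := H2 _ m2; rewrite /hlf; lra|exact: H3|exact: H4].
Qed.

Lemma admissible_local f f' j n : (forall k, (k < j)%N -> f k = f' k) ->
  admissible f j n -> admissible f' j n.
Proof.
move=> ff [h1 h2 h3 h4].
have wE i : (i <= j)%N -> forall p, wave f i p = wave f' i p.
  move=> ij p; apply/funext => t; rewrite /wave (@psum_local f f')// => k ki.
  by apply: ff; exact: leq_trans ki ij.
split; [move=> i ij| |move=> i ij|exact: h4].
- by rewrite -(wE j (leqnn j)) -(wE i (ltnW ij)) -(ff i ij); exact: h1.
- by rewrite -(psum_local ff).
- by rewrite -(ff i ij); exact: h3.
Qed.

Variable f : nat -> nat.
Hypothesis fP : forall j, admissible f j (f j).

Definition w j := wave f j (f j).

Let gw j : good (w j). Proof. exact: good_wave. Qed.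

Lemma N2_gs n (v : R -> C R) : supp E v -> N2 (fun t => gs t ^+ n * v t) = N2 v.
Proof.
move=> sv; apply: eq_J => t _; have [Et|nE] := pselect (E t).
  by rewrite nmM nmX gs1// expr1n mul1r.
by rewrite sv// mulr0.
Qed.

Lemma N2_conj_gs n (v : R -> C R) : supp E v -> N2 (fun t => Num.conj (gs t) ^+ n * v t) = N2 v.
Proof.
move=> sv; apply: eq_J => t _; have [Et|nE] := pselect (E t).
  by rewrite nmM nmX nm_conj gs1// expr1n mul1r.
by rewrite sv// mulr0.
Qed.

Lemma N2_w j : N2 (w j) <= \sum_(k < j) (N2 (u k) + 1).
Proof.
rewrite /w /wave N2_conj_gs; last exact: supp_psum.
elim: j => [|j IH].
  rewrite big_ord0 (_ : N2 _ = 0)// /N2 -[RHS](J_cst (0 : R)); apply: eq_J => t _.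
  by rewrite /psum big_ord0 nm0 expr0n.
have gj : good (fun t => gs t ^+ f j * u j t) by exact: goodM (goodX _ gs_good) (gu _).
have -> : psum f j.+1 = (fun t => gs t ^+ f j * u j t + psum f j t).
  by apply/funext => t; rewrite /psum big_ord_recr /= addrC.
rewrite big_ord_recr /= N2D//; last exact: good_psum.
rewrite N2_gs; last exact: su.
have [_ h _ _] := fP j.
have := le_trans (ler_norm _) (nm_Re (ip2 (fun t => gs t ^+ f j * u j t) (psum f j))).
by move: h IH; lra.
Qed.

Lemma ip2Zr (z : C R) (a c : R -> C R) : good a -> good c ->
  ip2 c (fun t => z * a t) = Num.conj z * ip2 c a.
Proof.
move=> ga gc; rewrite /ip2 -IZ; last exact: goodM gc (good_conj ga).
by apply: eq_I => t _; rewrite rmorphM mulrCA.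
Qed.

Lemma ip2Zl (z : C R) (a c : R -> C R) : good a -> good c ->
  ip2 (fun t => z * a t) c = z * ip2 a c.
Proof.
move=> ga gc; rewrite /ip2 -IZ; last exact: goodM ga (good_conj gc).
by apply: eq_I => t _; rewrite mulrA.
Qed.

Lemma ip2_sumr (b : nat -> R -> C R) (c : R -> C R) n : (forall j, good (b j)) -> good c ->
  ip2 c (fun t => \sum_(j < n) b j t) = \sum_(j < n) ip2 c (b j).
Proof.
move=> gb gc; rewrite /ip2 -I_sum => [|j]; last exact: goodM gc (good_conj (gb _)).
by apply: eq_I => t _; rewrite rmorph_sum mulr_sumr.
Qed.

Lemma N2Z (z : C R) (a : R -> C R) : good a -> N2 (fun t => z * a t) = nm z ^+ 2 * N2 a.
Proof.
move=> ga; rewrite /N2 -JZ; last exact: bmf_nm2.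
by apply: eq_J => t _; rewrite nmM exprMn.
Qed.

Lemma near_orthogonal (be : nat -> C R) n :
  N2 (fun t => \sum_(j < n) be j * w j t) <=
  \sum_(j < n) nm (be j) ^+ 2 * (N2 (w j) + 2).
Proof.
pose V n t := \sum_(j < n) be j * w j t.
have gb j : good (fun t => be j * w j t) by exact: goodM (good_cst _) (gw _).
have gV m : good (V m) by apply: good_sum => j; exact: gb.
have b0 j : 0 <= nm (be j) ^+ 2 := sqr_ge0 _.
have h1 m : hlf ^+ m <= 1 by rewrite exprn_ile1 ?ltW// /hlf; lra.
(* Induction with slack: the cross terms of stage [m] cost one extra copy of [|be m|^2] and
   [hlf^(m+1)] times the earlier sum, which is exactly the growth of [1 - hlf^m]. *)
suff H m : N2 (V m) <= \sum_(j < m) nm (be j) ^+ 2 * (N2 (w j) + 1) +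
    (1 - hlf ^+ m) * \sum_(j < m) nm (be j) ^+ 2.
  apply: le_trans (H n) _; rewrite -[leRHS](_ : \sum_(j < n) nm (be j) ^+ 2 * (N2 (w j) + 1) +
      \sum_(j < n) nm (be j) ^+ 2 = _); last first.
    by rewrite -big_split; apply: eq_bigr => j _ /=; ring.
  rewrite lerD2l ler_piMl ?sumr_ge0// gerBl exprn_ge0// ltW//.
elim: m => [|m IH].
  rewrite !big_ord0 mulr0 addr0 (_ : N2 _ = 0)// /N2 -[RHS](J_cst (0 : R)).
  by apply: eq_J => t _; rewrite /V big_ord0 nm0 expr0n.
have -> : V m.+1 = (fun t => be m * w m t + V m t).
  by apply/funext => t; rewrite /V big_ord_recr /= addrC.
rewrite N2D// N2Z//; set T := 2 * _; rewrite !big_ord_recr /=.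
set S := \sum_(j < m) nm (be j) ^+ 2 in IH *; have S0 : 0 <= S by rewrite sumr_ge0.
have B0 := b0 m; set B := nm (be m) ^+ 2 in B0 *.
have h0 : 0 < hlf ^+ m.+1 by exact: exprn_gt0.
suff : T <= B + hlf ^+ m.+1 * S.
  have p1 : 0 <= (1 - hlf ^+ m.+1) * B by rewrite mulr_ge0// subr_ge0.
  have e1 : hlf ^+ m = 2 * hlf ^+ m.+1 by rewrite exprS mulVKf.
  by move: p1 IH; rewrite e1; lra.
have TE : T <= 2 * \sum_(j < m) nm (be m) * nm (be j) * hlf ^+ m.+1 ^+ 2.
  rewrite /T ler_pM2l// (le_trans (ler_norm _))// (le_trans (nm_Re _))//.
  have -> : ip2 (fun t => be m * w m t) (V m) =
      \sum_(j < m) ip2 (fun t => be m * w m t) (fun t => be j * w j t).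
    exact: (@ip2_sumr (fun j t => be j * w j t) _ m gb (gb m)).
  rewrite (le_trans (nm_sum _ _ _))//; apply: ler_sum => j _.
  rewrite (ip2Zr (be j) (gw j) (gb m)) (ip2Zl (be m) (gw m) (gw j)).
  rewrite (nmM (Num.conj _)) nm_conj (nmM (be m)) mulrA [nm (be j) * _]mulrC.
  rewrite ler_wpM2l ?mulr_ge0 ?nm_ge0//.
  by have [h _ _ _] := fP m; exact: h.
apply: (le_trans TE); rewrite mulr_sumr.
set eta := hlf ^+ m.+1 ^+ 2; have eta0 : 0 <= eta by exact: sqr_ge0.
apply: le_trans (_ : \sum_(j < m) (eta * B + eta * nm (be j) ^+ 2) <= _).
  apply: ler_sum => j _; rewrite -mulrDr mulrA [leLHS]mulrC ler_wpM2l// -subr_ge0.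
  rewrite (_ : _ - _ = (nm (be m) - nm (be j)) ^+ 2) ?sqr_ge0//.
  by rewrite /B; ring.
have -> : \sum_(j < m) (eta * B + eta * nm (be j) ^+ 2) = m%:R * (eta * B) + eta * S.
  by rewrite big_split /= sumr_const card_ord mulr_natl /S mulr_sumr.
apply: lerD; last first.
  by rewrite ler_wpM2r// /eta expr2 ler_piMl// ltW.
have m2 : hlf ^+ m.+1 * m%:R <= 1.
  have -> : hlf ^+ m.+1 = (2 ^+ m.+1)^-1 by rewrite exprVn.
  rewrite ler_pdivrMl ?exprn_gt0// mulr1 -natrX ler_nat.
  exact: leq_trans (ltnW (ltn_expl m _)) (leq_pexp2l _ _).
rewrite mulrA ler_piMl// [_ * eta]mulrC /eta expr2 -mulrA.
by rewrite mulr_ile1 ?mulr_ge0 ?(ltW h0).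
Qed.

(** The bound of [N2_w] for the energy of the wave, plus the 2 of [near_orthogonal]. *)
Definition cost j : R := \sum_(k < j) (N2 (u k) + 1) + 2.

Lemma cost_gt0 j : 0 < cost j.
Proof.
rewrite /cost ltr_wpDl// sumr_ge0// => k _.
by rewrite addr_ge0// N2_ge0.
Qed.

(** Bessel's inequality by duality: the waves are weighted in [V] so that its pairing with [e] is
    the sum [T] itself while [N2 V <= T]; Cauchy-Schwarz then gives [T <= sqrt T * b]. *)
Lemma wave_bessel (e : nat -> C R) b (S : pred nat) n : nb e b ->
  \sum_(j < n | S j) nm (ip (fc (w j)) e) ^+ 2 / cost j <= b ^+ 2.
Proof.
move=> ne; have b0 := nb_ge0 ne.
set T := \sum_(j < n | S j) _.
pose al j := ip (fc (w j)) e.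
pose be j : C R := if S j then RtoC (cost j)^-1 * Num.conj (al j) else 0.
pose V t := \sum_(j < n) be j * w j t.
have gb j : good (fun t => be j * w j t) by exact: goodM (good_cst _) (gw _).
have gV : good V by apply: good_sum => j; exact: gb.
have T0 : 0 <= T.
  by apply: sumr_ge0 => j _; rewrite divr_ge0 ?sqr_ge0// ltW// cost_gt0.
have nbw j : nb (fun k => be j * fc (w j) k) (nm (be j) * Num.sqrt (N2 (w j))).
  exact: nbZ (fc_nb_sqrt (gw j)).
have E1 : ip (fc V) e = RtoC T.
  have -> : fc V = (fun k => \sum_(j < n) be j * fc (w j) k).
    apply/funext => k; rewrite /V fc_sum//; apply: eq_bigr => j _.
    by rewrite fcZ.
  rewrite (@ip_sum _ (fun j k => be j * fc (w j) k) (fun j => nm (be j) * Num.sqrt (N2 (w j))) e b n)//.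
  rewrite /T RtoC_sum [RHS]big_mkcond; apply: eq_bigr => j _.
  rewrite (ipZl _ (fc_nb_sqrt (gw j)) ne) /be -/(al j); case: ifP => _; last by rewrite mul0r.
  by rewrite -mulrA [Num.conj _ * _]mulrC sqr_norm_conj -RtoCM mulrC.
have E2 : N2 V <= T.
  apply: le_trans (near_orthogonal be n) _; rewrite /T [leRHS]big_mkcond.
  apply: ler_sum => j _; rewrite /be; case: ifP => _; last first.
    by rewrite nm0 expr0n mul0r.
  have cj := cost_gt0 j.
  rewrite nmM nm_real nm_conj ger0_norm ?invr_ge0 ?(ltW cj)// exprMn -/(al j).
  rewrite mulrAC mulrC ler_wpM2l ?sqr_ge0// expr2 -mulrA ler_piMr ?invr_ge0 ?(ltW cj)//.
  by rewrite ler_pdivrMl// mulr1 lerD2r N2_w.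
have : T <= Num.sqrt T * b.
  have nV : nb (fc V) (Num.sqrt T).
    by apply: (fc_nb gV (sqrtr_ge0 _)); rewrite sqr_sqrtr.
  by have := ip_le nV ne; rewrite E1 nm_real ger0_norm.
have [->|t0] := eqVneq T 0; first by rewrite sqr_ge0.
have tp : 0 < Num.sqrt T by rewrite sqrtr_gt0 lt_neqAle eq_sym t0.
rewrite -{1}[T]sqr_sqrtr// expr2 ler_pM2l// => h.
by rewrite -[leLHS]sqr_sqrtr// lerXn2r ?nnegrE ?sqrtr_ge0.
Qed.

Let z j (k : nat) : C R := fc (fun t => gs t ^+ f j * u j t) k.

Definition xvec k : C R := lim (series (fun j => z j k) @ \oo).

Lemma psum_fc J k : fc (psum f J) k = \sum_(j < J) z j k.
Proof. by rewrite /psum fc_sum// => j; exact: goodM (goodX _ gs_good) (gu _). Qed.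

Let nbz j : nb (z j) (hlf ^+ j). Proof. by have [_ _ _] := fP j. Qed.

Let geo a n : \sum_(j < n) hlf ^+ (a + j) <= 2 * hlf ^+ a.
Proof.
suff -> : \sum_(j < n) hlf ^+ (a + j) = 2 * hlf ^+ a - 2 * hlf ^+ (a + n).
  by rewrite gerBl mulr_ge0// exprn_ge0// ltW.
elim: n => [|n IH]; first by rewrite big_ord0 addn0 subrr.
by rewrite big_ord_recr /= IH addnS exprS /hlf; field.
Qed.

Lemma xvec_cvg k : (fun J => fc (psum f J) k) @ \oo --> xvec k.
Proof.
have [||L cL] := @cvgC_series R (fun j => z j k) (geometric 1 hlf).
- by move=> j; rewrite /geometric /= mul1r; exact: (nb_coef k (nbz j)).
- by apply: is_cvg_geometric_series; rewrite ger0_norm ?ltW// /hlf; lra.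
have : series (fun j => z j k) @ \oo --> xvec k by apply/cvg_ex; exists L.
apply: cvg_trans; apply: near_eq_cvg; apply: nearW => J.
by rewrite psum_fc series_mkord.
Qed.

Lemma psum_nb J : nb (fc (psum f J)) 2.
Proof.
apply: (@nb_le _ _ (\sum_(j < J) hlf ^+ j)).
  by apply: eq_nb (nb_sum (fun j _ => nbz j)) => k; rewrite psum_fc.
by have := geo 0 J; rewrite expr0 mulr1; under eq_bigr do rewrite add0n.
Qed.

Lemma xvec_nb : nb xvec 2.
Proof. by apply: nb_lim xvec_cvg; apply: nearW => J; exact: psum_nb. Qed.

Lemma ip_conj_sym (p q : nat -> C R) a b : nb p a -> nb q b -> ip q p = Num.conj (ip p q).
Proof.
move=> np nq; apply: (ip_eq nq np).
have H : (fun n => Num.conj (series (dot p q) n)) @ \oo --> Num.conj (ip p q).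
  by apply: conj_cvg; exact: (ip_cvg np nq).
apply: cvg_trans H; apply: near_eq_cvg; apply: nearW => n.
rewrite !series_mkord rmorph_sum; apply: eq_bigr => k _.
by rewrite /dot rmorphM /= conjCK mulrC.
Qed.

Variable A : (nat -> C R) -> (nat -> C R).
Hypothesis A_fc : forall n v, good v -> supp E v ->
  iter n A (fc v) = fc (fun t => Num.conj (gs t) ^+ n * v t).
Hypothesis A_ip : forall n k, exists T b, nb T b /\
  forall p, H2 p -> iter n A p k = ip p T.

(** Each coordinate of [iter n A p] is a pairing of [p] with a fixed vector, and the partial sums
    converge weakly to [xvec]. *)
Lemma iter_xvec n k : (fun J => iter n A (fc (psum f J)) k) @ \oo --> iter n A xvec k.
Proof.
have [T [b [nT AT]]] := A_ip n k.
rewrite AT; last exact: nb_H2 xvec_nb.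
rewrite (ip_conj_sym nT xvec_nb).
have H : (fun J => Num.conj (ip T (fc (psum f J)))) @ \oo --> Num.conj (ip T xvec).
  by apply: conj_cvg; exact: (ip_weak_cvg nT psum_nb xvec_cvg).
apply: cvg_trans H; apply: near_eq_cvg; apply: nearW => J.
rewrite AT; last exact: nb_H2 (psum_nb J).
by rewrite (ip_conj_sym nT (psum_nb J)).
Qed.

(** At time [f i] the summands before [i] form the wave, the summand [i] returns to [u i] because
    [|gs| = 1] on [E], and the later ones have total norm at most [2 * hlf^(i+1) = hlf^i]. *)
Lemma orbit_decomposition i : exists tau : nat -> C R,
  nb tau (hlf ^+ i) /\
  forall k, iter (f i) A xvec k = fc (w i) k + fc (u i) k + tau k.
Proof.
exists (fun k => iter (f i) A xvec k - (fc (w i) k + fc (u i) k)); split; last first.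
  by move=> k; rewrite subrKC.
pose y j t := gs t ^+ f j * (Num.conj (gs t) ^+ f i * u j t).
have gy j : good (y j).
  by exact: goodM (goodX _ gs_good) (goodM (goodX _ (good_conj gs_good)) (gu _)).
apply: (@nb_lim _ (fun J k => \sum_(j < J - i.+1) fc (y (i.+1 + j)%N) k)).
  apply: nearW => J; apply: (@nb_le _ _ (\sum_(j < J - i.+1) hlf ^+ (i.+1 + j))).
    apply: (nb_sum (u := fun j => fc (y (i.+1 + j)%N)) (b := fun j => hlf ^+ (i.+1 + j))) => j _.
    by have [_ _ h _] := fP (i.+1 + j)%N; apply: h; rewrite addSn ltnS leq_addr.
  apply: le_trans (geo i.+1 _) _; rewrite exprS /hlf; lra.
move=> k.
have c : (fun J => iter (f i) A (fc (psum f J)) k - (fc (w i) k + fc (u i) k)) @ \oo -->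
    iter (f i) A xvec k - (fc (w i) k + fc (u i) k).
  by apply: cvgD; [exact: iter_xvec|exact: cvg_cst].
apply: cvg_trans c; apply: near_eq_cvg; exists i.+1 => // J /= iJ.
rewrite A_fc; [|exact: good_psum|exact: supp_psum].
rewrite -{1}(subnKC iJ).
have -> : fc (fun t => Num.conj (gs t) ^+ f i * psum f (i.+1 + (J - i.+1)) t) k =
   fc (fun t => w i t + u i t + \sum_(j < J - i.+1) y (i.+1 + j)%N t) k.
  apply: eq_I => t _; congr (_ * _); rewrite /psum big_split_ord /= mulrDr.
  congr (_ + _); last first.
    rewrite mulr_sumr; apply: eq_bigr => j _; rewrite /y.
    by rewrite mulrCA.
  rewrite big_ord_recr /= mulrDr; congr (_ + _).
  have [Et|nE] := pselect (E t); last by rewrite su// !mulr0.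
  by rewrite mulrA -exprMn mulrC [X in X ^+ _]mulrC sqr_norm_conj gs1// expr1n expr1n mulr1.
have g3 : good (fun t => \sum_(j < J - i.+1) y (i.+1 + j)%N t).
  by apply: good_sum => j; exact: gy.
rewrite (fcD k (goodD (gw i) (gu i)) g3) (fcD k (gw i) (gu i)) addrC addKr.
by rewrite (@fc_sum R _ _ _ (fun j : 'I_(J - i.+1) => y (i.+1 + j)%N) k).
Qed.

End Selection.

(** * The order of the targets *)

Section DyadicValuation.
Variable R : realType.

Lemma sum_double (F : nat -> R) n :
  \sum_(j < n.*2) F j = \sum_(i < n) (F i.*2 + F i.*2.+1).
Proof.
elim: n => [|n IH]; first by rewrite !big_ord0.
by rewrite doubleS !big_ord_recr /= IH addrA.
Qed.

(** The 2-adic valuation is unbounded but averages at most 1, and takes each value with positive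
    density. *)
Definition v2 (k : nat) : nat := logn 2 k.+1.

Lemma v2_even i : v2 i.*2 = 0%N.
Proof. by rewrite /v2 logn_coprime// coprime2n /= odd_double. Qed.

Lemma v2_odd i : v2 i.*2.+1 = (v2 i).+1.
Proof. by rewrite /v2 -doubleS -mul2n lognM. Qed.

(** Halving: an even index contributes 0 and the index [2 i + 1] contributes [v2 i + 1]. *)
Lemma sum_v2_le n : \sum_(k < n) (v2 k)%:R <= n%:R :> R.
Proof.
elim/ltn_ind: n => n IH.
suff : \sum_(k < odd n + n./2.*2) (v2 k)%:R <= (odd n + n./2.*2)%:R :> R.
  by rewrite odd_double_half.
have H : \sum_(k < n./2.*2) (v2 k)%:R <= n./2.*2%:R :> R.
  rewrite (sum_double (fun k => (v2 k)%:R)) (eq_bigr (fun i : 'I_n./2 => (v2 i)%:R + 1)); last first.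
    by move=> i _; rewrite v2_even v2_odd add0r -natr1.
  rewrite big_split /= sumr_const card_ord -addnn natrD lerD2r.
  case: n {IH}(IH n./2) => [_|n H]; first by rewrite big_ord0.
  by apply: H; rewrite -divn2 ltn_Pdiv.
case: (odd n); last by rewrite add0n.
rewrite add1n big_ord_recr /= v2_even addr0 (le_trans H)// ler_nat//.
Qed.

Definition harm v j : R := if v2 j == v then j.+1%:R^-1 else 0.

(** For [v = 0] the reciprocals of odd numbers dominate half of a harmonic sum. The substitution
    [j + 1 = 2 (i + 1)] passes from [v] to [v + 1] and halves the sum. *)
Lemma harm_unbounded v (B : R) : exists n, B < \sum_(j < n) harm v j.
Proof.
have hd (K : R) : exists n, K < \sum_(i < n) i.+1%:R^-1.
  apply: contrapT => /forallNP H; apply: (@dvg_harmonic R).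
  apply: nondecreasing_is_cvgn.
    apply/nondecreasing_seqP => n; rewrite /series /= big_nat_recr//= lerDl.
    by rewrite /harmonic /= invr_ge0.
  exists K => _ [n _ <-]; rewrite series_mkord leNgt; apply/negP; exact: H.
elim: v B => [|v IH] B.
  have [n hn] := hd (2 * B); exists n.*2; rewrite sum_double.
  apply: (@lt_le_trans _ _ (2^-1 * \sum_(i < n) i.+1%:R^-1)).
    by rewrite ltr_pdivlMl.
  rewrite mulr_sumr; apply: ler_sum => i _.
  rewrite /harm v2_even v2_odd eqxx addr0 -invfM lef_pV2 ?posrE ?mulr_gt0 ?ltr0n//.
  by rewrite -natrM ler_nat mul2n doubleS.
have [n hn] := IH (2 * B); exists n.*2; rewrite sum_double.
rewrite (eq_bigr (fun i : 'I_n => 2^-1 * harm v i)); last first.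
  move=> i _; rewrite /harm v2_even v2_odd add0r eqSS; case: ifP => _; last by rewrite mulr0.
  by rewrite -doubleS -mul2n natrM invfM.
by rewrite -mulr_sumr ltr_pdivlMl.
Qed.

(** [v] must be large as well as of valuation [l], to pass the norm threshold in [target]; take
    [v + 1 = 2^l * (2 B + 1)]. *)
Lemma v2_surj l (b : R) : exists v, v2 v = l /\ b <= v.+1%:R.
Proof.
pose B := Num.bound `|b|; exists (2 ^ l * B.*2.+1).-1.
have p : (0 < 2 ^ l * B.*2.+1)%N by rewrite muln_gt0 expn_gt0.
rewrite /v2 prednK//; split.
  rewrite lognM ?expn_gt0// pfactorK// [logn _ B.*2.+1]logn_coprime ?addn0//.
  by rewrite coprime2n /= odd_double.
apply: ltW; apply: (le_lt_trans (ler_norm b)); apply: (lt_le_trans (archi_boundP (normr_ge0 b))).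
rewrite ler_nat -/B; apply: (@leq_trans B.*2.+1); last by rewrite leq_pmull// expn_gt0.
by rewrite -addnn -addnS leq_addr.
Qed.

End DyadicValuation.

(** * A dense sequence of targets *)

Section Enumeration.
Variable R : realType.
Variable E : set R.
Hypothesis dense : forall (y : nat -> C R) b, nb y b -> inV E y.

Let ratC (p : rat * rat) : C R := Complex (ratr p.1) (ratr p.2).

Lemma ratC_dense (z : C R) (e : R) : 0 < e -> exists p, nm (ratC p - z) < e.
Proof.
move=> e0; have e20 : 0 < e / 2 by rewrite divr_gt0.
have near (x : R) : exists q : rat, `|ratr q - x| < e / 2.
  have [|q] := @rat_in_itvoo R (x - e / 2) (x + e / 2); first by rewrite ltrBlDr -addrA -splitr ltrDl.
  by rewrite in_itv /= => hq; exists q; rewrite ltr_distl.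
have [a ha] := near (complex.Re z); have [b hb] := near (complex.Im z).
exists (a, b); apply: (le_lt_trans (nm_le _)); rewrite cReD cImD cReN cImN /=.
by rewrite [ltRHS]splitr ltrD.
Qed.

Let row (c : seq (rat * rat)) (k : nat) : C R :=
  if (k < size c)%N then ratC (nth (0, 0) c k) else 0.

Let nb_row c : exists b, nb (row c) b.
Proof.
exists (\sum_(j < size c) (nm (row c j) * 1)).
apply: eq_nb (nb_sum (u := fun j k => row c j * delta R j k) (b := fun j => nm (row c j) * 1)
  (n := size c) _) => [k|j _]; last by apply: nbZ; exact: nb_delta.
have [kc|ck] := ltnP k (size c); last first.
  rewrite /row ltnNge ck /= big1// => i _.
  by rewrite /delta gtn_eqF ?mulr0// (leq_trans (ltn_ord i) ck).
rewrite (bigD1 (Ordinal kc))//= big1 => [|i]; last first.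
  by rewrite -val_eqE /= /delta eq_sym => /negbTE ->; rewrite mulr0.
by rewrite /delta eqxx mulr1 addr0.
Qed.

Let row_dense (y : nat -> C R) b (d : R) : nb y b -> 0 < d ->
  exists c, nb (fun k => row c k - y k) d.
Proof.
move=> ny d0; have d20 : 0 < d / 2 by rewrite divr_gt0.
have [K nt] := nb_tail ny d20.
have e0 : 0 < d / 2 / K.+1%:R by rewrite divr_gt0// ltr0n.
have /choice[q qP] k : exists p, nm (ratC p - y k) < d / 2 / K.+1%:R by exact: ratC_dense.
pose c := mkseq q K; exists c.
pose h k : C R := \sum_(j < K) (ratC (q j) - y j) * delta R j k.
have nh : nb h (d / 2).
  apply: (@nb_le _ _ (\sum_(j < K) (nm (ratC (q j) - y j) * 1))).
    apply: (nb_sum (u := fun j k => (ratC (q j) - y j) * delta R j k)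
      (b := fun j => nm (ratC (q j) - y j) * 1)) => j _.
    by apply: nbZ; exact: nb_delta.
  apply: (@le_trans _ _ (\sum_(j < K) d / 2 / K.+1%:R)).
    by apply: ler_sum => j _; rewrite mulr1 ltW.
  rewrite sumr_const card_ord -[_ *+ K]mulr_natr mulrAC ler_pdivrMr ?ltr0n//.
  by rewrite ler_wpM2l ?(ltW d20)// ler_nat.
apply: (@nb_le _ _ (d / 2 + d / 2)); last by rewrite -splitr.
apply: eq_nb (nbB nh nt) => k; rewrite /row size_mkseq /h; case: ltnP => kK.
  rewrite (bigD1 (Ordinal kK))//= big1 => [|i]; last first.
    by rewrite -val_eqE /= /delta eq_sym => /negbTE ->; rewrite mulr0.
  by rewrite /delta eqxx mulr1 addr0 subr0 nth_mkseq.
rewrite big1 => [|i _]; last by rewrite /delta gtn_eqF ?mulr0// (leq_trans (ltn_ord i) kK).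
by [].
Qed.

(** Finite rational sequences are dense but are only approximated by projections from [E]. Each is
    therefore paired with every precision [1 / (m + 1)], and one index codes the pair. *)
Lemma dense_sequence : exists U : nat -> R -> C R,
  [/\ forall l, good (U l), forall l, supp E (U l) &
    forall (y : nat -> C R) b (d : R), nb y b -> 0 < d ->
      exists l, nb (fun k => fc (U l) k - y k) d].
Proof.
have H (p : seq (rat * rat) * nat) : exists v,
    [/\ good v, supp E v & nb (fun k => fc v k - row p.1 k) p.2.+1%:R^-1].
  have [b nr] := nb_row p.1; apply: (dense nr).
  by rewrite invr_gt0 ltr0n.
have [v vP] := choice H; pose U l := if unpickle l is Some p then v p else fun=> 0.
exists U; split=> [l|l|y b d ny d0]; rewrite /U.
- by case: unpickle => [p|]; [case: (vP p)|exact: good_cst].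
- by case: unpickle => [p|//]; case: (vP p).
have d20 : 0 < d / 2 by rewrite divr_gt0.
have [c nc] := row_dense ny d20.
pose m := Num.bound `|(d / 2)^-1|; exists (pickle (c, m)); rewrite pickleK.
have [_ _ nv] := vP (c, m).
apply: (@nb_le _ _ (m.+1%:R^-1 + d / 2)).
  by apply: eq_nb (nbD nv nc) => k /=; rewrite addrA subrK.
rewrite [leRHS]splitr lerD2r invf_ple ?posrE ?ltr0n//; apply: ltW.
apply: (le_lt_trans (ler_norm _)); apply: (lt_le_trans (archi_boundP (normr_ge0 _))).
by rewrite ler_nat leqnSn.
Qed.

End Enumeration.

(** * Recurrence of the targets and weak density of the orbit *)

Section Recurrence.
Variable R : realType.
Variable E : set R.
Variable gs : R -> C R.
Hypothesis gs_good : good gs.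
Hypothesis gs1 : forall t, E t -> nm (gs t) = 1.
Variable A : (nat -> C R) -> (nat -> C R).
Hypothesis A_fc : forall n v, good v -> supp E v ->
  iter n A (fc v) = fc (fun t => Num.conj (gs t) ^+ n * v t).
Hypothesis A_ip : forall n k, exists T b, nb T b /\
  forall p, H2 p -> iter n A p k = ip p T.
Variable U : nat -> R -> C R.
Hypothesis U_good : forall l, good (U l).
Hypothesis U_supp : forall l, supp E (U l).
Hypothesis U_dense : forall (y : nat -> C R) b (d : R), nb y b -> 0 < d ->
  exists l, nb (fun k => fc (U l) k - y k) d.

(* Iterating the valuation makes every target U l reappear along sets of indices
   of positive density, while the total energy of the first j targets stays O(j). *)
Definition target j : R -> C R :=
  if N2 (U (v2 (v2 j))) <= (v2 j).+1%:R then U (v2 (v2 j)) else fun=> 0.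

Lemma target_good j : good (target j).
Proof. by rewrite /target; case: ifP => _; [exact: U_good|exact: good_cst]. Qed.

Lemma target_supp j : supp E (target j).
Proof. by rewrite /target; case: ifP => _; [exact: U_supp|]. Qed.

Lemma N2_target j : N2 (target j) <= (v2 j).+1%:R.
Proof.
rewrite /target; case: ifP => [//|_].
rewrite (_ : N2 _ = 0)// /N2 -[RHS](J_cst (0 : R)); apply: eq_J => t _.
by rewrite nm0 expr0n.
Qed.

(** By the threshold in [target] each summand is at most [v2 k + 2], and the valuations average at
    most 1: the total is at most [3 j + 2]. *)
Lemma cost_target j : cost target j <= 3 * j.+1%:R.
Proof.
have H : \sum_(k < j) (N2 (target k) + 1) <= \sum_(k < j) ((v2 k)%:R + 2).
  apply: ler_sum => k _; have := N2_target k; rewrite -(natr1 (v2 k)); lra.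
move: H; rewrite [leRHS]big_split /= [X in _ + X]sumr_const card_ord -[_ *+ j]mulr_natr.
have := sum_v2_le R j; rewrite /cost -(natr1 j); lra.
Qed.

Lemma v2_le j : (v2 j <= j)%N.
Proof. by rewrite -ltnS /v2 ltn_logl. Qed.

Lemma common_bound (e : nat -> nat -> C R) m : (forall i, (i < m)%N -> H2 (e i)) ->
  exists2 B : R, 0 < B & forall i, (i < m)%N -> nb (e i) B.
Proof.
elim: m => [|m IH] H; first by exists 1.
have [B B0 HB] := IH (fun i im => H i (ltnW im)).
have [b nbm] := H2_nb (H m (ltnSn m)); have b0 := nb_ge0 nbm.
exists (B + b) => [|i]; first by rewrite ltr_wpDr.
rewrite ltnS leq_eqVlt => /predU1P[->|im].
  by apply: nb_le nbm _; rewrite lerDr ltW.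
by apply: nb_le (HB _ im) _; rewrite lerDl.
Qed.

Variable f : nat -> nat.
Hypothesis fP : forall j, admissible gs target f j (f j).

(** Otherwise every index [j] of valuation [v] contributes at least [d^2 / (3 (j + 1))] to the sum
    of the [m] Bessel sums, which is at most [m * B^2], whereas these reciprocals have a divergent
    sum. Adding the Bessel sums first is what yields one [j] for all test vectors. *)
Lemma small_waves (e : nat -> nat -> C R) m (B d : R) v : 0 < d ->
  (forall i, (i < m)%N -> nb (e i) B) ->
  exists2 j, v2 j = v & forall i, (i < m)%N -> nm (ip (fc (w gs target f j)) (e i)) <= d.
Proof.
move=> d0 eB; apply: contrapT => /forall2NP H.
have big j : v2 j == v -> d ^+ 2 / (3 * j.+1%:R) <=
    \sum_(i < m) nm (ip (fc (w gs target f j)) (e i)) ^+ 2 / cost target j.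
  move=> /eqP vj; have [//|/existsNP[i /not_implyP[im /negP]]] := H j.
  rewrite -ltNge => di.
  apply: (@le_trans _ _ (nm (ip (fc (w gs target f j)) (e i)) ^+ 2 / cost target j)).
    apply: ler_pM; rewrite ?sqr_ge0 ?invr_ge0 ?mulr_ge0//.
      by rewrite ler_pXn2r ?nnegrE ?nm_ge0 ?ltW.
    by rewrite lef_pV2 ?posrE ?cost_target ?cost_gt0 ?mulr_gt0 ?ltr0n.
  rewrite (bigD1 (Ordinal im))//= lerDl sumr_ge0// => k _.
  by rewrite divr_ge0 ?sqr_ge0// ltW// cost_gt0.
have [n Hn] := harm_unbounded v (3 / d ^+ 2 * (m%:R * B ^+ 2)).
have d20 : 0 < d ^+ 2 / 3 by rewrite divr_gt0// exprn_gt0.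
suff : d ^+ 2 / 3 * \sum_(j < n) harm R v j <= m%:R * B ^+ 2.
  rewrite -ler_pdivlMl// leNgt => /negP; apply.
  by rewrite invf_div.
rewrite mulr_sumr.
apply: (@le_trans _ _ (\sum_(j < n | v2 j == v)
    \sum_(i < m) nm (ip (fc (w gs target f j)) (e i)) ^+ 2 / cost target j)).
  rewrite [leRHS]big_mkcond; apply: ler_sum => j _; rewrite /harm.
  case: ifP => [/big|_]; last by rewrite mulr0.
  by rewrite invfM mulrA.
rewrite exchange_big /=.
apply: (@le_trans _ _ (\sum_(i < m) B ^+ 2)).
  apply: ler_sum => i _.
  exact: (wave_bessel gs_good gs1 target_good target_supp fP (fun j => v2 j == v) n (eB i (ltn_ord i))).
by rewrite sumr_const card_ord mulr_natl.
Qed.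

Lemma half_pow_small (b d : R) : 0 < d -> exists j0, forall j, (j0 <= j)%N ->
  2^-1 ^+ j * b <= d.
Proof.
move=> d0; pose j0 := Num.bound `|b / d|; exists j0 => j jj.
rewrite exprVn ler_pdivrMl ?exprn_gt0// -ler_pdivrMr//.
apply: (le_trans (ler_norm _)); apply: ltW.
apply: (lt_le_trans (archi_boundP (normr_ge0 _))).
rewrite -/j0 -natrX ler_nat; exact: leq_trans jj (ltnW (ltn_expl j _)).
Qed.

Lemma orbit_approx (y : nat -> C R) m (e : nat -> nat -> C R) (eps : R) :
  H2 y -> (forall i, (i < m)%N -> H2 (e i)) -> 0 < eps ->
  exists n, forall i, (i < m)%N ->
    nm (ip (fun k => iter n A (xvec gs target f) k - y k) (e i)) < eps.
Proof.
move=> /H2_nb[b ny] /common_bound[B B0 eB] eps0.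
(* Three errors of at most [eps / 4]: the wave, the distance from the target to [y], and the
   remainder [tau]. *)
have d0 : 0 < eps / 4 by rewrite divr_gt0.
have [l nl] := U_dense ny (divr_gt0 d0 B0).
have [j0 Hj0] := half_pow_small B d0.
(* [v] selects the target [l] and passes its norm threshold; an index of valuation [v] is at least
   [v], hence at least [j0], which makes [tau] small. *)
have [v [vl]] := v2_surj l (Num.max (N2 (U l)) j0.+1%:R).
rewrite ge_max => /andP[Nv jv].
have [j vj Hj] := small_waves v d0 eB.
have uj : target j = U l by rewrite /target vj vl Nv.
have jj : (j0 <= j)%N.
  by apply: leq_trans (v2_le j); rewrite vj -ltnS -(ler_nat R).
have [tau [ntau orb]] := orbit_decomposition gs_good gs1 target_good target_supp fP A_fc A_ip j.
exists (f j) => i im; have nei := eB i im.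
have nw := fc_nb_sqrt (good_wave gs_good target_good f j (f j)).
rewrite -/(w gs target f j) in nw.
have -> : (fun k => iter (f j) A (xvec gs target f) k - y k) =
    (fun k => fc (w gs target f j) k + (fc (U l) k - y k) + tau k).
  by apply/funext => k; rewrite orb uj; ring.
rewrite (ipDl (nbD nw nl) ntau nei) (ipDl nw nl nei).
have h1 := nmD (ip (fc (w gs target f j)) (e i) + ip (fun k => fc (U l) k - y k) (e i)) (ip tau (e i)).
have h2 := nmD (ip (fc (w gs target f j)) (e i)) (ip (fun k => fc (U l) k - y k) (e i)).
have := Hj i im; have := ip_le nl nei; have := ip_le ntau nei; have := Hj0 j jj.
rewrite divfK ?gt_eqF//; lra.
Qed.

End Recurrence.

(** * The unimodular part of the boundary *)

Section UnimodularBoundary.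
Variable R : realType.
Notation mu := (@lebesgue_measure R).
Variables (g : C R -> C R) (M : R).
Hypothesis dg : forall z, disc z -> derivable g z 1.
Hypothesis gM : forall z, disc z -> nm (g z) <= M.

Let F n t : C R := g (RtoC (rho R n) * circ t).

Let rho0 n : 0 <= rho R n < 1.
Proof. by have /andP[/ltW -> ->] := rho_itv R n. Qed.

Let gF n : good (F n).
Proof. exact: (good_trace dg gM (rho0 n)). Qed.

Let FM n t : nm (F n t) <= M.
Proof.
have /andP[r0 r1] := rho0 n.
by apply/gM/discE; rewrite nmM nm_circ mulr1 nm_real ger0_norm.
Qed.

(** Squared moduli, since these are measurable by [bmf_nm2]. *)
Let near_limit k N n : set R :=
  [set t | nm (F n t - F N t) ^+ 2 <= k.+1%:R^-1] `&`
  [set t | `|nm (F n t) ^+ 2 - 1| <= k.+1%:R^-1].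

(** [unimodular_set] quantifies over limits along all radii and is not visibly measurable. Being
    Cauchy along the radii [rho] with moduli tending to 1 is a countable condition, and a weaker
    one. *)
Definition cauchy_unimodular : set R :=
  `[0, 1[%classic `&` \bigcap_k \bigcup_N \bigcap_(n in [set n | (N <= n)%N]) near_limit k N n.

Let measurable_le (f : R -> R) c : bmf f -> measurable [set t | f t <= c].
Proof.
move=> [mf _]; rewrite -[X in measurable X]setTI; apply: measurable_fun_le => //.
Qed.

Lemma measurable_cauchy_unimodular : measurable cauchy_unimodular.
Proof.
apply: measurableI; first exact: measurable_itv.
apply: bigcap_measurableType => k _; apply: bigcupT_measurable => N.
apply: bigcap_measurableType => n _; apply: measurableI; apply: measurable_le.
  by apply: bmf_nm2; exact: goodB.
have [m1 [B hB]] : bmf (fun t => nm (F n t) ^+ 2 - 1).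
  by apply: bmfB; [exact: bmf_nm2|exact: bmf_cst].
split; first exact: measurableT_comp.
by exists B => t; rewrite normr_id.
Qed.

Lemma inv_nat_lt (e : R) : 0 < e -> exists k, k.+1%:R^-1 < e.
Proof. by move=> /ltr_add_invr[k]; rewrite add0r; exists k. Qed.

Lemma cauchyC_cvg (u : nat -> C R) :
  (forall e : R, 0 < e -> exists N, forall n, (N <= n)%N -> nm (u n - u N) < e) ->
  exists L : C R, u @ \oo --> L.
Proof.
move=> H.
have c (p : C R -> R) : (forall z w, p (z - w) = p z - p w) ->
    (forall z, `|p z| <= nm z) -> cvg (p (u n) @[n --> \oo]).
  move=> pB pn; apply: cauchy_cvg; apply: cauchy_exP => e /= e0.
  have [N HN] := H e e0; exists (p (u N)); exists N => // n /= Nn.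
  rewrite /ball /= -pB; apply: le_lt_trans (pn _) _.
  by rewrite nmB; exact: HN.
have /cvg_ex[a ca] : cvg (complex.Re (u n) @[n --> \oo]).
  by apply: (c (@complex.Re R)) => [z w|]; [rewrite cReD cReN|exact: nm_Re].
have /cvg_ex[b cb] : cvg (complex.Im (u n) @[n --> \oo]).
  by apply: (c (@complex.Im R)) => [z w|]; [rewrite cImD cImN|exact: nm_Im].
by exists (Complex a b); apply/cvgC_ReIm.
Qed.

Lemma cvg_nm_sqr (u : nat -> C R) L : u @ \oo --> L ->
  (fun n => nm (u n) ^+ 2) @ \oo --> nm L ^+ 2.
Proof.
move=> /cvgC_ReIm[c1 c2]; rewrite nm_sqr; under eq_fun do rewrite nm_sqr.
by apply: cvgD; apply: cvgM.
Qed.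

Lemma cauchy_unimodular_cvg t : cauchy_unimodular t ->
  exists L : C R, nm L = 1 /\ F ^~ t @ \oo --> L.
Proof.
move=> [_ Ht].
have [|L cL] := @cauchyC_cvg (F ^~ t).
  move=> e e0; have [k hk] := inv_nat_lt (exprn_gt0 2 e0).
  have [N _ HN] := Ht k Logic.I; exists N => n Nn; have [h _] := HN n Nn.
  by rewrite -(@ltr_pXn2r _ 2) ?nnegrE ?nm_ge0 ?(ltW e0)//; exact: le_lt_trans h hk.
exists L; split=> //.
have c1 : (fun n => nm (F n t) ^+ 2) @ \oo --> (1 : R).
  apply/cvgrPdist_lt => e e0; have [k hk] := inv_nat_lt e0.
  have [N _ HN] := Ht k Logic.I; exists N => // n /= Nn; have [_ h] := HN n Nn.
  by rewrite distrC; exact: le_lt_trans h hk.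
have nL := cvg_unique _ (cvg_nm_sqr cL) c1.
by apply/eqP; rewrite -sqrp_eq1 ?nm_ge0//; apply/eqP; exact: nL.
Qed.

Lemma unimodular_sub : unimodular_set g `<=` cauchy_unimodular.
Proof.
move=> t [t01 [L [bL L1]]]; split; first by rewrite /= in_itv.
have cL : F ^~ t @ \oo --> L :=
  @cvg_comp _ _ _ (rho R) (fun r => g (RtoC r * circ t)) _ _ _ (@rho_left R) bL.
have nL : nm L = 1 by have := L1; rewrite normE => /(congr1 (@complex.Re R)).
move=> k _; have k0 : 0 < k.+1%:R^-1 :> R by rewrite invr_gt0 ltr0n.
have s0 : 0 < Num.sqrt k.+1%:R^-1 / 2 :> R by rewrite divr_gt0// sqrtr_gt0.
have /cvgC_eps/(_ _ s0)[N1 _ H1] := cL.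
have := cvg_nm_sqr cL; rewrite nL expr1n => /cvgrPdist_lt/(_ _ k0)[N2 _ H2].
exists (maxn N1 N2) => // n /=; rewrite geq_max => /andP[n1 n2]; split => /=.
  rewrite -[leRHS]sqr_sqrtr ?(ltW k0)// ler_pXn2r ?nnegrE ?nm_ge0 ?sqrtr_ge0//.
  have := H1 n n1; have := H1 _ (leq_maxl N1 N2) => /=.
  have := nm_sub (F n t - L) (F (maxn N1 N2) t - L).
  rewrite opprB addrA subrK; lra.
by rewrite distrC ltW//; exact: H2.
Qed.

(** Monotonicity comes from the underlying outer measure, because it is applied to [unimodular_set],
    whose measurability is not established. *)
Lemma le_lebesgue_measure (A B : set R) : A `<=` B -> (mu A <= mu B)%E.
Proof.
move=> AB; rewrite /lebesgue_measure /lebesgue_stieltjes_measure /measure_extension.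
by apply: le_mu_ext.
Qed.

Lemma compact_unimodular : (0 < mu (unimodular_set g))%E ->
  exists E : set R, [/\ compact E, E `<=` cauchy_unimodular & (0 < mu E)%E].
Proof.
move=> m0; have m1 : (0 < mu cauchy_unimodular)%E.
  by apply: (lt_le_trans m0); exact: le_lebesgue_measure unimodular_sub.
have mfin : (mu cauchy_unimodular < +oo)%E.
  apply: (@le_lt_trans _ _ (mu `[(0 : R), 1]%classic)); last by rewrite mu01 ltry.
  by apply: le_lebesgue_measure => t [/itvP h _]; rewrite /= in_itv /= !h.
have mD := measurable_cauchy_unimodular.
have fD : mu cauchy_unimodular \is a fin_num by rewrite ge0_fin_numE.
have d0 : 0 < fine (mu cauchy_unimodular) by rewrite fine_gt0// m1.
(* The tolerance is the full measure: a null [E] would leave a difference of that very measure,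
   against the strict bound. *)
have [E [cE sE lE]] := lebesgue_regularity_inner mD mfin d0.
exists E; split=> //; rewrite lt0e measure_ge0 andbT; apply/eqP => E0.
move: lE; rewrite fineK// measureD//; last exact: compact_measurable.
by rewrite setIidr// [X in (_ - X)%E](_ : _ = 0%E)// sube0 ltxx.
Qed.

End UnimodularBoundary.

(** The traces cut off by the indicator of [E] converge at every real [t], so their limit is
    measurable and bounded everywhere. *)
Lemma boundary_function (R : realType) (g : C R -> C R) (M : R) (E : set R) :
  (forall z, disc z -> derivable g z 1) -> (forall z, disc z -> nm (g z) <= M) ->
  measurable E -> E `<=` cauchy_unimodular g ->
  exists gs : R -> C R, [/\ good gs,
    forall t, E t -> (fun m => g (RtoC (rho R m) * circ t)) @ \oo --> gs t &
    forall t, E t -> nm (gs t) = 1].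
Proof.
move=> dg gM mE sE.
have rho0 n : 0 <= rho R n < 1 by have /andP[/ltW -> ->] := rho_itv R n.
pose F n := circle_trace g (rho R n).
have FM n t : nm (F n t) <= M.
  have /andP[r0 r1] := rho0 n.
  by apply/gM/discE; rewrite nmM nm_circ mulr1 nm_real ger0_norm.
have /choice[gs gsP] t : exists L : C R,
    (fun n => RtoC (\1_E t) * F n t) @ \oo --> L /\ (E t -> nm L = 1 /\ F ^~ t @ \oo --> L).
  have [Et|nEt] := pselect (E t).
    have [L [L1 cL]] := cauchy_unimodular_cvg (sE _ Et); exists L; split=> //.
    apply: cvg_trans cL; apply: near_eq_cvg; apply: nearW => n.
    by rewrite indicE mem_set// mul1r.
  exists 0; split=> //; under eq_fun do rewrite indicE memNset// mul0r.
  exact: cvg_cst.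
exists gs; split=> [|t Et|t Et]; last 2 first.
- by have [_ /(_ Et)[_]] := gsP t.
- by have [_ /(_ Et)[]] := gsP t.
apply: (@good_cvg _ (fun n t => RtoC (\1_E t) * F n t) _ M) => [n|n t|t].
- apply: goodM; first by apply: good_real; exact: bmf_indic.
  exact: (good_trace dg gM (rho0 n)).
- rewrite nmM nm_real indicE; case: (t \in E); rewrite ?normr1 ?mul1r// normr0 mul0r.
  exact: le_trans (nm_ge0 _) (FM n t).
- by have [] := gsP t.
Qed.

Theorem theorem1p9 (R : realType) (g : C R -> C R) :
  Hinfty g ->
  (exists z w, disc z /\ disc w /\ g z <> g w) ->
  (forall z, disc z -> ~ disc (g z)) ->
  (0 < (@lebesgue_measure R) (unimodular_set g))%E ->
  forall A : (nat -> C R) -> (nat -> C R),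
    is_Tg_adjoint g A -> weakly_hypercyclic A.
Proof.
move=> [dg [M gM0]] gnc gD m0 A hA.
have gM z : disc z -> nm (g z) <= M by move=> /gM0; rewrite normE lecR.
have g1 z : disc z -> 1 <= nm (g z).
  by move=> /gD ngz; rewrite leNgt; apply/negP => /discE.
have [E [cE sE muE]] := compact_unimodular dg gM m0.
have E01 t : E t -> 0 <= t < 1 by move=> /sE[+ _]; rewrite /= in_itv.
have [gs [gs_good gs_lim gs1]] := boundary_function dg gM (compact_measurable cE) sE.
have A_fc := iter_fc dg gM gs_good gs_lim hA.
have A_ip n k : exists T b, nb T b /\ forall p, H2 p -> iter n A p k = ip p T.
  exists (taylor (gmon g n k)), (M ^+ n); split; first exact: (gmon_nb dg gM).
  by move=> p Hp; exact: (iter_adjoint dg gM hA).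
have dec := decay dg g1 gnc gs_good gs_lim gs1.
have rl := riemann_lebesgue dg g1 gnc gs_good gs_lim gs1.
have rlc := riemann_lebesgue_conj dg g1 gnc gs_good gs_lim gs1.
have [U [gU sU dU]] := dense_sequence (dense_range cE E01 muE).
have gu := target_good gU; have su := target_supp sU.
have [f fP] := rec_choice
  (admissible_ex gs_good dec rl rlc gu su) (@admissible_local _ gs (target U)).
exists (xvec gs (target U) f); split.
  exact: nb_H2 (xvec_nb gs_good gu fP).
move=> y m e eps Hy He eps0.
have [n Hn] := orbit_approx gs_good gs1 A_fc A_ip gU sU dU fP Hy He eps0.
by exists n => i im; rewrite normC_lt; exact: Hn.
Qed.
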